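(* Let $0 < p_0 < p_1$ be real numbers and let $q_0 \in [0,1)$. There exist $\beta \in (0,1)$ and $\delta > 0$ such that the following holds: for every Borel set $E \subset [0,1]$ with $\mathcal{H}^{\beta}_{\infty}(E) \ge 1-\delta$ and for every pair $(p,q) \in \mathbb{R}^2$ with $p_0 \le |p| \le p_1$ and $|q| \le q_0$, there exist $x, t \in \mathbb{R}$ with $t \ne 0$ such that $$\{x,\; x+t,\; x + p t^2 + q t\} \subset E.$$
   Context: For $S \subset [0,1]$ and $\beta>0$, the Hausdorff content is $$\mathcal{H}^{\beta}_{\infty}(S) := \inf\left\{ \sum_i l(Q_i)^{\beta} : S \subset \bigcup_i Q_i,\ Q_i \subset [0,1] \right\},$$ where the infimum is over countable families of intervals $Q_i \subset [0,1]$ covering $S$ and $l(Q_i)$ is the length of $Q_i$. *)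

(* Defs.v *)
From mathcomp Require Import all_boot all_order all_algebra.
From mathcomp Require Import all_classical all_reals all_analysis.

Set Implicit Arguments.
Unset Strict Implicit.
Unset Printing Implicit Defensive.

Import Order.TTheory GRing.Theory Num.Theory.
Import numFieldNormedType.Exports.

Local Open Scope classical_set_scope.
Local Open Scope ring_scope.

(* Countable families are indexed by nat. Finite families are included: an
   interval may be empty (e.g. `]0, 0[), and an empty interval contributes
   0 `^ beta = 0 to the sum when 0 < beta. *)
Definition interval_cover01 (R : realType) (S : set R)
    (Q : nat -> interval R) : Prop :=
  (forall i, [set` Q i] `<=` `[0, 1]) /\ S `<=` \bigcup_i [set` Q i].

(* The length of an interval is its Lebesgue measure, cf. lebesgue_measure_itv. *)
Definition hausdorff_content (R : realType) (beta : R) (S : set R) : \bar R :=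
  ereal_inf [set (\sum_(i <oo) (lebesgue_measure [set` Q i] `^ beta))%E
            | Q in interval_cover01 S].

(* Main.v *)
Require Import Defs.
From mathcomp Require Import all_boot all_order all_algebra.
From mathcomp Require Import all_classical all_reals all_analysis.
From mathcomp Require Import zify ring lra.

Set Implicit Arguments.
Unset Strict Implicit.
Unset Printing Implicit Defensive.

Import Order.TTheory GRing.Theory Num.Theory.
Import numFieldNormedType.Exports.

Local Open Scope classical_set_scope.
Local Open Scope ring_scope.

(** Rescale to the integers: with [N = 4 ^ n], replace [x, x + t, x + p t^2 + q t]
    by integer patterns and consider the trilinear form that averages
    [f0 (x) f1 (x + t) f2 (x + floor (p t^2 / N + q t))]. Two applications of
    Cauchy-Schwarz remove [f0] and [f1] and leave four copies of [f2], whose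
    arguments are generically independent (the Jacobian is
    [(k2 - k1) (k3 - k1) (1 - k1 - k4)], with [ki] the slopes of the phase);
    so the form gains a power of the scale as soon as [f2] has mean zero on short
    intervals. When [f2] is instead
    coarse, summation by parts yields a gain from the cancellation in [f0] or
    [f1]. Telescoping over dyadic scales, a measure that is equal to Lebesgue
    measure down to scale [2 ^ - k0], and whose density at finer scales [2 ^ - k]
    grows at most like [g ^ k] with [g] close to [1], has patterns in its support.

    A content hypothesis with [beta] close to [1] gives every dyadic cell of
    level [k0] a fixed proportion of the maximal content, and Frostman's lemma
    then provides such measures on a compact subset of [E]. Compactness comes
    from capacitability of Souslin sets, applied not to the content itself but
    to a Hilbertian capacity on the dyadic tree that is comparable to it, up to
    a small loss in the exponent: there continuity along increasing sequences
    follows from the parallelogram identity. *)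

(** * Finite sums and sums over a period *)

(** The exponents follow one budget. Two applications of Cauchy-Schwarz leave a fourth power, so a
    gain [2 ^ - (4 r)] in the sum of the four copies is a gain [2 ^ - r] in the form, available as
    long as [32 r <= k]. With [s ^ 128 = 1/2] this is about [s ^ (4 k)]; splitting at level [k / 2]
    leaves [s ^ (2 k)], half of which pays for the growth [g ^ (3 k)] of three densities. Hence
    [g ^ 384 = 2]. The grid has [4 ^ n] points for densities of level [n], so that rounding the
    phase to integers is negligible at every level [k <= n]. The order of the choices is the real
    constraint: [k0] must beat the constant [C0] of the densities, while [beta] and [delta] depend
    on [k0]; so [C0] may not depend on [k0]. This is why Frostman's lemma is applied inside each
    cell of level [k0], with a lower bound for the rescaled content that is the same for all cells
    and all [k0]. A closed supporting set is needed because level [n] only yields three points that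
    form the pattern up to an error of order [2 ^ - n]. *)

Section FiniteSums.
Variable R : realFieldType.
Implicit Types (I : finType).

Lemma sqr_sum_le I (c : I -> R) :
  (\sum_i c i) ^+ 2 <= #|I|%:R * \sum_i c i ^+ 2.
Proof.
have h : 0 <= \sum_i \sum_j (c i - c j) ^+ 2.
  by apply: sumr_ge0 => i _; apply: sumr_ge0 => j _; exact: sqr_ge0.
have e : \sum_i \sum_j (c i - c j) ^+ 2 =
    2 * (#|I|%:R * (\sum_i c i ^+ 2) - (\sum_i c i) ^+ 2).
  transitivity (\sum_i (#|I|%:R * c i ^+ 2 - 2 * c i * (\sum_j c j)
      + \sum_j c j ^+ 2)).
    apply: eq_bigr => i _.
    transitivity (\sum_j (c i ^+ 2 - 2 * c i * c j + c j ^+ 2)).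
      by apply: eq_bigr => j _; ring.
    rewrite !big_split /= sumr_const sumrN -mulr_sumr.
    by rewrite -(mulr_natl (c i ^+ 2)).
  rewrite !big_split /= sumr_const sumrN -mulr_suml -!mulr_sumr.
  by rewrite -(mulr_natl (\sum_j _)); ring.
by move: h; rewrite e; lra.
Qed.

Lemma sqr_sum_mul_le I (a b : I -> R) : (forall i, `|a i| <= 1) ->
  (\sum_i a i * b i) ^+ 2 <= #|I|%:R * \sum_i b i ^+ 2.
Proof.
move=> a1; apply: le_trans (sqr_sum_le _) _.
apply: ler_wpM2l => //; apply: ler_sum => i _.
rewrite exprMn -[leRHS]mul1r; apply: ler_wpM2r; first exact: sqr_ge0.
by rewrite -real_normK ?num_real// expr_le1.
Qed.

Lemma sum_blocks (D B : nat) (F : nat -> R) :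
  \sum_(t < D * B) F t = \sum_(i < D) \sum_(r < B) F (i * B + r)%N.
Proof.
elim: D => [|D IH]; first by rewrite mul0n !big_ord0.
rewrite big_ord_recr /= -IH mulSn addnC big_split_ord /=.
by [].
Qed.

(** Counts the boxes discarded from the cube sum: once the other indices are fixed, they lie in
    short windows of integers. *)
Lemma count_window (D w : nat) (c : int) (P : pred nat) :
  (forall i, P i -> c <= i%:Z < c + w%:Z) ->
  \sum_(i < D) (P i)%:R <= w%:R :> R.
Proof.
elim: w P => [|w IH] P hP.
  rewrite big1 // => i _; case: (boolP (P i)) => // /hP; lia.
have -> : \sum_(i < D) (P i)%:R =
  \sum_(i < D) ((P i && (i%:Z != c + w%:Z))%:R : R)
  + \sum_(i < D) ((P i && (i%:Z == c + w%:Z))%:R : R).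
  rewrite -big_split /=; apply: eq_bigr => i _.
  by case: (P i); case: eqP => _ //=; rewrite ?addr0 ?add0r.
rewrite -natr1; apply: lerD.
  by apply: (IH (fun i => P i && (i%:Z != c + w%:Z))) => i /andP[/hP]; lia.
case: (boolP [exists i : 'I_D, i%:Z == c + w%:Z]) => [/existsP[i0 /eqP e0]|].
  rewrite (bigD1 i0) //= big1 ?addr0; first by rewrite lern1 leq_b1.
  move=> i ni; case: eqP => [e|]; last by rewrite andbF.
  case/eqP: ni; apply: val_inj => /=; lia.
rewrite negb_exists => /forallP h; rewrite big1 // => i _.
by rewrite (negbTE (h i)) andbF.
Qed.

Lemma prod4_dist (a b c d a' b' c' d' : R) :
  `|a| <= 1 -> `|b| <= 1 -> `|c| <= 1 -> `|b'| <= 1 -> `|c'| <= 1 ->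
  `|d| <= 1 -> `|a'| <= 1 ->
  `|a * b * c * d - a' * b' * c' * d'| <=
  `|a - a'| + `|b - b'| + `|c - c'| + `|d - d'|.
Proof.
move=> ha hb hc hb' hc' hd ha'.
have -> : a * b * c * d - a' * b' * c' * d' =
  (a - a') * (b * c * d) + a' * ((b - b') * (c * d))
  + a' * b' * ((c - c') * d) + a' * b' * c' * (d - d') by ring.
have n2 (x y : R) : `|y| <= 1 -> `|x * y| <= `|x|.
  by move=> hy; rewrite normrM ler_piMr.
have n3 (x y : R) : `|x| <= 1 -> `|y| <= 1 -> `|x * y| <= 1.
  by move=> hx hy; rewrite normrM mulr_ile1.
have n4 (x y : R) : `|x| <= 1 -> `|x * y| <= `|y|.
  by move=> hy; rewrite normrM ler_piMl.
apply: le_trans (ler_normD _ _) _; apply: lerD; last first.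
  by apply: (n4); apply: (n3) => //; apply: (n3).
apply: le_trans (ler_normD _ _) _; apply: lerD; last first.
  apply: le_trans (n4 _ _ _) _; [exact: n3|exact: n2].
apply: le_trans (ler_normD _ _) _; apply: lerD.
  by apply: (n2); apply: (n3) => //; apply: (n3).
by apply: le_trans (n4 _ _ ha') _; apply: (n2); apply: (n3).
Qed.

(** A shift by one step telescopes to two boundary terms, whatever the length of the window. *)
Lemma window_shift (h : int -> R) (H : R) (B : nat) (b d : int) :
  (forall x, `|h x| <= H) ->
  `|\sum_(r < B) h (b + d + r%:Z) - \sum_(r < B) h (b + r%:Z)|
    <= 2 * `|d|%:~R * H.
Proof.
move=> hH.
have pos (b' : int) (n : nat) :
    `|\sum_(r < B) h (b' + n%:Z + r%:Z) - \sum_(r < B) h (b' + r%:Z)|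
      <= 2 * n%:R * H.
  elim: n => [|n IH].
    by rewrite addr0 subrr normr0 mulr0 mul0r.
  have -> : 2 * n.+1%:R * H = 2 * n%:R * H + 2 * H by rewrite -natr1; ring.
  apply: le_trans (ler_distD (\sum_(r < B) h (b' + n%:Z + r%:Z)) _ _) _.
  rewrite addrC; apply: lerD; first exact: IH.
  have -> : \sum_(r < B) h (b' + n.+1%:Z + r%:Z) =
      \sum_(r < B) h (b' + n%:Z + r.+1%:Z).
    by apply: eq_bigr => r _; congr h; lia.
  have tel : \sum_(r < B) h (b' + n%:Z + r.+1%:Z) -
      \sum_(r < B) h (b' + n%:Z + r%:Z) = h (b' + n%:Z + B%:Z) - h (b' + n%:Z).
    elim: B {IH} => [|B' IHB]; first by rewrite !big_ord0 addr0 !subrr.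
    rewrite !big_ord_recr /=; move: IHB.
    set S1 := \sum_(_ < _) _; set S2 := \sum_(_ < _) _ => IHB.
    by lra.
  rewrite tel; apply: le_trans (ler_normB _ _) _.
  by rewrite mulr2n mulrDl mul1r; apply: lerD.
case: (intP d) => [|n|n].
- by rewrite addr0 subrr normr0 mulr0z mulr0 mul0r.
- exact: pos.
- rewrite distrC normrN.
  have := pos (b - n.+1%:Z) n.+1.
  by rewrite subrK.
Qed.

End FiniteSums.

Section Cyclic.
Variable R : realFieldType.
Variable m : nat.
Hypothesis m0 : (0 < m)%N.
Implicit Types (f g h : int -> R).

Definition periodic (f : int -> R) := forall x, f (x + m%:Z) = f x.

Definition csum (f : int -> R) := \sum_(i < m) f i%:Z.

Lemma csum_shift f c : periodic f -> csum (fun x => f (x + c)) = csum f.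
Proof.
move=> pf.
have s1 g : periodic g -> csum (fun x => g (x + 1)) = csum g.
  move=> pg; have := pg 0; rewrite /csum; case: m m0 => // m' _ pg0.
  rewrite big_ord_recr [RHS]big_ord_recl /= addrC; congr (_ + _).
    by rewrite -pg0; congr g; lia.
  by apply: eq_bigr => i _; congr g; rewrite /bump /=; lia.
have pos (n : nat) g : periodic g -> csum (fun x => g (x + n%:Z)) = csum g.
  move=> pg; elim: n => [|n IH].
    by apply: eq_bigr => i _; rewrite addr0.
  rewrite -IH -(s1 (fun x => g (x + n%:Z))).
    by apply: eq_bigr => i _; congr g; lia.
  by move=> x; rewrite -(pg (x + n%:Z)); congr g; lia.
case: (intP c) => [|n|n].
- by apply: eq_bigr => i _; rewrite addr0.
- exact: pos.
- rewrite -(pos n.+1 (fun x => f (x - n.+1%:Z))).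
    by apply: eq_bigr => i _; congr f; lia.
  by move=> x; rewrite -(pf (x - n.+1%:Z)); congr f; lia.
Qed.

Lemma eq_csum f g : f =1 g -> csum f = csum g.
Proof. by move=> e; apply: eq_bigr => i _; rewrite e. Qed.

Lemma csum_le f g : (forall x, f x <= g x) -> csum f <= csum g.
Proof. by move=> h; apply: ler_sum => i _; apply: h. Qed.

Lemma csumD f g : csum (fun x => f x + g x) = csum f + csum g.
Proof. exact: big_split. Qed.

Lemma csum_sum (I : finType) (P : pred I) (F : I -> int -> R) :
  csum (fun x => \sum_(i | P i) F i x) = \sum_(i | P i) csum (F i).
Proof. exact: exchange_big. Qed.

Lemma csumZ a f : csum (fun x => a * f x) = a * csum f.
Proof. by rewrite /csum mulr_sumr. Qed.

Lemma csum_norm f : `|csum f| <= csum (fun x => `|f x|).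
Proof. exact: ler_norm_sum. Qed.

Lemma csum_bound f (H : R) : (forall x, `|f x| <= H) -> `|csum f| <= m%:R * H.
Proof.
move=> h; apply: le_trans (csum_norm _) _.
apply: (le_trans (csum_le (g := fun=> H) h)).
by rewrite /csum sumr_const card_ord mulr_natl.
Qed.

Definition variation f := csum (fun x => `|f (x + 1) - f x|).

Lemma variation_shift f (c e : int) : periodic f ->
  csum (fun x => `|f (x + c + e) - f (x + c)|) <= `|e|%:~R * variation f.
Proof.
move=> pf.
have p1 : periodic (fun x => `|f (x + 1) - f x|).
  by move=> x /=; rewrite pf -addrA (addrC m%:Z) addrA pf.
have pos (n : nat) c' :
    csum (fun x => `|f (x + c' + n%:Z) - f (x + c')|) <= n%:R * variation f.
  elim: n => [|n IH].
    rewrite mul0r /csum big1// => i _; by rewrite addr0 subrr normr0.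
  have -> : n.+1%:R * variation f = n%:R * variation f + variation f
    by rewrite -natr1; ring.
  apply: (@le_trans _ _ (csum (fun x => `|f (x + c' + n%:Z) - f (x + c')| +
     `|f (x + (c' + n%:Z) + 1) - f (x + (c' + n%:Z))|))).
    apply: csum_le => x.
    have := ler_distD (f (x + c' + n%:Z)) (f (x + c' + n.+1%:Z)) (f (x + c')).
    rewrite [X in _ <= X]addrC; congr (_ <= _ + `|f _ - f _|); lia.
  rewrite csumD; apply: lerD => //.
  by rewrite (csum_shift (c' + n%:Z) p1).
case: (intP e) => [|n|n].
- by have := pos 0%N c.
- exact: pos.
- have := pos n.+1 (c - n.+1%:Z); congr (_ <= _ * _).
  by apply: eq_csum => x; rewrite distrC; congr `|f _ - f _|; lia.
Qed.

End Cyclic.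

(** * Two Cauchy-Schwarz inequalities *)

Section TwoCauchySchwarz.
Variable R : realFieldType.
Variables (m T : nat) (A : int) (Q : int -> int).
Hypothesis m0 : (0 < m)%N.

(** The step of the pattern is [A + t]; the offset [A] keeps it away from zero and from the values
    at which the phase degenerates. In the application [Q t] is the phase at [A + t]. *)
Definition trilinear (f0 f1 f2 : int -> R) :=
  csum m (fun x => \sum_(t < T) f0 x * f1 (x + A + t%:Z) * f2 (x + Q t%:Z)).

(** The four copies of [f2] that survive both inequalities, translated so that the first argument is
    [x + Q X1]. The fourth step is forced by the equality of the differences [t2 - t1 = t4 - t3]. *)
Definition cube (f : int -> R) (X1 X2 X3 x : int) : R :=
  f (x + Q X1) * f (x + Q X2) * f (x + X1 - X3 + Q X3) *
  f (x + X1 - X3 + Q (X2 + X3 - X1)).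

Definition cube_sum (f : int -> R) :=
  \sum_(t1 < T) \sum_(t2 < T) \sum_(t3 < T)
    if (0 <= t2%:Z + t3%:Z - t1%:Z < T%:Z)
    then csum m (cube f t1%:Z t2%:Z t3%:Z) else 0.

Lemma sum_pick (n a : nat) (X : nat -> R) : (a < n)%N ->
  \sum_(h < n) (h == a :> nat)%:R * X h = X a.
Proof.
move=> an; rewrite (bigD1 (Ordinal an)) //= eqxx mul1r big1 ?addr0// => i ni.
case: eqP => [e|]; last by rewrite mul0r.
by case/eqP: ni; apply: val_inj.
Qed.

(** Cauchy-Schwarz in [x] removes [f0]; the substitution [u = x + A + t] then makes the two copies
    of [f1] depend only on [u] and on the difference of the two steps. *)
Lemma trilinear_sqr f0 f1 f2 :
  periodic m f1 -> periodic m f2 -> (forall x, `|f0 x| <= 1) ->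
  trilinear f0 f1 f2 ^+ 2 <= m%:R * \sum_(p : 'I_T * 'I_T)
    csum m (fun u => f1 u * f1 (u + p.2%:Z - p.1%:Z) *
     (f2 (u - A - p.1%:Z + Q p.1%:Z) * f2 (u - A - p.1%:Z + Q p.2%:Z))).
Proof.
move=> p1 p2 b0.
pose g x := \sum_(t < T) f1 (x + A + t%:Z) * f2 (x + Q t%:Z).
have -> : trilinear f0 f1 f2 = \sum_(i < m) f0 i%:Z * g i%:Z.
  apply: eq_bigr => i _; rewrite mulr_sumr; apply: eq_bigr => t _.
  by rewrite mulrA.
apply: le_trans (sqr_sum_mul_le _ _) _; first by move=> i; apply: b0.
rewrite card_ord; apply: ler_wpM2l => //.
rewrite le_eqVlt; apply/orP; left; apply/eqP.
rewrite -(pair_bigA _ (fun t t' : 'I_T => csum m (fun u => f1 u * f1 (u + t'%:Z - t%:Z) *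
     (f2 (u - A - t%:Z + Q t%:Z) * f2 (u - A - t%:Z + Q t'%:Z))))) /=.
transitivity (csum m (fun x => \sum_(t < T) \sum_(t' < T)
    (f1 (x + A + t%:Z) * f2 (x + Q t%:Z)) *
    (f1 (x + A + t'%:Z) * f2 (x + Q t'%:Z)))).
  by apply: eq_bigr => i _; rewrite expr2 /g big_distrlr.
rewrite csum_sum; apply: eq_bigr => t _.
rewrite csum_sum; apply: eq_bigr => t' _.
pose F u := f1 u * f1 (u + t'%:Z - t%:Z) *
     (f2 (u - A - t%:Z + Q t%:Z) * f2 (u - A - t%:Z + Q t'%:Z)).
rewrite -[RHS](@csum_shift _ _ m0 F (A + t%:Z)).
  apply: eq_csum => x; rewrite /F mulrACA.
  by congr (f1 _ * f1 _ * (f2 _ * f2 _)); lia.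
move=> x; rewrite /F.
congr (_ * _ * (_ * _)); first exact: p1.
- by rewrite -[RHS]p1; congr f1; lia.
- by rewrite -[RHS]p2; congr f2; lia.
- by rewrite -[RHS]p2; congr f2; lia.
Qed.

(** For a fixed [u] and a fixed difference of the two steps, the product of the two [f1] is one
    bounded factor; Cauchy-Schwarz over these [2 T m] pairs removes it. Squaring the inner sum pairs
    up [(t1, t2)] and [(t3, t4)] with equal differences. *)
Lemma trilinear_pow4 f0 f1 f2 :
  periodic m f1 -> periodic m f2 ->
  (forall x, `|f0 x| <= 1) -> (forall x, `|f1 x| <= 1) ->
  trilinear f0 f1 f2 ^+ 4 <= 2 * T%:R * m%:R ^+ 3 * cube_sum f2.
Proof.
move=> p1 p2 b0 b1.
have sq := trilinear_sqr p1 p2 b0.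
pose w (u : int) (p : 'I_T * 'I_T) :=
  f2 (u - A - p.1%:Z + Q p.1%:Z) * f2 (u - A - p.1%:Z + Q p.2%:Z).
set S := (X in m%:R * X) in sq.
(* The index [hu.1] stands for the difference of the steps plus [T], which keeps it a natural
   number. *)
pose a (hu : 'I_(2 * T) * 'I_m) :=
  f1 hu.2%:Z * f1 (hu.2%:Z + hu.1%:Z - T%:Z).
pose Phi (hu : 'I_(2 * T) * 'I_m) : R :=
  \sum_(p : 'I_T * 'I_T) (hu.1 == p.2 + T - p.1 :> nat)%N%:R * w hu.2%:Z p.
have eS : S = \sum_hu a hu * Phi hu.
  transitivity (\sum_(hu : 'I_(2 * T) * 'I_m) \sum_(p : 'I_T * 'I_T)
     (hu.1 == p.2 + T - p.1 :> nat)%N%:R * (a hu * w hu.2%:Z p)); last first.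
    apply: eq_bigr => hu _; rewrite mulr_sumr; apply: eq_bigr => p _; ring.
  rewrite exchange_big; apply: eq_bigr => -[t t'] _ /=.
  rewrite -(pair_bigA _ (fun (h : 'I_(2 * T)) (u : 'I_m) =>
     (h == t' + T - t :> nat)%N%:R * (a (h, u) * w u%:Z (t, t')))) /=.
  rewrite exchange_big; apply: eq_bigr => u _ /=.
  have lt : (t' + T - t < 2 * T)%N.
    by have := ltn_ord t; have := ltn_ord t'; lia.
  rewrite (sum_pick (fun h => f1 u%:Z * f1 (u%:Z + h%:Z - T%:Z) * w u%:Z (t, t')) lt).
  by congr (_ * f1 _ * _); have := ltn_ord t; lia.
have sq2 : S ^+ 2 <= (2 * T * m)%:R * \sum_hu Phi hu ^+ 2.
  rewrite eS; apply: le_trans (sqr_sum_mul_le _ _) _.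
    by move=> hu; rewrite normrM mulr_ile1.
  by rewrite card_prod !card_ord.
have eJ : \sum_hu Phi hu ^+ 2 = cube_sum f2.
  transitivity (\sum_(p : 'I_T * 'I_T) \sum_(q : 'I_T * 'I_T)
     (p.2 + q.1 == q.2 + p.1)%N%:R * csum m (fun u => w u p * w u q)).
    transitivity (\sum_(hu : 'I_(2 * T) * 'I_m) \sum_(p : 'I_T * 'I_T)
       \sum_(q : 'I_T * 'I_T) (hu.1 == p.2 + T - p.1 :> nat)%N%:R *
        ((hu.1 == q.2 + T - q.1 :> nat)%N%:R * (w hu.2%:Z p * w hu.2%:Z q))).
      apply: eq_bigr => hu _; rewrite expr2 /Phi big_distrlr /=.
      by apply: eq_bigr => p _; apply: eq_bigr => q _; rewrite mulrACA -mulrA.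
    rewrite exchange_big; apply: eq_bigr => -[t1 t2] _ /=.
    rewrite exchange_big; apply: eq_bigr => -[t3 t4] _ /=.
    rewrite -(pair_bigA _ (fun (h : 'I_(2 * T)) (u : 'I_m) =>
     (h == t2 + T - t1 :> nat)%N%:R *
        ((h == t4 + T - t3 :> nat)%N%:R * (w u%:Z (t1, t2) * w u%:Z (t3, t4))))) /=.
    rewrite exchange_big /csum mulr_sumr; apply: eq_bigr => u _ /=.
    have := (ltn_ord t1, ltn_ord t2, ltn_ord t3, ltn_ord t4) => -[[[l1 l2] l3] l4].
    have lt : (t2 + T - t1 < 2 * T)%N by lia.
    rewrite (sum_pick (fun h => ((h == t4 + T - t3 :> nat)%N%:R *
       (w u%:Z (t1, t2) * w u%:Z (t3, t4)))) lt).
    by congr (_ * _); congr (nat_of_bool _)%:R; apply/eqP/eqP; lia.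
  rewrite -(pair_bigA _ (fun t1 t2 : 'I_T => \sum_(q : 'I_T * 'I_T)
     (t2 + q.1 == q.2 + t1)%N%:R * csum m (fun u => w u (t1, t2) * w u q))) /=.
  apply: eq_bigr => t1 _; apply: eq_bigr => t2 _.
  rewrite -(pair_bigA _ (fun t3 t4 : 'I_T =>
     (t2 + t3 == t4 + t1)%N%:R * csum m (fun u => w u (t1, t2) * w u (t3, t4)))) /=.
  apply: eq_bigr => t3 _.
  case: ifP => [/andP[c1 c2]|c]; last first.
    rewrite big1 // => t4 _; case: eqP => [e|]; last by rewrite mul0r.
    by move: c (ltn_ord t4); lia.
  have lt : (t2 + t3 - t1 < T)%N by lia.
  transitivity (\sum_(t4 < T) (t4 == t2 + t3 - t1 :> nat)%N%:R *
     csum m (cube f2 t1%:Z t2%:Z t3%:Z)); last first.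
    by rewrite (sum_pick (fun _ => csum m (cube f2 t1%:Z t2%:Z t3%:Z)) lt).
  apply: eq_bigr => t4 _.
  have -> : (t2 + t3 == t4 + t1)%N = (t4 == t2 + t3 - t1 :> nat)%N.
    by apply/eqP/eqP; lia.
  case: eqP => [e|]; last by rewrite !mul0r.
  congr (_ * _).
  rewrite -(@csum_shift _ _ m0 (fun u => w u (t1, t2) * w u (t3, t4)) (A + t1%:Z)).
    apply: eq_csum => x; rewrite /w /cube /= mulrA.
    by congr (f2 _ * f2 _ * f2 _ * f2 _); [lia|lia|lia|
      have -> : t2%:Z + t3%:Z - t1%:Z = t4%:Z by lia]; lia.
  by move=> x; rewrite /w; congr (_ * _ * (_ * _));
    rewrite -[RHS]p2; congr f2; lia.
have S0 : 0 <= m%:R * S by apply: le_trans sq; exact: sqr_ge0.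
have -> : trilinear f0 f1 f2 ^+ 4 = (trilinear f0 f1 f2 ^+ 2) ^+ 2.
  by rewrite -exprM.
apply: (@le_trans _ _ ((m%:R * S) ^+ 2)).
  by apply: lerXn2r; rewrite // nnegrE ?sqr_ge0.
rewrite exprMn -eJ.
have -> : 2 * T%:R * m%:R ^+ 3 * \sum_hu Phi hu ^+ 2 =
   m%:R ^+ 2 * ((2 * T * m)%:R * \sum_hu Phi hu ^+ 2) by rewrite !natrM; ring.
by apply: ler_wpM2l => //; apply: sqr_ge0.
Qed.

End TwoCauchySchwarz.

(** * Averaging over translations of a box of parameters *)

Section Box.
Variable R : realFieldType.
Variables (m : nat) (Q : int -> int) (f : int -> R) (V G : R).
Hypothesis m0 : (0 < m)%N.
Hypothesis pf : periodic m f.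
Hypothesis f1 : forall x, `|f x| <= 1.
Hypothesis fV : variation m f <= V.
Hypothesis fG : forall (a : int) (n : nat), `|\sum_(i < n) f (a + i%:Z)| <= G.

Local Notation H X1 X2 X3 := (csum m (cube Q f X1 X2 X3)).

Lemma cube_periodic X1 X2 X3 : periodic m (cube Q f X1 X2 X3).
Proof.
by move=> x; rewrite /cube; congr (_ * _ * _ * _); rewrite -[RHS]pf; congr f; lia.
Qed.

Lemma cube_le1 X1 X2 X3 x : `|cube Q f X1 X2 X3 x| <= 1.
Proof. by rewrite /cube !normrM; do 3![apply: mulr_ile1; rewrite ?mulr_ge0 ?f1//]. Qed.

Lemma csum_cube_le X1 X2 X3 : `|H X1 X2 X3| <= m%:R.
Proof.
rewrite -[leRHS]mulr1; apply: csum_bound => x; exact: cube_le1.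
Qed.

Definition box_sum (B : nat) (b1 b2 b3 : int) :=
  \sum_(r1 < B) \sum_(r2 < B) \sum_(r3 < B)
     H (b1 + r1%:Z) (b2 + r2%:Z) (b3 + r3%:Z).

Lemma sum_cst_le (n : nat) (F : nat -> R) (c : R) :
  (forall i, (i < n)%N -> `|F i| <= c) -> `|\sum_(i < n) F i| <= n%:R * c.
Proof.
move=> h; apply: le_trans (ler_norm_sum _ _ _) _.
apply: (@le_trans _ _ (\sum_(i < n) c)); first by apply: ler_sum => i _; apply: h.
by rewrite sumr_const card_ord mulr_natl.
Qed.

Lemma box_sum_shift B b1 b2 b3 d1 d2 d3 (dm : R) :
  `|d1|%:~R <= dm -> `|d2|%:~R <= dm -> `|d3|%:~R <= dm ->
  `|box_sum B (b1 + d1) (b2 + d2) (b3 + d3) - box_sum B b1 b2 b3|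
     <= 6 * dm * B%:R ^+ 2 * m%:R.
Proof.
move=> h1 h2 h3.
have m0' : 0 <= m%:R :> R by [].
have B0' : 0 <= B%:R :> R by [].
have e : 6 * dm * B%:R ^+ 2 * m%:R = 2 * dm * (B%:R * (B%:R * m%:R)) +
  (B%:R * (2 * dm * (B%:R * m%:R)) + B%:R * (B%:R * (2 * dm * m%:R))) by ring.
rewrite e.
apply: le_trans (ler_distD (box_sum B b1 (b2 + d2) (b3 + d3)) _ _) _.
apply: lerD.
  rewrite /box_sum.
  apply: (@le_trans _ _ (2 * `|d1|%:~R * (B%:R * (B%:R * m%:R)))); last first.
    by rewrite ler_wpM2r ?mulr_ge0// ler_wpM2l.
  apply: (window_shift (h := fun X => \sum_(r2 < B) \sum_(r3 < B)
     H X (b2 + d2 + r2%:Z) (b3 + d3 + r3%:Z))) => x.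
  apply: (sum_cst_le (F := fun r2 : nat => \sum_(r3 < B)
     H x (b2 + d2 + r2%:Z) (b3 + d3 + r3%:Z))) => i _.
  apply: (sum_cst_le (F := fun r3 : nat =>
     H x (b2 + d2 + i%:Z) (b3 + d3 + r3%:Z))) => j _.
  exact: csum_cube_le.
apply: le_trans (ler_distD (box_sum B b1 b2 (b3 + d3)) _ _) _.
apply: lerD.
  rewrite /box_sum -sumrB.
  apply: (sum_cst_le (F := fun r1 : nat => (\sum_(r2 < B) \sum_(r3 < B)
     H (b1 + r1%:Z) (b2 + d2 + r2%:Z) (b3 + d3 + r3%:Z)) -
     \sum_(r2 < B) \sum_(r3 < B)
     H (b1 + r1%:Z) (b2 + r2%:Z) (b3 + d3 + r3%:Z))) => i _.
  apply: (@le_trans _ _ (2 * `|d2|%:~R * (B%:R * m%:R))); last first.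
    by rewrite ler_wpM2r ?mulr_ge0// ler_wpM2l.
  apply: (window_shift (h := fun X => \sum_(r3 < B)
     H (b1 + i%:Z) X (b3 + d3 + r3%:Z))) => x.
  apply: (sum_cst_le (F := fun r3 : nat =>
     H (b1 + i%:Z) x (b3 + d3 + r3%:Z))) => j _.
  exact: csum_cube_le.
rewrite /box_sum -sumrB.
apply: (sum_cst_le (F := fun r1 : nat => (\sum_(r2 < B) \sum_(r3 < B)
     H (b1 + r1%:Z) (b2 + r2%:Z) (b3 + d3 + r3%:Z)) -
     \sum_(r2 < B) \sum_(r3 < B)
     H (b1 + r1%:Z) (b2 + r2%:Z) (b3 + r3%:Z))) => i _.
rewrite -sumrB.
apply: (sum_cst_le (F := fun r2 : nat => (\sum_(r3 < B)
     H (b1 + i%:Z) (b2 + r2%:Z) (b3 + d3 + r3%:Z)) -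
     \sum_(r3 < B) H (b1 + i%:Z) (b2 + r2%:Z) (b3 + r3%:Z))) => j _.
apply: (@le_trans _ _ (2 * `|d3|%:~R * m%:R)); last first.
  by rewrite ler_wpM2r ?mulr_ge0// ler_wpM2l.
apply: (window_shift (h := fun X => H (b1 + i%:Z) (b2 + j%:Z) X)) => x.
exact: csum_cube_le.
Qed.

(** If the displacement [(dx, d1, d2, d3)] fixes three arguments and translates the fourth by [k],
    up to errors of size [er], each error costs [er * V] once summed over a period. *)
Lemma cube_shift (X1 X2 X3 dx d1 d2 d3 k : int) (er : R) :
  let X4 := X2 + X3 - X1 in
  `|dx + Q (X1 + d1) - Q X1|%:~R <= er ->
  `|dx + Q (X2 + d2) - Q X2|%:~R <= er ->
  `|dx + d1 - d3 + Q (X3 + d3) - Q X3|%:~R <= er ->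
  `|dx + d1 - d3 + Q (X4 + (d2 + d3 - d1)) - Q X4 - k|%:~R <= er ->
  `|H (X1 + d1) (X2 + d2) (X3 + d3) -
    csum m (fun x => f (x + Q X1) * f (x + Q X2) * f (x + X1 - X3 + Q X3) *
      f (x + X1 - X3 + Q X4 + k))| <= 4 * er * V.
Proof.
move=> X4 h1 h2 h3 h4.
rewrite -(csum_shift m0 dx (@cube_periodic (X1 + d1) (X2 + d2) (X3 + d3))).
rewrite /csum -sumrB.
have V0 : 0 <= variation m f by apply: sumr_ge0.
have er0 : 0 <= er by apply: le_trans h1; rewrite ler0z.
have piece (c e : int) : `|e|%:~R <= er ->
    csum m (fun x => `|f (x + c + e) - f (x + c)|) <= er * V.
  move=> he; apply: le_trans (variation_shift m0 c e pf) _.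
  apply: (@le_trans _ _ (er * variation m f)); first exact: ler_wpM2r.
  exact: ler_wpM2l.
have -> : 4 * er * V = er * V + er * V + er * V + er * V by ring.
apply: le_trans (csum_norm _ (fun x => cube Q f (X1 + d1) (X2 + d2) (X3 + d3) (x + dx) -
   f (x + Q X1) * f (x + Q X2) * f (x + X1 - X3 + Q X3) *
      f (x + X1 - X3 + Q X4 + k))) _.
have p1 := piece (Q X1) _ h1.
have p2 := piece (Q X2) _ h2.
have p3 := piece (X1 - X3 + Q X3) _ h3.
have p4 := piece (X1 - X3 + Q X4 + k) _ h4.
apply: le_trans (lerD (lerD (lerD p1 p2) p3) p4).
rewrite -!csumD; apply: csum_le => x; rewrite /cube.
rewrite (_ : X2 + d2 + (X3 + d3) - (X1 + d1) = X4 + (d2 + d3 - d1)); last first.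
  by rewrite /X4; ring.
rewrite (_ : x + dx + Q (X1 + d1) = x + Q X1 + (dx + Q (X1 + d1) - Q X1)); last by ring.
rewrite (_ : x + dx + Q (X2 + d2) = x + Q X2 + (dx + Q (X2 + d2) - Q X2)); last by ring.
rewrite (_ : x + dx + (X1 + d1) - (X3 + d3) + Q (X3 + d3) =
  x + (X1 - X3 + Q X3) + (dx + d1 - d3 + Q (X3 + d3) - Q X3)); last by ring.
rewrite (_ : x + dx + (X1 + d1) - (X3 + d3) + Q (X4 + (d2 + d3 - d1)) =
  x + (X1 - X3 + Q X4 + k) +
    (dx + d1 - d3 + Q (X4 + (d2 + d3 - d1)) - Q X4 - k)); last by ring.
rewrite (_ : x + X1 - X3 + Q X4 + k = x + (X1 - X3 + Q X4 + k)); last by ring.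
rewrite (_ : x + X1 - X3 + Q X3 = x + (X1 - X3 + Q X3)); last by ring.
by apply: prod4_dist; rewrite ?f1.
Qed.

(** Each of the [M] displacements changes the box sum little, and after averaging over [k] only the
    fourth factor depends on [k]: its sum is a window sum of [f], bounded by [G]. This is the only
    place where the cancellation in [f] enters. *)
Lemma box_sum_bound (B M : nat) (b1 b2 b3 : int) (dx d1 d2 d3 : nat -> int)
    (er dm : R) :
  (forall k, (k < M)%N -> [/\ `|d1 k|%:~R <= dm, `|d2 k|%:~R <= dm & `|d3 k|%:~R <= dm]) ->
  (forall k r1 r2 r3, (k < M)%N -> (r1 < B)%N -> (r2 < B)%N -> (r3 < B)%N ->
    let X1 := b1 + r1%:Z in let X2 := b2 + r2%:Z in let X3 := b3 + r3%:Z in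
    let X4 := X2 + X3 - X1 in
    [/\ `|dx k + Q (X1 + d1 k) - Q X1|%:~R <= er,
     `|dx k + Q (X2 + d2 k) - Q X2|%:~R <= er,
     `|dx k + d1 k - d3 k + Q (X3 + d3 k) - Q X3|%:~R <= er &
     `|dx k + d1 k - d3 k + Q (X4 + (d2 k + d3 k - d1 k)) - Q X4 - k%:Z|%:~R <= er]) ->
  M%:R * `|box_sum B b1 b2 b3| <=
    M%:R * (6 * dm * B%:R ^+ 2 * m%:R + 4 * er * V * B%:R ^+ 3)
    + B%:R ^+ 3 * m%:R * G.
Proof.
move=> hd he.
pose F (k r1 r2 r3 : nat) x :=
  let X1 := b1 + r1%:Z in let X2 := b2 + r2%:Z in let X3 := b3 + r3%:Z in
  f (x + Q X1) * f (x + Q X2) * f (x + X1 - X3 + Q X3) *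
      f (x + X1 - X3 + Q (X2 + X3 - X1) + k%:Z).
pose S k := \sum_(r1 < B) \sum_(r2 < B) \sum_(r3 < B) csum m (F k r1 r2 r3).
have dS k : (k < M)%N -> `|box_sum B b1 b2 b3 - S k| <=
    6 * dm * B%:R ^+ 2 * m%:R + 4 * er * V * B%:R ^+ 3.
  move=> kM; have [e1 e2 e3] := hd k kM.
  apply: le_trans (ler_distD (box_sum B (b1 + d1 k) (b2 + d2 k) (b3 + d3 k)) _ _) _.
  apply: lerD; first by rewrite distrC; apply: box_sum_shift.
  rewrite (_ : 4 * er * V * B%:R ^+ 3 = B%:R * (B%:R * (B%:R * (4 * er * V)))); last by ring.
  rewrite /box_sum /S -sumrB.
  apply: (sum_cst_le (F := fun r1 : nat => (\sum_(r2 < B) \sum_(r3 < B)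
    H (b1 + d1 k + r1%:Z) (b2 + d2 k + r2%:Z) (b3 + d3 k + r3%:Z)) -
     \sum_(r2 < B) \sum_(r3 < B) csum m (F k r1 r2 r3))) => r1 l1.
  rewrite -sumrB.
  apply: (sum_cst_le (F := fun r2 : nat => (\sum_(r3 < B)
    H (b1 + d1 k + r1%:Z) (b2 + d2 k + r2%:Z) (b3 + d3 k + r3%:Z)) -
     \sum_(r3 < B) csum m (F k r1 r2 r3))) => r2 l2.
  rewrite -sumrB.
  apply: (sum_cst_le (F := fun r3 : nat =>
    H (b1 + d1 k + r1%:Z) (b2 + d2 k + r2%:Z) (b3 + d3 k + r3%:Z) -
     csum m (F k r1 r2 r3))) => r3 l3.
  have [q1 q2 q3 q4] := he k r1 r2 r3 kM l1 l2 l3.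
  have := cube_shift q1 q2 q3 q4.
  by rewrite (addrAC b1 (d1 k)) (addrAC b2 (d2 k)) (addrAC b3 (d3 k)).
have sS : `|\sum_(k < M) S k| <= B%:R ^+ 3 * m%:R * G.
  have -> : \sum_(k < M) S k = \sum_(r1 < B) \sum_(r2 < B) \sum_(r3 < B)
      csum m (fun x => \sum_(k < M) F k r1 r2 r3 x).
    rewrite exchange_big; apply: eq_bigr => r1 _.
    rewrite exchange_big; apply: eq_bigr => r2 _.
    rewrite exchange_big; apply: eq_bigr => r3 _.
    by rewrite csum_sum.
  rewrite (_ : B%:R ^+ 3 * m%:R * G = B%:R * (B%:R * (B%:R * (m%:R * G)))); last by ring.
  apply: (sum_cst_le (F := fun r1 : nat => \sum_(r2 < B) \sum_(r3 < B)
      csum m (fun x => \sum_(k < M) F k r1 r2 r3 x))) => r1 _.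
  apply: (sum_cst_le (F := fun r2 : nat => \sum_(r3 < B)
      csum m (fun x => \sum_(k < M) F k r1 r2 r3 x))) => r2 _.
  apply: (sum_cst_le (F := fun r3 : nat =>
      csum m (fun x => \sum_(k < M) F k r1 r2 r3 x))) => r3 _.
  apply: csum_bound => x; rewrite /F -mulr_sumr normrM.
  apply: le_trans (fG _ M); apply: ler_piMl => //.
  by rewrite !normrM; do 2![apply: mulr_ile1; rewrite ?mulr_ge0 ?f1//].
have -> : M%:R * `|box_sum B b1 b2 b3| =
   `|\sum_(k < M) (box_sum B b1 b2 b3 - S k) + \sum_(k < M) S k|.
  by rewrite sumrB subrK sumr_const card_ord -(mulr_natl (box_sum _ _ _ _)) normrM normr_nat.
apply: le_trans (ler_normD _ _) _; apply: lerD => //.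
exact: (sum_cst_le (F := fun k => box_sum B b1 b2 b3 - S k)).
Qed.

End Box.

(** * The quadratic phase *)

Section Quantized.
Variable R : archiRealFieldType.
Implicit Types (p q N x : R) (A t b d : int).

Definition quad p q N A t : int :=
  Num.floor (p * (A + t)%:~R ^+ 2 / N + q * (A + t)%:~R).

Definition slope p q N A b : R := 2 * p * (A + b)%:~R / N + q.

Lemma floor_err x : exists2 e : R, 0 <= e < 1 & (Num.floor x)%:~R = x - e.
Proof.
exists (x - (Num.floor x)%:~R); last by ring.
by have := floor_itv x; rewrite intrD; lra.
Qed.

(** Exact expansion of the quadratic phase, with the slope taken at a base point [b] instead of [X];
    the term [1] accounts for the two roundings. *)
Lemma quad_diff p q N A X d b p1 : 0 < N -> `|p| <= p1 ->
  exists2 e : R, `|e| <= 1 + p1 * (2 * `|X - b|%:~R * `|d|%:~R + `|d|%:~R ^+ 2) / N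
   & (quad p q N A (X + d))%:~R - (quad p q N A X)%:~R
     = slope p q N A b * d%:~R + e.
Proof.
move=> N0 hp; rewrite /quad /slope.
have [e1 he1 ->] := floor_err (p * (A + (X + d))%:~R ^+ 2 / N + q * (A + (X + d))%:~R).
have [e2 he2 ->] := floor_err (p * (A + X)%:~R ^+ 2 / N + q * (A + X)%:~R).
pose w := p * (2 * (X - b)%:~R * d%:~R + d%:~R ^+ 2) / N.
exists (e2 - e1 + w); last by rewrite /w !intrD !intrN; field; rewrite gt_eqF.
apply: le_trans (ler_normD _ _) _; apply: lerD.
  by rewrite ler_norml; lra.
rewrite /w normrM (ger0_norm (_ : 0 <= N^-1)); last by rewrite invr_ge0 ltW.
rewrite ler_wpM2r ?invr_ge0 ?(ltW N0)// normrM.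
apply: ler_pM => //.
apply: le_trans (ler_normD _ _) _.
by rewrite normrX !normrM -!intr_norm (ger0_norm (ler0n _ 2)).
Qed.

Lemma norm_sub_lt b (B r : nat) : (r < B)%N -> `|b + r%:Z - b|%:~R <= B%:R :> R.
Proof.
move=> rB; rewrite (_ : b + r%:Z - b = r%:Z); last by ring.
by rewrite -[`|_|]/(r%:Z) ler_nat ltnW.
Qed.

Lemma corner_dist b1 b2 b3 (B r1 r2 r3 : nat) :
  (r1 < B)%N -> (r2 < B)%N -> (r3 < B)%N ->
  `|b2 + r2%:Z + (b3 + r3%:Z) - (b1 + r1%:Z) - (b2 + b3 - b1)| <= (2 * B)%N%:Z.
Proof. by move=> l1 l2 l3; rewrite ler_norml; apply/andP; split; lia. Qed.

Section Shifts.
Variables (p q N p1 K D0 : R) (A b1 b2 b3 : int) (B M : nat).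
Hypothesis N0 : 0 < N.
Hypothesis hp : `|p| <= p1.
Hypothesis K1 : 1 <= K.
Hypothesis D00 : 0 < D0.
Let k1 := slope p q N A b1.
Let k2 := slope p q N A b2.
Let k3 := slope p q N A b3.
Let k4 := slope p q N A (b2 + b3 - b1).
Hypothesis hk1 : `|k1| <= K.
Hypothesis hk2 : `|k2| <= K.
Hypothesis hk3 : `|k3| <= K.
Hypothesis hk4 : `|k4| <= K.
Let det := (k2 - k1) * (k3 - k1) * (1 - k1 - k4).
Hypothesis hdet : D0 <= `|det|.

(* Cramer's rule for the direction in (x, t1, t2, t3) that fixes the first
   three arguments of [cube] to first order and moves the fourth at unit speed *)
Let Cx : R := k1 * k2 * (1 - k3) / det.
Let C1 : R := - (k2 * (1 - k3)) / det.
Let C2 : R := - (k1 * (1 - k3)) / det.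
Let C3 : R := k2 * (k1 - 1) / det.

Let Cm := K * (K + 1) / D0.

Let det0 : det != 0.
Proof. by rewrite -normr_gt0; apply: lt_le_trans hdet. Qed.

(** The slope is affine in the step, so the fourth slope is determined by the others; this is what
    makes the fourth argument move at unit speed along [(Cx, C1, C2, C3)]. *)
Let k4E : k4 = k2 + k3 - k1.
Proof. by rewrite /k4 /k2 /k3 /k1 /slope !intrD !intrN; field; rewrite gt_eqF. Qed.

Let bound_C (x y : R) : `|x| <= K -> `|y| <= K + 1 -> `|x * y / det| <= Cm.
Proof.
move=> hx hy; rewrite !normrM normfV.
have h1 : `|x| * `|y| <= K * (K + 1) by apply: ler_pM.
have h2 : `|det|^-1 <= D0^-1.
  by rewrite lef_pV2 // posrE normr_gt0.
by apply: ler_pM => //; rewrite ?mulr_ge0 ?invr_ge0.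
Qed.

Let n1B (x : R) : `|x| <= K -> `|1 - x| <= K + 1.
Proof. by move=> h; apply: le_trans (ler_normB _ _) _; rewrite normr1; lra. Qed.

Let hC1 : `|C1| <= Cm.
Proof. by rewrite /C1 mulNr normrN; apply: bound_C => //; exact: n1B. Qed.

Let hC2 : `|C2| <= Cm.
Proof. by rewrite /C2 mulNr normrN; apply: bound_C => //; exact: n1B. Qed.

Let hC3 : `|C3| <= Cm.
Proof. by apply: bound_C => //; rewrite distrC; exact: n1B. Qed.

Definition shift_size : R := M%:R * Cm + 1.

(** The fourth argument is the worst one: it starts within [2 B] of its base point and its step
    moves by at most [3 s], where [s = shift_size], and [2 (2 B) (3 s) + (3 s) ^ 2 = 12 B s + 9 s ^
    2]. The term [4 + 3 K] covers all roundings. *)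
Definition shift_err : R :=
  4 + 3 * K + p1 * (12 * B%:R * shift_size + 9 * shift_size ^+ 2) / N.

Let Cm0 : 0 <= Cm.
Proof.
have K0 : 0 <= K by apply: le_trans K1.
by rewrite /Cm divr_ge0 ?mulr_ge0 ?addr_ge0// ltW.
Qed.

Let floor_size (k : nat) (c : R) : (k < M)%N -> `|c| <= Cm ->
  `|Num.floor (k%:R * c)|%:~R <= shift_size.
Proof.
move=> kM hc; rewrite intr_norm; have [e he ->] := floor_err (k%:R * c).
apply: le_trans (ler_normB _ _) _; apply: lerD; last by rewrite ger0_norm; lra.
rewrite normrM normr_nat; apply: ler_pM => //.
by rewrite ler_nat ltnW.
Qed.

Lemma shifts_exist : exists dx d1 d2 d3 : nat -> int,
  (forall k, (k < M)%N -> [/\ `|d1 k|%:~R <= shift_size, `|d2 k|%:~R <= shift_size &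
    `|d3 k|%:~R <= shift_size]) /\
  (forall k r1 r2 r3, (k < M)%N -> (r1 < B)%N -> (r2 < B)%N -> (r3 < B)%N ->
    let Q := quad p q N A in
    let X1 := b1 + r1%:Z in let X2 := b2 + r2%:Z in let X3 := b3 + r3%:Z in
    let X4 := X2 + X3 - X1 in
    [/\ `|dx k + Q (X1 + d1 k) - Q X1|%:~R <= shift_err,
     `|dx k + Q (X2 + d2 k) - Q X2|%:~R <= shift_err,
     `|dx k + d1 k - d3 k + Q (X3 + d3 k) - Q X3|%:~R <= shift_err &
     `|dx k + d1 k - d3 k + Q (X4 + (d2 k + d3 k - d1 k)) - Q X4 - k%:Z|%:~R
        <= shift_err]).
Proof.
(* [k] times the Cramer direction, rounded down in each coordinate. *)
exists (fun k => Num.floor (k%:R * Cx)), (fun k => Num.floor (k%:R * C1)),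
  (fun k => Num.floor (k%:R * C2)), (fun k => Num.floor (k%:R * C3)).
split => [k kM|k r1 r2 r3 kM l1 l2 l3 Q X1 X2 X3 X4].
  by split; apply: floor_size.
have p10 : 0 <= p1 by apply: le_trans hp.
have s0 : 0 <= shift_size by apply: addr_ge0 => //; apply: mulr_ge0.
have B0 : 0 <= B%:R :> R by [].
have s1 := floor_size kM hC1; have s2 := floor_size kM hC2.
have s3 := floor_size kM hC3.
have [ex hex Ex] := floor_err (k%:R * Cx).
have [e1 he1 E1] := floor_err (k%:R * C1).
have [e2 he2 E2] := floor_err (k%:R * C2).
have [e3 he3 E3] := floor_err (k%:R * C3).
set dx := Num.floor (k%:R * Cx) in Ex *.
set d1 := Num.floor (k%:R * C1) in E1 s1 *.
set d2 := Num.floor (k%:R * C2) in E2 s2 *.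
set d3 := Num.floor (k%:R * C3) in E3 s3 *.
have Nv : 0 <= N^-1 by rewrite invr_ge0 ltW.
have qe (X d b : int) (x s : R) : `|X - b|%:~R <= x -> `|d|%:~R <= s ->
    2 * x * s + s ^+ 2 <= 12 * B%:R * shift_size + 9 * shift_size ^+ 2 ->
    exists2 e : R, `|e| <= 1 + p1 * (12 * B%:R * shift_size + 9 * shift_size ^+ 2) / N &
     (Q (X + d) - Q X)%:~R = slope p q N A b * d%:~R + e.
  move=> hx hs hxs.
  have [e he E] := quad_diff q A X d b N0 hp.
  exists e; last by rewrite intrD intrN.
  apply: (le_trans he); rewrite lerD2l ler_wpM2r// ler_wpM2l//.
  apply: le_trans hxs; apply: lerD; last first.
    by rewrite lerXn2r // nnegrE ?ler0z // (le_trans _ hs) ?ler0z.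
  apply: ler_pM; rewrite ?mulr_ge0 ?ler0z//.
  by rewrite ler_wpM2l.
have n0 (x : int) : 0 <= `|x|%:~R :> R by rewrite ler0z.
have sB : 0 <= B%:R * shift_size by rewrite mulr_ge0.
have ss : 0 <= shift_size ^+ 2 by rewrite sqr_ge0.
have small : 2 * B%:R * shift_size + shift_size ^+ 2 <=
   12 * B%:R * shift_size + 9 * shift_size ^+ 2 by rewrite -!mulrA; lra.
have [f1 hf1 F1] := qe X1 d1 b1 _ _ (norm_sub_lt b1 l1) s1 small.
have [f2 hf2 F2] := qe X2 d2 b2 _ _ (norm_sub_lt b2 l2) s2 small.
have [f3 hf3 F3] := qe X3 d3 b3 _ _ (norm_sub_lt b3 l3) s3 small.
have big : 2 * (2 * B%:R) * (3 * shift_size) + (3 * shift_size) ^+ 2 <=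
   12 * B%:R * shift_size + 9 * shift_size ^+ 2.
  by rewrite le_eqVlt; apply/orP; left; apply/eqP; ring.
have hX4 : `|X4 - (b2 + b3 - b1)|%:~R <= 2 * B%:R :> R.
  by rewrite -natrM pmulrn ler_int; apply: corner_dist.
have hd4 : `|d2 + d3 - d1|%:~R <= 3 * shift_size.
  rewrite intr_norm intrD intrN intrD; apply: le_trans (ler_normB _ _) _.
  have := ler_normD (d2%:~R : R) d3%:~R.
  by move: s1 s2 s3; rewrite !intr_norm; lra.
have [f4 hf4 F4] := qe X4 (d2 + d3 - d1) (b2 + b3 - b1) _ _ hX4 hd4 big.
rewrite -/k1 in F1; rewrite -/k2 in F2; rewrite -/k3 in F3; rewrite -/k4 in F4.
have le3 (x y u : R) : `|x| <= u -> `|y| <= K -> 0 <= u -> `|x * y| <= u * K.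
  by move=> hx hy u0; rewrite normrM; apply: ler_pM.
rewrite /shift_err !intr_norm; set E := p1 * _ / N in hf1 hf2 hf3 hf4 *.
have ne (e : R) : 0 <= e < 1 -> `|e| <= 1 by move=> h; rewrite ger0_norm; lra.
have K1' := K1; clear s0 B0 Nv qe n0 sB ss small big hX4 hd4 s1 s2 s3.
split.
- rewrite -addrA intrD F1 Ex E1.
  rewrite [X in `|X|](_ : _ = (f1 - ex) - e1 * k1); last by rewrite /Cx /C1; field.
  have a1 := le3 _ _ _ (ne _ he1) hk1 ler01.
  have a2 := ler_normB (f1 - ex) (e1 * k1); have a3 := ler_normB f1 ex.
  have a4 := ne _ hex; lra.
- rewrite -addrA intrD F2 Ex E2.
  rewrite [X in `|X|](_ : _ = (f2 - ex) - e2 * k2); last by rewrite /Cx /C2; field.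
  have a1 := le3 _ _ _ (ne _ he2) hk2 ler01.
  have a2 := ler_normB (f2 - ex) (e2 * k2); have a3 := ler_normB f2 ex.
  have a4 := ne _ hex; lra.
- rewrite -addrA intrD F3 intrD intrN intrD Ex E1 E3.
  rewrite [X in `|X|](_ : _ = (f3 - (ex + e1 - e3)) - e3 * k3); last first.
    by rewrite /Cx /C1 /C3; field.
  have a1 := le3 _ _ _ (ne _ he3) hk3 ler01.
  have a2 := ler_normB (f3 - (ex + e1 - e3)) (e3 * k3).
  have a3 := ler_normB f3 (ex + e1 - e3).
  have a4 : `|ex + e1 - e3| <= 2 by rewrite ler_norml; lra.
  lra.
- rewrite (_ : dx + d1 - d3 + Q (X4 + (d2 + d3 - d1)) - Q X4 - k%:Z =
      (dx + d1 - d3 - k%:Z) + (Q (X4 + (d2 + d3 - d1)) - Q X4)); last by ring.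
  rewrite intrD F4 !intrD !intrN Ex E1 E3 E2.
  rewrite [X in `|X|](_ : _ = (f4 - (ex + e1 - e3)) - (e2 + e3 - e1) * k4); last first.
    rewrite k4E -pmulrn /Cx /C1 /C3 /C2 /det k4E; field.
    by move: det0; rewrite /det k4E !mulf_eq0 !negb_or => /andP[/andP[-> ->] ->].
  have h2 : `|e2 + e3 - e1| <= 2 by rewrite ler_norml; lra.
  have a1 := le3 _ _ _ h2 hk4 (ler0n _ 2).
  have a2 := ler_normB (f4 - (ex + e1 - e3)) ((e2 + e3 - e1) * k4).
  have a3 := ler_normB f4 (ex + e1 - e3).
  have a4 : `|ex + e1 - e3| <= 2 by rewrite ler_norml; lra.
  lra.
Qed.

End Shifts.
End Quantized.

(** * Splitting the cube sum into boxes *)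

Lemma corner_in_range (B D i1 i2 i3 r1 r2 r3 : nat) :
  (r1 < B)%N -> (r2 < B)%N -> (r3 < B)%N ->
  (i1 < i2 + i3)%N -> (i2 + i3 + 2 <= D + i1)%N ->
  0 <= (i2 * B + r2)%N%:Z + (i3 * B + r3)%N%:Z - (i1 * B + r1)%N%:Z < (D * B)%N%:Z.
Proof.
move=> l1 l2 l3 g1 g2.
have a1 : (i1.+1 * B <= (i2 + i3) * B)%N by rewrite leq_mul2r g1 orbT.
have a2 : ((i2 + i3 + 2) * B <= (D + i1) * B)%N by rewrite leq_mul2r g2 orbT.
by move: a1 a2; rewrite !mulnDl mulSn; lia.
Qed.

Lemma corner_out_of_range (B D i1 i2 i3 r1 r2 r3 : nat) :
  (r1 < B)%N -> (r2 < B)%N -> (r3 < B)%N ->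
  (i2 + i3 + 2 <= i1)%N || (D + i1 + 1 <= i2 + i3)%N ->
  (0 <= (i2 * B + r2)%N%:Z + (i3 * B + r3)%N%:Z - (i1 * B + r1)%N%:Z < (D * B)%N%:Z)
   = false.
Proof.
move=> l1 l2 l3 /orP[g|g].
  have a1 : ((i2 + i3 + 2) * B <= i1 * B)%N by rewrite leq_mul2r g orbT.
  by move: a1; rewrite !mulnDl; lia.
have a1 : ((D + i1 + 1) * B <= (i2 + i3) * B)%N by rewrite leq_mul2r g orbT.
by move: a1; rewrite !mulnDl; lia.
Qed.

Lemma far_mul (B z i j : nat) : (i + z <= j)%N || (j + z <= i)%N ->
  (B * z)%N%:Z <= `|(i * B)%N%:Z - (j * B)%N%:Z|.
Proof.
case/orP => h.
  have a1 : ((i + z) * B <= j * B)%N by rewrite leq_mul2r h orbT.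
  by move: a1; rewrite mulnDl (mulnC B); lia.
have a1 : ((j + z) * B <= i * B)%N by rewrite leq_mul2r h orbT.
by move: a1; rewrite mulnDl (mulnC B); lia.
Qed.

Lemma corner_index (B i1 i2 i3 : nat) : (i1 < i2 + i3)%N ->
  (i2 * B)%N%:Z + (i3 * B)%N%:Z - (i1 * B)%N%:Z = ((i2 + i3 - i1) * B)%N%:Z.
Proof.
move=> h; have a1 : (i1 * B <= (i2 + i3) * B)%N by rewrite leq_mul2r (ltnW h) orbT.
by move: a1; rewrite mulnBl !mulnDl; lia.
Qed.

Section CubeSum.
Variable R : archiRealFieldType.
Variables (m D B M z : nat) (f : int -> R) (V G : R).
Variables (p q N p0 p1 K c0 : R) (A : int).
Hypothesis m0 : (0 < m)%N.
Hypothesis B0 : (0 < B)%N.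
Hypothesis M0 : (0 < M)%N.
Hypothesis z0 : (0 < z)%N.
Hypothesis pf : periodic m f.
Hypothesis f1 : forall x, `|f x| <= 1.
Hypothesis fV : variation m f <= V.
Hypothesis fG : forall (a : int) (n : nat), `|\sum_(i < n) f (a + i%:Z)| <= G.
Hypothesis N0 : 0 < N.
Hypothesis p00 : 0 < p0.
Hypothesis hp : p0 <= `|p| <= p1.
Hypothesis K1 : 1 <= K.
Hypothesis c00 : 0 < c0.
Hypothesis hK : forall i, (i <= D * B)%N -> `|slope p q N A i%:Z| <= K.
Hypothesis hc : forall i j, (i <= D * B)%N -> (j <= D * B)%N ->
  c0 <= `|1 - slope p q N A i%:Z - slope p q N A j%:Z|.

(** Lower bound for the Jacobian on the boxes that are kept: two slope differences of size at least
    [2 p0 B z / N], and [c0] for the third factor. *)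
Definition min_det : R := (2 * p0 * (B * z)%:R / N) ^+ 2 * c0.

Definition box_err : R :=
  6 * shift_size K min_det M * B%:R ^+ 2 * m%:R +
  4 * shift_err N p1 K min_det B M * V * B%:R ^+ 3 + B%:R ^+ 3 * m%:R * G / M%:R.

(** The boxes that are kept: the fourth step stays in range throughout the box, and the first index
    is at least [z] boxes away from the second and from the third, which separates the slopes. *)
Let good (i1 i2 i3 : nat) := [&& (i1 < i2 + i3)%N, (i2 + i3 + 2 <= D + i1)%N,
  (i1 + z <= i2)%N || (i2 + z <= i1)%N & (i1 + z <= i3)%N || (i3 + z <= i1)%N].

Let min_det0 : 0 < min_det.
Proof.
by rewrite /min_det mulr_gt0// exprn_gt0// divr_gt0// mulr_gt0 ?mulr_gt0// ltr0n muln_gt0 B0.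
Qed.

Let slope_diff (i j : nat) : (i + z <= j)%N || (j + z <= i)%N ->
  2 * p0 * (B * z)%:R / N <= `|slope p q N A (i * B)%:Z - slope p q N A (j * B)%:Z|.
Proof.
move=> h; rewrite /slope.
rewrite (_ : _ - _ = 2 * p * ((i * B)%:Z - (j * B)%:Z)%:~R / N); last first.
  by rewrite !intrD !intrN; field; rewrite gt_eqF.
rewrite !normrM (ger0_norm (ler0n _ 2)) (ger0_norm (_ : 0 <= N^-1)); last first.
  by rewrite invr_ge0 ltW.
rewrite ler_wpM2r ?invr_ge0 ?(ltW N0)//.
case/andP: hp => hp0 _.
apply: ler_pM => //; first by rewrite mulr_ge0 ?ltW.
  by rewrite ler_wpM2l.
by rewrite -intr_norm pmulrn ler_int; apply: far_mul.
Qed.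

Let good_box (i1 i2 i3 : nat) : (i1 < D)%N -> (i2 < D)%N -> (i3 < D)%N ->
  good i1 i2 i3 ->
  `|box_sum m (quad p q N A) f B (i1 * B)%:Z (i2 * B)%:Z (i3 * B)%:Z| <= box_err.
Proof.
move=> l1 l2 l3 /and4P[g1 g2 g3 g4].
have hb (i : nat) : (i < D)%N -> `|slope p q N A (i * B)%:Z| <= K.
  by move=> iD; apply: hK; rewrite leq_mul2r ltnW ?orbT.
have i4 : (i2 * B)%:Z + (i3 * B)%:Z - (i1 * B)%:Z = ((i2 + i3 - i1) * B)%N%:Z
  by apply: corner_index.
have l4 : (i2 + i3 - i1 < D)%N by lia.
case/andP: hp => hp0 hp1.
have s2 := slope_diff g3; have s3 := slope_diff g4.
have := @shifts_exist R p q N p1 K min_det A (i1 * B)%:Z (i2 * B)%:Z (i3 * B)%:Z B M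
  N0 hp1 K1 min_det0 (hb _ l1) (hb _ l2) (hb _ l3).
rewrite i4 => /(_ (hb _ l4)) [].
  rewrite /min_det !normrM expr2; apply: ler_pM => //.
  - by rewrite mulr_ge0// divr_ge0 ?(ltW N0)// mulr_ge0// mulr_ge0// ltW.
  - exact: ltW.
  - by apply: ler_pM; rewrite 1?distrC// divr_ge0 ?(ltW N0)// mulr_ge0// mulr_ge0// ltW.
  - by apply: hc; rewrite leq_mul2r ltnW ?orbT.
move=> dx [d1 [d2 [d3 [hd he]]]].
have := box_sum_bound m0 pf f1 fV fG hd he.
rewrite /box_err => h.
have M0' : 0 < M%:R :> R by rewrite ltr0n.
rewrite -(ler_pM2l M0'); apply: (le_trans h).
rewrite [leRHS]mulrDr. rewrite lerD2l le_eqVlt; apply/orP; left; apply/eqP.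
by field; rewrite gt_eqF.
Qed.

Let term (t1 t2 t3 : nat) : R :=
  if (0 <= t2%:Z + t3%:Z - t1%:Z < (D * B)%N%:Z)
  then csum m (cube (quad p q N A) f t1%:Z t2%:Z t3%:Z) else 0.

Let block i1 i2 i3 := \sum_(r1 < B) \sum_(r2 < B) \sum_(r3 < B)
   term (i1 * B + r1) (i2 * B + r2) (i3 * B + r3).

Let cube_sum_blocks : cube_sum m (D * B) (quad p q N A) f =
  \sum_(i1 < D) \sum_(i2 < D) \sum_(i3 < D) block i1 i2 i3.
Proof.
rewrite /cube_sum -/term.
rewrite (sum_blocks D B (fun t1 => \sum_(t2 < D * B) \sum_(t3 < D * B) term t1 t2 t3)).
apply: eq_bigr => i1 _.
transitivity (\sum_(r1 < B) \sum_(i2 < D) \sum_(r2 < B) \sum_(i3 < D) \sum_(r3 < B)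
  term (i1 * B + r1) (i2 * B + r2) (i3 * B + r3)).
  apply: eq_bigr => r1 _.
  rewrite (sum_blocks D B (fun t2 => \sum_(t3 < D * B) term _ t2 t3)).
  apply: eq_bigr => i2 _; apply: eq_bigr => r2 _.
  by rewrite (sum_blocks D B (fun t3 => term _ _ t3)).
rewrite exchange_big; apply: eq_bigr => i2 _.
transitivity (\sum_(r1 < B) \sum_(i3 < D) \sum_(r2 < B) \sum_(r3 < B)
  term (i1 * B + r1) (i2 * B + r2) (i3 * B + r3)).
  by apply: eq_bigr => r1 _; rewrite exchange_big.
by rewrite exchange_big.
Qed.

Let near1 (i1 i2 : nat) : nat := ((i1 < i2 + z) && (i2 < i1 + z))%N.
(** Boxes inside which the range condition on the fourth step may change: for given [i1] and [i2],
    two windows of two values of [i3]. *)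
Let edge (i1 i2 i3 : nat) : nat :=
  ((i1 <= i2 + i3 + 1) && (i2 + i3 <= i1))%N + ((D + i1 <= i2 + i3 + 1) && (i2 + i3 <= D + i1))%N.

Let block_le (i1 i2 i3 : nat) : (i1 < D)%N -> (i2 < D)%N -> (i3 < D)%N ->
  block i1 i2 i3 <= box_err + B%:R ^+ 3 * m%:R *
    ((near1 i1 i2)%:R + (near1 i1 i3)%:R + (edge i1 i2 i3)%:R).
Proof.
move=> l1 l2 l3.
have V0 : 0 <= V by apply: le_trans fV; apply: sumr_ge0.
have G0 : 0 <= G by apply: le_trans (fG 0 0); rewrite normr_ge0.
have p10 : 0 <= p1 by case/andP: hp => _; apply: le_trans.
have K0 : 0 <= K by apply: le_trans K1.
have s0 : 0 <= shift_size K min_det M.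
  apply: addr_ge0 => //; apply: mulr_ge0 => //; apply: divr_ge0; last exact: ltW.
  by apply: mulr_ge0 => //; apply: addr_ge0.
have se0 : 0 <= shift_err N p1 K min_det B M.
  apply: addr_ge0; first by apply: addr_ge0 => //; apply: mulr_ge0.
  apply: divr_ge0; last exact: ltW.
  apply: mulr_ge0 => //; apply: addr_ge0; first by apply: mulr_ge0 => //; apply: mulr_ge0.
  by apply: mulr_ge0 => //; apply: exprn_ge0.
have E0 : 0 <= box_err.
  rewrite /box_err; apply: addr_ge0; first apply: addr_ge0.
  - by rewrite !mulr_ge0// exprn_ge0.
  - by rewrite !mulr_ge0// exprn_ge0.
  - by apply: divr_ge0 => //; rewrite !mulr_ge0// exprn_ge0.
case: (boolP (good i1 i2 i3)) => g.
  have -> : block i1 i2 i3 =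
      box_sum m (quad p q N A) f B (i1 * B)%:Z (i2 * B)%:Z (i3 * B)%:Z.
    apply: eq_bigr => r1 _; apply: eq_bigr => r2 _; apply: eq_bigr => r3 _.
    rewrite /term ifT ?PoszD//.
    have := (ltn_ord r1, ltn_ord r2, ltn_ord r3) => -[[k1 k2] k3].
    by move: g => /and4P[g1 g2 _ _]; apply: corner_in_range.
  apply: (@le_trans _ _ box_err); last by rewrite lerDl mulr_ge0// ?mulr_ge0 ?exprn_ge0// !addr_ge0.
  exact: le_trans (ler_norm _) (good_box l1 l2 l3 g).
apply: (@le_trans _ _ (B%:R ^+ 3 * m%:R *
    ((near1 i1 i2)%:R + (near1 i1 i3)%:R + (edge i1 i2 i3)%:R))); last by rewrite lerDr.
case: (posnP (near1 i1 i2 + near1 i1 i3 + edge i1 i2 i3)) => [e0|e1].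
  rewrite -!natrD e0 mulr0 /block big1// => r1 _; rewrite big1// => r2 _.
  rewrite big1// => r3 _; rewrite /term.
  have := (ltn_ord r1, ltn_ord r2, ltn_ord r3) => -[[k1 k2] k3].
  rewrite corner_out_of_range//; move: g e0.
  by rewrite /good /near1 /edge; clear; lia.
apply: (@le_trans _ _ (B%:R ^+ 3 * m%:R * 1)); last first.
  by rewrite -!natrD ler_wpM2l ?mulr_ge0 ?exprn_ge0// ler1n.
apply: le_trans (ler_norm _) _.
rewrite (_ : B%:R ^+ 3 * m%:R * 1 = B%:R * (B%:R * (B%:R * m%:R))); last by ring.
apply: (sum_cst_le (F := fun r1 => \sum_(r2 < B) \sum_(r3 < B)
   term (i1 * B + r1) (i2 * B + r2) (i3 * B + r3))) => r1 _.
apply: (sum_cst_le (F := fun r2 => \sum_(r3 < B)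
   term (i1 * B + r1) (i2 * B + r2) (i3 * B + r3))) => r2 _.
apply: (sum_cst_le (F := fun r3 =>
   term (i1 * B + r1) (i2 * B + r2) (i3 * B + r3))) => r3 _.
rewrite /term; case: ifP => _; last by rewrite normr0.
exact: csum_cube_le.
Qed.

(** Discarded boxes are estimated trivially. Each of the two closeness conditions leaves at most
    [2 z] values of one index and the range condition at most [4], whence [4 z + 4]. *)
Lemma cube_sum_bound : cube_sum m (D * B) (quad p q N A) f <=
  D%:R ^+ 3 * box_err + B%:R ^+ 3 * m%:R * (D%:R ^+ 2 * (4 * z + 4)%:R).
Proof.
rewrite cube_sum_blocks.
apply: (@le_trans _ _ (\sum_(i1 < D) \sum_(i2 < D) \sum_(i3 < D) (box_err +
  B%:R ^+ 3 * m%:R *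
    ((near1 i1 i2)%:R + (near1 i1 i3)%:R + (edge i1 i2 i3)%:R)))).
  by apply: ler_sum => i1 _; apply: ler_sum => i2 _; apply: ler_sum => i3 _;
    apply: block_le.
have near_sum (i1 : nat) : \sum_(i2 < D) (near1 i1 i2)%:R <= (2 * z)%:R :> R.
  apply: (@count_window R D (2 * z) (i1%:Z - z%:Z) (fun i2 => (i1 < i2 + z) && (i2 < i1 + z))%N).
  by move=> i; lia.
have edge_sum (i1 i2 : nat) : \sum_(i3 < D) (edge i1 i2 i3)%:R <= 4%:R :> R.
  under eq_bigr do rewrite natrD.
  rewrite big_split (_ : 4%:R = 2%:R + 2%:R :> R) /=; last by rewrite -natrD.
  apply: lerD.
    apply: (@count_window R D 2 (i1%:Z - i2%:Z - 1)
      (fun i3 => (i1 <= i2 + i3 + 1) && (i2 + i3 <= i1))%N) => i; lia.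
  apply: (@count_window R D 2 (D%:Z + i1%:Z - i2%:Z - 1)
      (fun i3 => (D + i1 <= i2 + i3 + 1) && (i2 + i3 <= D + i1))%N) => i; lia.
have Dn (F : nat -> R) c : (forall i, (i < D)%N -> F i <= c) -> \sum_(i < D) F i <= D%:R * c.
  move=> h; apply: (@le_trans _ _ (\sum_(i < D) c)); first by apply: ler_sum => i _; apply: h.
  by rewrite sumr_const card_ord mulr_natl.
have sum_c (c : R) : \sum_(i < D) c = D%:R * c.
  by rewrite sumr_const card_ord mulr_natl.
rewrite [leRHS](_ : _ = D%:R * (D%:R * (D%:R * box_err) + B%:R ^+ 3 * m%:R *
   (D%:R * (2 * z)%:R + D%:R * (2 * z)%:R + D%:R * 4%:R))); last first.
  by rewrite (natrD _ (4 * z) 4) (natrM _ 4 z) (natrM _ 2 z); ring.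
apply: (Dn (fun i1 => \sum_(i2 < D) \sum_(i3 < D) (box_err + B%:R ^+ 3 * m%:R *
    ((near1 i1 i2)%:R + (near1 i1 i3)%:R + (edge i1 i2 i3)%:R)))) => i1 _.
have -> : \sum_(i2 < D) \sum_(i3 < D) (box_err + B%:R ^+ 3 * m%:R *
    ((near1 i1 i2)%:R + (near1 i1 i3)%:R + (edge i1 i2 i3)%:R)) =
  D%:R * (D%:R * box_err) + B%:R ^+ 3 * m%:R *
  (D%:R * (\sum_(i2 < D) (near1 i1 i2)%:R) + D%:R * (\sum_(i3 < D) (near1 i1 i3)%:R)
   + \sum_(i2 < D) \sum_(i3 < D) (edge i1 i2 i3)%:R).
  transitivity (\sum_(i2 < D) (D%:R * box_err + B%:R ^+ 3 * m%:R *
    (D%:R * (near1 i1 i2)%:R + (\sum_(i3 < D) (near1 i1 i3)%:R)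
      + \sum_(i3 < D) (edge i1 i2 i3)%:R))).
    apply: eq_bigr => i2 _.
    by rewrite big_split /= sum_c -mulr_sumr !big_split /= sum_c.
  by rewrite big_split /= sum_c -mulr_sumr !big_split /= sum_c -mulr_sumr.
rewrite lerD2l; apply: ler_wpM2l; first by rewrite mulr_ge0// exprn_ge0.
apply: lerD; first by apply: lerD; rewrite ler_wpM2l// near_sum.
by apply: (Dn (fun i2 => \sum_(i3 < D) (edge i1 i2 i3)%:R)) => i2 _; apply: edge_sum.
Qed.

End CubeSum.

(** * Trilinear smoothing *)

Section Smoothing.
Variable R : archiRealFieldType.

(** Here [x = N], [y = 2 ^ k], [w = 2 ^ j], and [1 / u] is the relative gain. The displacements have
    size about [x u ^ 3 / y], which is [B / u]; the linearisation error then costs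
    [u ^ 7 / y <= 1 / u], rounding costs [y / x <= 1 / u], and a window sum [2 x / y] spread over
    [M] translations gives [2 / u]. *)
Lemma box_err_le (m B M z : nat) (N p0 p1 K c0 x y u w b : R) :
  1 <= u -> 1 <= w -> 0 < y -> 0 < x -> 0 < p0 -> 0 <= p1 -> 1 <= K -> 0 < c0 ->
  u ^+ 8 <= y -> y * u <= x ->
  m%:R = 2 * x -> B%:R = x * u ^+ 4 / y -> M%:R = x * u / y ->
  z%:R = y / (u ^+ 5 * w) -> N = x ->
  b = K * (K + 1) * w ^+ 2 / (4 * p0 ^+ 2 * c0) + 1 ->
  box_err m B M z (8 * y) (2 * x / y) N p0 p1 K c0 <=
    B%:R ^+ 3 * m%:R *
    ((6 * b + 16 * (4 + 3 * K + p1 * (12 * b + 9 * b ^+ 2)) + 2) / u).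
Proof.
move=> u1 w1 y0 x0 p00 p10 K1 c00 uy yx em eB eM ez -> eb.
have u0 : 0 < u by lra.
have w0 : 0 < w by lra.
have K0 : 0 <= K by lra.
have nz : (x != 0) && (y != 0) && (u != 0) && (w != 0) && (p0 != 0) && (c0 != 0).
  by rewrite !gt_eqF.
move: nz => /andP[/andP[/andP[/andP[/andP[xn yn] un] wn] pn] cn].
have eD : min_det B z x p0 c0 = 4 * p0 ^+ 2 * c0 / (u ^+ 2 * w ^+ 2).
  rewrite /min_det natrM eB ez; field.
  by rewrite yn xn un wn.
pose X := x * u ^+ 3 / y.
have b1 : 1 <= b.
  rewrite eb lerDr divr_ge0// ?mulr_ge0 ?sqr_ge0 ?addr_ge0//; exact: ltW.
have b0 : 0 <= b by apply: le_trans b1.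
have X1 : 1 <= X.
  rewrite /X lter_pdivlMr// mul1r; apply: le_trans (_ : y * u <= _).
    by rewrite ler_peMr// ltW.
  by apply: le_trans yx _; rewrite ler_peMr ?exprn_ege1// ltW.
have X0 : 0 <= X by apply: le_trans X1.
have ss : shift_size K (min_det B z x p0 c0) M <= b * X.
  rewrite /shift_size eD eM eb [leRHS]mulrDl mul1r; apply: lerD => //.
  rewrite le_eqVlt; apply/orP; left; apply/eqP; rewrite /X; field.
  by rewrite yn un wn pn cn.
have ss0 : 0 <= shift_size K (min_det B z x p0 c0) M.
  rewrite /shift_size eD eM; apply: addr_ge0 => //; apply: mulr_ge0.
    by rewrite divr_ge0 ?mulr_ge0 ?ltW.
  apply: divr_ge0; first by rewrite mulr_ge0// addr_ge0.
  by rewrite divr_ge0// ?mulr_ge0 ?exprn_ge0 ?ltW.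
set s := shift_size _ _ _ in ss ss0.
have ss2 : s ^+ 2 <= b ^+ 2 * X ^+ 2.
  by rewrite -exprMn lerXn2r// nnegrE mulr_ge0.
have se : shift_err x p1 K (min_det B z x p0 c0) B M <=
    4 + 3 * K + p1 * (12 * b + 9 * b ^+ 2) * (x * u ^+ 7 / y ^+ 2).
  rewrite /shift_err -/s lerD2l -mulrA -[leRHS]mulrA ler_wpM2l//.
  rewrite ler_pdivrMr//.
  have -> : (12 * b + 9 * b ^+ 2) * (x * u ^+ 7 / y ^+ 2) * x =
     12 * (x * u ^+ 4 / y) * (b * X) + 9 * (b ^+ 2 * X ^+ 2) * u.
    by rewrite /X; field.
  rewrite eB; apply: lerD.
    by rewrite ler_wpM2l// mulr_ge0// divr_ge0 ?mulr_ge0 ?exprn_ge0// ltW.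
  apply: (@le_trans _ _ (9 * (b ^+ 2 * X ^+ 2))); first by rewrite ler_wpM2l.
  by rewrite ler_peMr// mulr_ge0// mulr_ge0 ?sqr_ge0.
rewrite /box_err -/s.
set E := shift_err _ _ _ _ _ _ in se *.
have m0 : 0 <= m%:R :> R by [].
have B0 : 0 <= B%:R :> R by [].
have B3m : 0 <= B%:R ^+ 3 * m%:R :> R by rewrite mulr_ge0 ?exprn_ge0.
have e1 : 6 * s * B%:R ^+ 2 * m%:R <= B%:R ^+ 3 * m%:R * (6 * b / u).
  have -> : B%:R ^+ 3 * m%:R * (6 * b / u) = 6 * (b * X) * B%:R ^+ 2 * m%:R.
    by rewrite /X eB; field; rewrite yn un.
  by do 2![apply: ler_wpM2r; rewrite ?exprn_ge0//]; rewrite ler_wpM2l.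
have e3 : B%:R ^+ 3 * m%:R * (2 * x / y) / M%:R = B%:R ^+ 3 * m%:R * (2 / u).
  by rewrite eM; field; rewrite yn xn un.
have yxu : y / x <= 1 / u.
  by rewrite ler_pdivrMr// mulrAC ler_pdivlMr// mul1r.
have u7 : u ^+ 7 / y <= 1 / u.
  by rewrite ler_pdivrMr// mulrAC ler_pdivlMr// mul1r -exprSr.
have Ey : E * (y / x) <= (4 + 3 * K + p1 * (12 * b + 9 * b ^+ 2)) / u.
  apply: (@le_trans _ _ ((4 + 3 * K) * (y / x) +
     p1 * (12 * b + 9 * b ^+ 2) * (u ^+ 7 / y))).
    apply: (@le_trans _ _ ((4 + 3 * K + p1 * (12 * b + 9 * b ^+ 2) * (x * u ^+ 7 / y ^+ 2))
      * (y / x))).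
      by rewrite ler_wpM2r// divr_ge0// ltW.
    by rewrite le_eqVlt; apply/orP; left; apply/eqP; field; rewrite xn yn.
  rewrite [leRHS](_ : _ = (4 + 3 * K) * (1 / u) +
      p1 * (12 * b + 9 * b ^+ 2) * (1 / u)); last by field; rewrite un.
  apply: lerD; apply: ler_wpM2l => //; first by rewrite addr_ge0 ?mulr_ge0.
  by rewrite mulr_ge0// addr_ge0// mulr_ge0 ?sqr_ge0.
have e2 : 4 * E * (8 * y) * B%:R ^+ 3 <= B%:R ^+ 3 * m%:R *
   (16 * (4 + 3 * K + p1 * (12 * b + 9 * b ^+ 2)) / u).
  have -> : 4 * E * (8 * y) * B%:R ^+ 3 = B%:R ^+ 3 * m%:R * (16 * (E * (y / x))).
    by rewrite em; field.
  by rewrite ler_wpM2l// -mulrA ler_wpM2l.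
rewrite e3 [leRHS](_ : _ = B%:R ^+ 3 * m%:R * (6 * b / u) + B%:R ^+ 3 * m%:R *
  (16 * (4 + 3 * K + p1 * (12 * b + 9 * b ^+ 2)) / u) + B%:R ^+ 3 * m%:R * (2 / u)).
  by rewrite lerD2r; apply: lerD.
by field; rewrite un.
Qed.

(** The cube sum gains [1 / u] with [u = 2 ^ (4 r)], and the fourth root turns this into [2 ^ - r].
    The condition [32 r <= k] is [u ^ 8 <= y]; together with [3 j <= k] it keeps the exponents of
    the numbers of boxes nonnegative. *)
Lemma smoothing (p0 p1 K c0 : R) (j : nat) : 0 < p0 -> 1 <= K -> 0 < c0 ->
  exists2 C : R, 0 < C & forall (n k r : nat) (p q : R) (A : int) (f0 f1 f2 : int -> R),
  (32 * r <= k)%N -> (k <= n)%N -> (3 * j <= k)%N ->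
  let m := (2 ^ (2 * n).+1)%N in let T := (2 ^ (2 * n - j))%N in
  let N : R := 2 ^+ (2 * n) in
  p0 <= `|p| <= p1 ->
  (forall i, (i <= T)%N -> `|slope p q N A i%:Z| <= K) ->
  (forall i j, (i <= T)%N -> (j <= T)%N ->
     c0 <= `|1 - slope p q N A i%:Z - slope p q N A j%:Z|) ->
  periodic m f1 -> periodic m f2 -> (forall x, `|f0 x| <= 1) ->
  (forall x, `|f1 x| <= 1) -> (forall x, `|f2 x| <= 1) ->
  variation m f2 <= 8 * 2 ^+ k ->
  (forall (a : int) (l : nat), `|\sum_(i < l) f2 (a + i%:Z)| <= 2 * 2 ^+ (2 * n) / 2 ^+ k) ->
  `|trilinear m T A (quad p q N A) f0 f1 f2| <= C * (m%:R * T%:R) / 2 ^+ r.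
Proof.
move=> p00 K1 c00.
pose w : R := 2 ^+ j.
(* The constant is fixed before any [p] is given, so nothing says yet that [p1] is nonnegative. *)
pose p1' := `|p1|.
pose b := K * (K + 1) * w ^+ 2 / (4 * p0 ^+ 2 * c0) + 1.
pose C1 := 6 * b + 16 * (4 + 3 * K + p1' * (12 * b + 9 * b ^+ 2)) + 2.
have K0 : 0 <= K by apply: le_trans K1.
have w1 : 1 <= w by rewrite exprn_ege1// ler1n.
have w0 : 0 < w by apply: lt_le_trans w1.
have b0 : 0 <= b.
  by rewrite addr_ge0// divr_ge0// ?mulr_ge0 ?sqr_ge0 ?addr_ge0// ltW.
have C10 : 0 <= C1.
  have q0 : 0 <= p1' * (12 * b + 9 * b ^+ 2).
    by rewrite mulr_ge0 ?normr_ge0// addr_ge0// mulr_ge0// sqr_ge0.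
  by rewrite /C1; lra.
exists (1 + 2 * (C1 + 8)); first by lra.
move=> n k r p q A f0 f1 f2 rk kn jk.
have a1 : (4 * r * 8 <= k)%N by lia.
have a2 : (k + 4 * r <= 2 * n)%N by lia.
have aB : (2 * n - k + 16 * r + k = 2 * n + 4 * r * 4)%N by lia.
have aM : (2 * n - k + 4 * r + k = 2 * n + 4 * r)%N by lia.
have az : (k - 20 * r - j + (4 * r * 5 + j) = k)%N by lia.
have aD : (k - 16 * r - j + (4 * r * 4 + j) = k)%N by lia.
have aT : (k - 16 * r - j + (2 * n - k + 16 * r) = 2 * n - j)%N by lia.
move=> m T N hp hK hc pf1 pf2 b0' b1' b2' hV hG.
have hp1 : p0 <= `|p| <= p1'.
  by case/andP: hp => -> h /=; apply: le_trans h _; exact: ler_norm.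
pose u : R := 2 ^+ (4 * r); pose x : R := 2 ^+ (2 * n); pose y : R := 2 ^+ k.
have two1 : 1 <= 2 :> R by rewrite ler1n.
have u1 : 1 <= u by rewrite exprn_ege1.
have u0 : 0 < u by apply: lt_le_trans u1.
have x0 : 0 < x by rewrite exprn_gt0.
have y0 : 0 < y by rewrite exprn_gt0.
have uy : u ^+ 8 <= y by rewrite -exprM; apply: ler_weXn2l.
have yx : y * u <= x by rewrite -exprD; apply: ler_weXn2l.
have un := gt_eqF u0; have xn := gt_eqF x0; have yn := gt_eqF y0; have wn := gt_eqF w0.
(* [B] is the side of the boxes on which the phase is linearised, [M] the number
   of shifts averaged over, and [z / D = 1 / u] the proportion of discarded boxes *)
pose B := (2 ^ (2 * n - k + 16 * r))%N.
pose M := (2 ^ (2 * n - k + 4 * r))%N.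
pose D := (2 ^ (k - 16 * r - j))%N.
pose z := (2 ^ (k - 20 * r - j))%N.
have em : m%:R = 2 * x by rewrite /m natrX exprS.
have eB : B%:R = x * u ^+ 4 / y.
  have e : B%:R * y = x * u ^+ 4.
    by rewrite /B natrX -exprM -!exprD aB.
  by rewrite -e mulfK ?yn.
have eM : M%:R = x * u / y.
  have e : M%:R * y = x * u.
    by rewrite /M natrX -!exprD aM.
  by rewrite -e mulfK ?yn.
have ez : z%:R = y / (u ^+ 5 * w).
  have e : z%:R * (u ^+ 5 * w) = y.
    by rewrite /z natrX -exprM -!exprD az.
  by rewrite -e mulfK// mulf_neq0 ?expf_neq0 ?un ?wn.
have eD : D%:R = y / (u ^+ 4 * w).
  have e : D%:R * (u ^+ 4 * w) = y.
    by rewrite /D natrX -exprM -!exprD aD.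
  by rewrite -e mulfK// mulf_neq0 ?expf_neq0 ?un ?wn.
have DB : (D * B = T)%N by rewrite /D /B /T -expnD aT.
have m0 : (0 < m)%N by rewrite expn_gt0.
have hJ : cube_sum m T (quad p q N A) f2 <= T%:R ^+ 3 * m%:R * ((C1 + 8) / u).
  rewrite -DB.
  apply: le_trans (cube_sum_bound (M := M) (z := z) m0 _ _ _ pf2 b2' hV hG _ p00 hp1 K1 c00 _ _) _;
    rewrite ?expn_gt0 ?DB//.
  have := @box_err_le m B M z N p0 p1' K c0 x y u w b u1 w1 y0 x0 p00 (normr_ge0 _) K1 c00 uy yx em eB eM ez erefl erefl.
  rewrite -/C1 => hb.
  apply: (@le_trans _ _ (D%:R ^+ 3 * (B%:R ^+ 3 * m%:R * (C1 / u)) +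
     D%:R ^+ 3 * (B%:R ^+ 3 * m%:R * (8 / u)))); last first.
    by rewrite -DB natrM le_eqVlt; apply/orP; left; apply/eqP; field; rewrite un.
  apply: lerD; first by rewrite ler_wpM2l ?exprn_ge0.
  rewrite [leLHS]mulrA.
  rewrite [leRHS](_ : _ = B%:R ^+ 3 * m%:R * D%:R ^+ 2 * (D%:R * (8 / u))); last by ring.
  rewrite ler_wpM2l ?mulr_ge0 ?exprn_ge0//.
  have -> : D%:R * (8 / u) = 8 * z%:R by rewrite eD ez; field; rewrite un wn.
  rewrite -natrM ler_nat.
  have z1 : (0 < z)%N by rewrite expn_gt0.
  by move: z1; clearbody z; clear; lia.
have := trilinear_pow4 T A (quad p q N A) m0 pf1 pf2 b0' b1'.
set L := trilinear _ _ _ _ _ _ _ => hL.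
have t0 : 0 < 2 ^+ r :> R by rewrite exprn_gt0.
have C0 : 0 <= 1 + 2 * (C1 + 8) by lra.
have P0 : 0 <= (1 + 2 * (C1 + 8)) * (m%:R * T%:R) / 2 ^+ r.
  apply: divr_ge0; last exact: ltW.
  by apply: mulr_ge0 => //; apply: mulr_ge0.
rewrite -(@ler_pXn2r _ 4)// ?nnegrE//.
have -> : `|L| ^+ 4 = L ^+ 4.
  by rewrite -normrX ger0_norm// (exprM L 2 2) sqr_ge0.
apply: (le_trans hL).
apply: (@le_trans _ _ (2 * T%:R * m%:R ^+ 3 * (T%:R ^+ 3 * m%:R * ((C1 + 8) / u)))).
  by rewrite ler_wpM2l// !mulr_ge0// exprn_ge0.
have eu : u = (2 ^+ r) ^+ 4 by rewrite -exprM mulnC.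
have -> : 2 * T%:R * m%:R ^+ 3 * (T%:R ^+ 3 * m%:R * ((C1 + 8) / u)) =
   (2 * (C1 + 8)) * ((m%:R * T%:R / 2 ^+ r) ^+ 4).
  by rewrite eu; field; rewrite (gt_eqF t0).
rewrite -(mulrA (1 + 2 * (C1 + 8))) [leRHS]exprMn ler_wpM2r//.
set c := 2 * (C1 + 8).
(* The summand [1] makes the constant at most its own fourth power, so that no root has to be
   taken. *)
have c1 : 1 <= 1 + c by rewrite /c; lra.
apply: (@le_trans _ _ (1 + c)); first by lra.
by rewrite -[leLHS]expr1; apply: ler_weXn2l.
Qed.

End Smoothing.

(** * Summation by parts against a coarse third function *)

Section Coarse.
Variable R : realFieldType.

Lemma abel_bound (T : nat) (h w : nat -> R) (G : R) :
  (forall l, `|\sum_(i < l) h i| <= G) ->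
  `|\sum_(t < T) h t * w t| <= G * (`|w T| + \sum_(t < T) `|w t.+1 - w t|).
Proof.
move=> hG.
have -> : \sum_(t < T) h t * w t = (\sum_(i < T) h i) * w T
    - \sum_(t < T) (\sum_(i < t.+1) h i) * (w t.+1 - w t).
  elim: T => [|T IH]; first by rewrite !big_ord0; ring.
  rewrite big_ord_recr /= IH [X in _ = _ - X]big_ord_recr /=.
  by rewrite ![\sum_(i < T.+1) h i]big_ord_recr /=; ring.
apply: le_trans (ler_normB _ _) _; rewrite mulrDr mulr_sumr.
apply: lerD; first by rewrite normrM ler_wpM2r.
apply: le_trans (ler_norm_sum _ _ _) _; apply: ler_sum => t _.
by rewrite normrM ler_wpM2r.
Qed.

Variables (m T : nat) (A : int) (Q : int -> int) (f0 f1 f2 : int -> R) (G V : R) (L : nat).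
Hypothesis m0 : (0 < m)%N.
Hypothesis pf0 : periodic m f0.
Hypothesis pf1 : periodic m f1.
Hypothesis pf2 : periodic m f2.
Hypothesis b2 : forall x, `|f2 x| <= 1.
Hypothesis fV : variation m f2 <= V.
Hypothesis QL : forall t : nat, (t < T)%N -> `|Q t.+1%:Z - Q t%:Z| <= L%:Z.

Let moving_variation (a : nat -> int) (l : nat) :
  (forall t, (t < T)%N -> `|a t.+1 - a t| <= l%:Z) ->
  csum m (fun x => \sum_(t < T) `|f2 (x + a t.+1) - f2 (x + a t)|) <= (l * T)%:R * V.
Proof.
move=> ha; rewrite csum_sum.
have -> : (l * T)%:R * V = \sum_(t < T) l%:R * V.
  by rewrite sumr_const card_ord -(mulr_natl (l%:R * V)) natrM; ring.
have V0 : 0 <= variation m f2 by apply: sumr_ge0.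
apply: ler_sum => t _.
have := variation_shift m0 (a t) (a t.+1 - a t) pf2.
rewrite (eq_csum m (g := fun x => `|f2 (x + a t.+1) - f2 (x + a t)|)); last first.
  by move=> x; congr `|f2 _ - _|; ring.
move=> h; apply: (le_trans h); apply: ler_pM => //.
by rewrite pmulrn ler_int ha.
Qed.

(** For fixed [x], summation by parts in [t] with the window sums of [f1]. The variation of
    [t => f2 (x + Q t)] is controlled on average over [x], because each increment of [Q] is at most
    [L]. *)
Lemma trilinear_coarse1 : (forall x, `|f0 x| <= 1) ->
  (forall (a : int) (l : nat), `|\sum_(i < l) f1 (a + i%:Z)| <= G) ->
  `|trilinear m T A Q f0 f1 f2| <= G * (m%:R + (L * T)%:R * V).
Proof.
move=> b0 hG.
have G0 : 0 <= G by apply: le_trans (hG 0 0%N); rewrite normr_ge0.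
apply: le_trans (csum_norm _ _) _.
apply: (@le_trans _ _ (csum m (fun x => G * (1 +
   \sum_(t < T) `|f2 (x + Q t.+1%:Z) - f2 (x + Q t%:Z)|)))).
  apply: csum_le => x.
  rewrite (_ : \sum_(t < T) _ = f0 x * \sum_(t < T) f1 (x + A + t%:Z) * f2 (x + Q t%:Z)); last first.
    by rewrite mulr_sumr; apply: eq_bigr => t _; rewrite mulrA.
  rewrite normrM; apply: le_trans (_ : 1 * _ <= _); first exact: ler_wpM2r.
  rewrite mul1r.
  apply: le_trans (@abel_bound T (fun t => f1 (x + A + t%:Z)) (fun t => f2 (x + Q t%:Z)) G (hG (x + A))) _.
  by rewrite ler_wpM2l// lerD2r.
rewrite csumZ csumD ler_wpM2l//; apply: lerD.
  by rewrite /csum sumr_const card_ord.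
by apply: (moving_variation (a := fun t => Q t%:Z)).
Qed.

(** Substituting [x - A - t] for [x] frees [f1] from [t] and sums [f0] along a reversed window. The
    argument of [f2] now moves by [Q t - t], hence by at most [L + 1] at each step. *)
Lemma trilinear_coarse0 : (forall x, `|f1 x| <= 1) ->
  (forall (a : int) (l : nat), `|\sum_(i < l) f0 (a + i%:Z)| <= G) ->
  `|trilinear m T A Q f0 f1 f2| <= G * (m%:R + (L.+1 * T)%:R * V).
Proof.
move=> b1 hG.
have G0 : 0 <= G by apply: le_trans (hG 0 0%N); rewrite normr_ge0.
pose a (t : nat) := Q t%:Z - A - t%:Z.
have -> : trilinear m T A Q f0 f1 f2 =
    csum m (fun x => \sum_(t < T) f0 (x - A - t%:Z) * f1 x * f2 (x + a t)).
  rewrite /trilinear !csum_sum; apply: eq_bigr => t _.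
  rewrite -(@csum_shift _ _ m0 (fun x => f0 (x - A - t%:Z) * f1 x * f2 (x + a t)) (A + t%:Z)).
    by apply: eq_csum => x; congr (f0 _ * f1 _ * f2 _); rewrite /a; ring.
  move=> x; congr (_ * _ * _).
  - by rewrite -[RHS]pf0; congr f0; ring.
  - exact: pf1.
  - by rewrite -[RHS]pf2; congr f2; ring.
apply: le_trans (csum_norm _ _) _.
apply: (@le_trans _ _ (csum m (fun x => G * (1 +
   \sum_(t < T) `|f2 (x + a t.+1) - f2 (x + a t)|)))).
  apply: csum_le => x.
  rewrite (_ : \sum_(t < T) _ = f1 x * \sum_(t < T) f0 (x - A - t%:Z) * f2 (x + a t)); last first.
    by rewrite mulr_sumr; apply: eq_bigr => t _; rewrite mulrCA mulrA.
  rewrite normrM; apply: le_trans (_ : 1 * _ <= _); first exact: ler_wpM2r.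
  rewrite mul1r.
  have hG' l : `|\sum_(i < l) f0 (x - A - i%:Z)| <= G.
    case: l => [|l]; first by rewrite big_ord0 normr0.
    apply: le_trans (hG (x - A - l%:Z) l.+1).
    rewrite le_eqVlt; apply/orP; left; apply/eqP; congr `|_|.
    rewrite (reindex_inj rev_ord_inj) /=; apply: eq_bigr => i _; congr f0.
    by rewrite subSS -subzn; [ring|rewrite -ltnS].
  apply: le_trans (@abel_bound T (fun t => f0 (x - A - t%:Z)) (fun t => f2 (x + a t)) G hG') _.
  by rewrite ler_wpM2l// lerD2r.
rewrite csumZ csumD ler_wpM2l//; apply: lerD.
  by rewrite /csum sumr_const card_ord.
apply: moving_variation => t tT.
have := QL tT; rewrite /a => h.
rewrite (_ : _ - _ = (Q t.+1%:Z - Q t%:Z) - 1); last by rewrite -addn1 PoszD; ring.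
apply: le_trans (ler_normB _ _) _.
rewrite (_ : L.+1%:Z = L%:Z + 1); last by rewrite -addn1 PoszD.
by apply: lerD.
Qed.

End Coarse.

Lemma quad_step (R : archiRealFieldType) (p q p1 K N : R) (A : int) (T L : nat) :
  1 <= N -> `|p| <= p1 -> K + p1 + 1 <= L%:R ->
  (forall i, (i <= T)%N -> `|slope p q N A i%:Z| <= K) ->
  forall t : nat, (t < T)%N ->
    `|quad p q N A t.+1%:Z - quad p q N A t%:Z| <= L%:Z.
Proof.
move=> N1 hp hL hK t tT.
have N0 : 0 < N by apply: lt_le_trans N1.
have [e he E] := quad_diff q A t%:Z 1 t%:Z N0 hp.
have p10 : 0 <= p1 by apply: le_trans hp.
rewrite -(ler_int R) intr_norm intrD intrN (_ : t.+1%:Z = t%:Z + 1); last by rewrite -addn1 PoszD.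
rewrite E mulr1; apply: le_trans (ler_normD _ _) _.
apply: (@le_trans _ _ (K + (1 + p1))); last by rewrite -pmulrn; lra.
apply: lerD; first by apply: hK; rewrite ltnW.
apply: (le_trans he); rewrite lerD2l subrr normr0 normr1.
rewrite (_ : 2 * _ * _ + _ = 1); last by ring.
by rewrite mulr1 ler_pdivrMr// ler_peMr.
Qed.

(** * Periodic step functions *)

Section StepFunctions.
Variable R : realFieldType.
Variables (m b c : nat).
Hypothesis b0 : (0 < b)%N.
Hypothesis c0 : (0 < c)%N.
Hypothesis mE : m = (c * b)%N.

Definition ext (h : nat -> R) (x : int) : R := h `|(x %% m%:Z)%Z|%N.

Let m0 : (0 < m)%N. Proof. by rewrite mE muln_gt0 c0. Qed.

Lemma ext_periodic h : periodic m (ext h).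
Proof. by move=> x; rewrite /ext modzDr. Qed.

Lemma ext_nat h (i : nat) : ext h i%:Z = h (i %% m)%N.
Proof. by rewrite /ext modz_nat. Qed.

Lemma ext_shift h (x : int) (i : nat) :
  ext h (x + i%:Z) = ext h (`|(x %% m%:Z)%Z|%N + i)%N%:Z.
Proof.
rewrite /ext PoszD gez0_abs ?modzDml// modz_ge0//.
by rewrite -lt0n.
Qed.

(** Jumps occur only at multiples of [b], and a period contains [c] of these. *)
Lemma ext_variation h (J : R) :
  (forall y, ~~ (b %| y.+1)%N -> h y.+1 = h y) ->
  (forall y y', `|h y - h y'| <= J) -> variation m (ext h) <= c%:R * J.
Proof.
move=> hb hJ; rewrite /variation /csum.
have J0 : 0 <= J by apply: le_trans (hJ 0 0)%N.
pose g (i : nat) := `|ext h (i%:Z + 1) - ext h i%:Z|.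
have -> : \sum_(i < m) g i = \sum_(i < c * b) g i by rewrite -mE.
rewrite sum_blocks /g {g}.
apply: (@le_trans _ _ (\sum_(i < c) J)); last by rewrite sumr_const card_ord mulr_natl.
apply: ler_sum => i _; case: b b0 mE hb => // b' _ mE' hb.
rewrite big_ord_recr /= big1 ?add0r ?hJ// => r _.
have lt : (i * b'.+1 + r < m)%N.
  have := ltn_ord i; have := ltn_ord r; rewrite mE' => l1 l2.
  have : (i.+1 * b'.+1 <= c * b'.+1)%N by rewrite leq_mul2r l2 orbT.
  by rewrite mulSn; lia.
have nd : ~~ (b'.+1 %| (i * b'.+1 + r).+1)%N.
  rewrite -addnS dvdn_addr ?dvdn_mull//.
  by apply/negP => /dvdn_leq; have := ltn_ord r; lia.
rewrite -PoszD addn1 !ext_nat (modn_small lt) modn_small ?hb ?subrr ?normr0//.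
move: lt; rewrite leq_eqVlt => /orP[/eqP e|//].
by case/negP: nd; rewrite e mE' dvdn_mull.
Qed.

(** A window is a difference of two initial segments; in each of them the complete blocks cancel and
    fewer than [b] terms of size at most one remain. *)
Lemma ext_window h : (forall y, `|h y| <= 1) ->
  (forall i, (i < c)%N -> \sum_(r < b) h (i * b + r)%N = 0) ->
  forall (a : int) (l : nat), `|\sum_(i < l) ext h (a + i%:Z)| <= 2 * b%:R.
Proof.
move=> h1 hz a l.
have pre (y : nat) : `|\sum_(i < y) ext h i%:Z| <= b%:R.
  rewrite (divn_eq y b) big_split_ord /=.
  rewrite (sum_blocks (y %/ b) b (fun i => ext h i%:Z)) big1 ?add0r.
    apply: le_trans (ler_norm_sum _ _ _) _.
    apply: (@le_trans _ _ (\sum_(i < y %% b) 1)); first by apply: ler_sum => i _; exact: h1.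
    by rewrite sumr_const card_ord ler_nat ltnW// ltn_mod.
  move=> i _; rewrite -[RHS](hz (i %% c)%N) ?ltn_mod//.
  apply: eq_bigr => r _; rewrite ext_nat; congr h.
  rewrite {1}(divn_eq i c) mulnDl -mulnA -mE -addnA modnMDl modn_small//.
  rewrite mE; have := ltn_ord r; have : (i %% c < c)%N by rewrite ltn_mod.
  move=> l1 l2; have : ((i %% c).+1 * b <= c * b)%N by rewrite leq_mul2r l1 orbT.
  by rewrite mulSn; lia.
pose a' := `|(a %% m%:Z)%Z|%N.
have -> : \sum_(i < l) ext h (a + i%:Z) =
    \sum_(i < a' + l) ext h i%:Z - \sum_(i < a') ext h i%:Z.
  by rewrite big_split_ord /= [RHS]addrAC subrr add0r; apply: eq_bigr => i _; exact: ext_shift.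
apply: le_trans (ler_normB _ _) _.
by rewrite mulr2n mulrDl mul1r; apply: lerD.
Qed.

End StepFunctions.

Section TrilinearAlgebra.
Variable R : realFieldType.
Variables (m T : nat) (A : int) (Q : int -> int).
Implicit Types f g : int -> R.
Local Notation Tr := (@trilinear R m T A Q).

Lemma trilinearB2 f0 f1 f g :
  Tr f0 f1 (fun x => f x - g x) = Tr f0 f1 f - Tr f0 f1 g.
Proof.
rewrite /trilinear /csum -sumrB; apply: eq_bigr => x _; rewrite -sumrB.
by apply: eq_bigr => t _; ring.
Qed.

Lemma trilinearB1 f0 f g f2 :
  Tr f0 (fun x => f x - g x) f2 = Tr f0 f f2 - Tr f0 g f2.
Proof.
rewrite /trilinear /csum -sumrB; apply: eq_bigr => x _; rewrite -sumrB.
by apply: eq_bigr => t _; ring.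
Qed.

Lemma trilinearB0 f g f1 f2 :
  Tr (fun x => f x - g x) f1 f2 = Tr f f1 f2 - Tr g f1 f2.
Proof.
rewrite /trilinear /csum -sumrB; apply: eq_bigr => x _; rewrite -sumrB.
by apply: eq_bigr => t _; ring.
Qed.

Lemma trilinearZ (U : R) f0 f1 f2 : U != 0 -> Tr f0 f1 f2 = U ^+ 3 *
  Tr (fun x => U^-1 * f0 x) (fun x => U^-1 * f1 x) (fun x => U^-1 * f2 x).
Proof.
move=> U0; rewrite /trilinear /csum mulr_sumr; apply: eq_bigr => x _.
by rewrite mulr_sumr; apply: eq_bigr => t _; field.
Qed.

Lemma periodicZ (U : R) f : periodic m f -> periodic m (fun x => U * f x).
Proof. by move=> pf x; rewrite pf. Qed.

Lemma norm_scaled (U x : R) : 0 < U -> `|x| <= U -> `|U^-1 * x| <= 1.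
Proof.
move=> U0 h; rewrite normrM ger0_norm ?invr_ge0 ?(ltW U0)//.
by rewrite -(ler_pM2l U0) mulVKf ?gt_eqF// mulr1.
Qed.

Lemma variation_scaled (U V : R) f : 0 < U -> variation m f <= U * V ->
  variation m (fun x => U^-1 * f x) <= V.
Proof.
move=> U0 h; rewrite -(ler_pM2l U0); apply: le_trans h.
rewrite /variation /csum mulr_sumr le_eqVlt; apply/orP; left; apply/eqP.
apply: eq_bigr => x _; rewrite -mulrBr normrM ger0_norm ?invr_ge0 ?(ltW U0)//.
by rewrite mulVKf// gt_eqF.
Qed.

Lemma window_scaled (U G : R) f : 0 < U ->
  (forall (a : int) (l : nat), `|\sum_(i < l) f (a + i%:Z)| <= U * G) ->
  forall (a : int) (l : nat), `|\sum_(i < l) U^-1 * f (a + i%:Z)| <= G.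
Proof.
move=> U0 h a l; rewrite -mulr_sumr normrM ger0_norm ?invr_ge0 ?(ltW U0)//.
by rewrite -(ler_pM2l U0) mulVKf ?gt_eqF.
Qed.

End TrilinearAlgebra.

(** * Densities on the dyadic tree *)

Section Densities.
Variable R : archiRealFieldType.

(* densities of a probability measure on the dyadic intervals of level
   [k <= n], equal to Lebesgue measure up to level [k0] *)
Definition density_tree (n k0 : nat) (C0 g : R) (d : nat -> nat -> R) : Prop :=
  [/\ forall k J, (k < n)%N -> (J < 2 ^ k)%N ->
        d k J = (d k.+1 (2 * J)%N + d k.+1 (2 * J).+1) / 2,
      forall k J, (k <= n)%N -> (J < 2 ^ k)%N -> 0 <= d k J <= C0 * g ^+ k &
      forall k J, (k <= k0)%N -> (J < 2 ^ k)%N -> d k J = 1].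

Section Steps.
Variables (n k0 : nat) (C0 g : R) (d : nat -> nat -> R).
Hypothesis C00 : 0 < C0.
Hypothesis g1 : 1 <= g.
Hypothesis hd : density_tree n k0 C0 g d.

Definition step (k y : nat) : R :=
  if (y < 2 ^ (2 * n))%N then d k (y %/ 2 ^ (2 * n - k))%N else 0.

(** Twice the [2 ^ (2 n)] grid points of the unit interval: the step functions vanish on the second
    half, so that the periodic form sees no pattern that wraps around. *)
Definition period := (2 ^ (2 * n).+1)%N.

Definition stepf k := ext period (step k).

Definition diff_stepf k := ext period (fun y => step k.+1 y - step k y).

Lemma diff_stepfE k : diff_stepf k = (fun x => stepf k.+1 x - stepf k x).
Proof. by []. Qed.

Lemma index_lt k y : (k <= n)%N -> (y < 2 ^ (2 * n))%N -> (y %/ 2 ^ (2 * n - k) < 2 ^ k)%N.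
Proof.
move=> kn yl; rewrite ltn_divLR ?expn_gt0// -expnD.
by rewrite (_ : k + (2 * n - k) = 2 * n)%N; last by move: kn; clear; lia.
Qed.

Lemma step_bound k y : (k <= n)%N -> 0 <= step k y <= C0 * g ^+ k.
Proof.
move=> kn; have [_ h _] := hd; rewrite /step; case: ifP => yl.
  by apply: h => //; apply: index_lt.
by rewrite lexx mulr_ge0 ?ltW// exprn_gt0// (lt_le_trans _ g1).
Qed.

Lemma bound_mono k l : (k <= l)%N -> C0 * g ^+ k <= C0 * g ^+ l.
Proof. by move=> kl; rewrite ler_pM2l// ler_weXn2l. Qed.

Lemma stepf_bound k l x : (k <= l)%N -> (l <= n)%N -> `|stepf k x| <= C0 * g ^+ l.
Proof.
move=> kl ln; have /andP[h1 h2] := step_bound `|(x %% period)%Z|%N (leq_trans kl ln).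
by rewrite /stepf /ext ger0_norm//; apply: le_trans h2 (bound_mono kl).
Qed.

Lemma diff_step_bound k l y : (k < l)%N -> (l <= n)%N ->
  `|step k.+1 y - step k y| <= C0 * g ^+ l.
Proof.
move=> kl ln.
have /andP[h1 h2] := step_bound y (leq_trans kl ln).
have /andP[h3 h4] := step_bound y (leq_trans (ltnW kl) ln).
have := bound_mono kl; have := bound_mono (ltnW kl); rewrite ler_norml; lra.
Qed.

Lemma step_const k y : (k <= n)%N -> ~~ (2 ^ (2 * n - k) %| y.+1)%N ->
  step k y.+1 = step k y.
Proof.
move=> kn nd; rewrite /step.
have -> : (y.+1 < 2 ^ (2 * n))%N = (y < 2 ^ (2 * n))%N.
  rewrite [RHS]leq_eqVlt; case: eqP => //= e; case/negP: nd; rewrite e.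
  by apply: dvdn_exp2l; rewrite leq_subr.
by case: ifP => // yl; rewrite divnS ?expn_gt0// (negbTE nd) add0n.
Qed.

Lemma period_split k : (k <= n)%N -> period = (2 ^ k.+1 * 2 ^ (2 * n - k))%N.
Proof. by move=> kn; rewrite /period -expnD; congr (_ ^ _)%N; move: kn; clear; lia. Qed.

Lemma stepf_variation k l : (k <= l)%N -> (l <= n)%N ->
  variation period (stepf k) <= C0 * g ^+ l * (2 * 2 ^+ k).
Proof.
move=> kl ln; have kn := leq_trans kl ln.
have := @ext_variation R period (2 ^ (2 * n - k)) (2 ^ k.+1) _ _ (period_split kn)
  (step k) (C0 * g ^+ k).
rewrite !expn_gt0 natrX exprS => h.
apply: le_trans (h isT isT _ _) _.
- by move=> y; apply: step_const.
- move=> y y'; have := step_bound y kn; have := step_bound y' kn.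
  by rewrite ler_norml; lra.
- by rewrite mulrC ler_pM2r ?bound_mono// mulr_gt0// exprn_gt0.
Qed.

Lemma diff_stepf_variation k l : (k < l)%N -> (l <= n)%N ->
  variation period (diff_stepf k) <= C0 * g ^+ l * (8 * 2 ^+ k).
Proof.
move=> kl ln; have kn := leq_trans kl ln.
have := @ext_variation R period (2 ^ (2 * n - k.+1)) (2 ^ k.+2) _ _ (period_split kn)
  (fun y => step k.+1 y - step k y) (C0 * g ^+ l + C0 * g ^+ l).
rewrite !expn_gt0 natrX => h.
apply: le_trans (h isT isT _ _) _.
- move=> y nd; rewrite !step_const// 1?ltnW//.
  apply: contra nd => nd; apply: dvdn_trans nd; apply: dvdn_exp2l; lia.
- move=> y y'; apply: le_trans (ler_normB _ _) _; apply: lerD; exact: diff_step_bound.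
- by rewrite !exprS le_eqVlt; apply/orP; left; apply/eqP; ring.
Qed.

(** By the averaging relation the two halves of an interval of level [k] contribute opposite
    amounts, so the difference of consecutive densities has mean zero on each such interval. *)
Lemma diff_stepf_window k l : (k < l)%N -> (l <= n)%N ->
  forall (a : int) (w : nat), `|\sum_(i < w) diff_stepf k (a + i%:Z)| <=
    C0 * g ^+ l * (2 * 2 ^+ (2 * n) / 2 ^+ k).
Proof.
move=> kl ln a w; have kn := leq_trans kl ln.
have U0 : 0 < C0 * g ^+ l by rewrite mulr_gt0// exprn_gt0// (lt_le_trans _ g1).
pose h y := (C0 * g ^+ l)^-1 * (step k.+1 y - step k y).
have -> : \sum_(i < w) diff_stepf k (a + i%:Z) =
    C0 * g ^+ l * \sum_(i < w) ext period h (a + i%:Z).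
  rewrite mulr_sumr; apply: eq_bigr => i _.
  by rewrite /diff_stepf /ext /h mulVKf// gt_eqF.
rewrite normrM (ger0_norm (ltW U0)) ler_pM2l//.
have -> : 2 * 2 ^+ (2 * n) / 2 ^+ k = 2 * (2 ^ (2 * n - k))%N%:R :> R.
  rewrite natrX -mulrA; congr (_ * _).
  apply: (@mulIf _ (2 ^+ k)); first by rewrite expf_neq0.
  by rewrite divfK ?expf_neq0// -exprD; congr (_ ^+ _); lia.
apply: (@ext_window R period (2 ^ (2 * n - k)) (2 ^ k.+1) _ _ (period_split (ltnW kn)));
  rewrite ?expn_gt0//.
  by move=> y; apply: norm_scaled => //; apply: diff_step_bound.
move=> i il; rewrite /h -mulr_sumr.
rewrite [X in _ * X](_ : _ = 0) ?mulr0//.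
have eb : (2 ^ (2 * n - k) = 2 ^ (2 * n - k.+1) + 2 ^ (2 * n - k.+1))%N.
  by rewrite addnn -mul2n -expnS; congr (_ ^ _)%N; lia.
set b' := (2 ^ (2 * n - k.+1))%N in eb.
have b'0 : (0 < b')%N by rewrite expn_gt0.
have nk : (2 * n = k + (2 * n - k))%N by lia.
pose v (r : nat) := step k.+1 (i * 2 ^ (2 * n - k) + r) - step k (i * 2 ^ (2 * n - k) + r).
rewrite -/(v _); have -> : \sum_(r < 2 ^ (2 * n - k)) v r = \sum_(r < b' + b') v r.
  by rewrite -eb.
have [ik|ik] := ltnP i (2 ^ k); last first.
  apply: big1 => r _.
  have out : (i * 2 ^ (2 * n - k) + r < 2 ^ (2 * n))%N = false.
    apply/negbTE; rewrite -leqNgt; apply: leq_trans (leq_addr _ _).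
    by rewrite {1}nk expnD leq_mul2r ik orbT.
  by rewrite /v /step !out subrr.
have in_range r : (r < b' + b')%N -> (i * 2 ^ (2 * n - k) + r < 2 ^ (2 * n))%N.
  rewrite -eb => rl; rewrite [X in (_ < 2 ^ X)%N]nk expnD.
  have : (i.+1 * 2 ^ (2 * n - k) <= 2 ^ k * 2 ^ (2 * n - k))%N.
    by rewrite leq_mul2r ik orbT.
  by apply: leq_trans; rewrite mulSn addnC ltn_add2r.
have ed r : (r < b' + b')%N -> step k (i * 2 ^ (2 * n - k) + r) = d k i.
  move=> rl; rewrite /step in_range// divnMDl ?expn_gt0// divn_small ?addn0//.
  by rewrite eb.
have ib r : (i * 2 ^ (2 * n - k) + r = (2 * i) * b' + r)%N.
  by rewrite eb -mulnA (mulnCA 2) mul2n addnn.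
have [hav _ _] := hd.
rewrite big_split_ord /=.
rewrite (eq_bigr (fun=> d k.+1 (2 * i)%N - d k i)); last first.
  move=> r _; have rl := ltn_ord r.
  rewrite /v ed; last by apply: leq_trans rl (leq_addr _ _).
  rewrite /step in_range; last by apply: leq_trans rl (leq_addr _ _).
  by rewrite ib divnMDl// (divn_small rl) addn0.
rewrite [X in _ + X](eq_bigr (fun=> d k.+1 (2 * i).+1%N - d k i)); last first.
  move=> r _; have rl := ltn_ord r.
  rewrite /v ed; last by rewrite ltn_add2l.
  rewrite /step in_range; last by rewrite ltn_add2l.
  by rewrite ib addnA -[X in (_ + X + _)%N]mul1n -mulnDl divnMDl// (divn_small rl) addn0 addn1.
rewrite !sumr_const !card_ord -mulrnDl (hav k i)// ?(leq_trans kl)//.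
by rewrite (_ : _ + _ = 0) ?mul0rn//; field.
Qed.

End Steps.
End Densities.

(** * Telescoping over dyadic levels *)

Lemma half_facts k : [/\ (k %/ 2 + (k - k %/ 2) = k)%N, (k <= 64 * (k - k %/ 2))%N,
  (k <= (2 * (k %/ 2)).+1)%N, (k %/ 2 <= k)%N & (k <= 2 * k)%N].
Proof. by split; lia. Qed.

Lemma half_ge j k : (6 * j < k)%N -> (3 * j <= k %/ 2)%N.
Proof. by lia. Qed.

Section Telescoping.
Variable R : archiRealFieldType.
Variables (n k0 j L : nat) (C0 g s C : R) (d : nat -> nat -> R).
Variables (A : int) (Q : int -> int).
Hypothesis C00 : 0 < C0.
Hypothesis g1 : 1 <= g.
Hypothesis hd : density_tree n k0 C0 g d.
Hypothesis s0 : 0 < s.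
Hypothesis s1 : s < 1.
Hypothesis s128 : s ^+ 128 = 2^-1.
Hypothesis gs : g ^+ 3 * s = 1.
Hypothesis C_gt0 : 0 < C.
Hypothesis jn : (j <= 2 * n)%N.

Let m := period n.
Let T := (2 ^ (2 * n - j))%N.
(** Up to constants, [a ^ k] is the smoothing gain at level [k], [b ^ k] is the gain available at
    level [k %/ 2], and [s ^ k] is what remains of it after the growth [g ^ (3 k)] of the
    densities. *)
Let a := s ^+ 4.
Let b := s ^+ 2.
Let F := stepf n d.
Let D := diff_stepf n d.
Local Notation Tr := (@trilinear R m T A Q).

Hypothesis smooth : forall (k r : nat) (f0 f1 f2 : int -> R),
  (32 * r <= k)%N -> (k <= n)%N -> (3 * j <= k)%N ->
  periodic m f1 -> periodic m f2 -> (forall x, `|f0 x| <= 1) ->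
  (forall x, `|f1 x| <= 1) -> (forall x, `|f2 x| <= 1) ->
  variation m f2 <= 8 * 2 ^+ k ->
  (forall (a : int) (l : nat), `|\sum_(i < l) f2 (a + i%:Z)| <= 2 * 2 ^+ (2 * n) / 2 ^+ k) ->
  `|Tr f0 f1 f2| <= C * (m%:R * T%:R) / 2 ^+ r.

Hypothesis QL : forall t : nat, (t < T)%N -> `|Q t.+1%:Z - Q t%:Z| <= L%:Z.

Let m0 : (0 < m)%N. Proof. by rewrite expn_gt0. Qed.
Let a0 : 0 < a. Proof. by rewrite exprn_gt0. Qed.
Let a1 : a < 1. Proof. by rewrite exprn_ilt1// ltW. Qed.
Let b0 : 0 < b. Proof. by rewrite exprn_gt0. Qed.
Let b1 : b < 1. Proof. by rewrite exprn_ilt1// ltW. Qed.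
Let Ug0 l : 0 < C0 * g ^+ l.
Proof. by rewrite mulr_gt0// exprn_gt0// (lt_le_trans _ g1). Qed.
Let F_per k : periodic m (F k). Proof. by apply: ext_periodic. Qed.
Let D_per k : periodic m (D k). Proof. by apply: ext_periodic. Qed.
Let D_bound k l x : (k < l)%N -> (l <= n)%N -> `|D k x| <= C0 * g ^+ l.
Proof. by move=> kl ln; apply: (diff_step_bound C00 g1 hd). Qed.
Let F_bound k l x : (k <= l)%N -> (l <= n)%N -> `|F k x| <= C0 * g ^+ l.
Proof. by move=> kl ln; apply: (stepf_bound C00 g1 hd). Qed.
Let mT0 : 0 < m%:R * T%:R :> R.
Proof. by rewrite mulr_gt0// ltr0n expn_gt0. Qed.

(** Dividing all three functions by [C0 * g ^ l] makes smoothing applicable, with [r = k %/ 32]; the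
    factor [2] absorbs the remainder of this division, since [a ^ 32 = 1/2]. *)
Let tri_diff2 k l f0 f1 : (k < l)%N -> (l <= n)%N -> (3 * j <= k)%N ->
  periodic m f1 ->
  (forall x, `|f0 x| <= C0 * g ^+ l) -> (forall x, `|f1 x| <= C0 * g ^+ l) ->
  `|Tr f0 f1 (D k)| <= (C0 * g ^+ l) ^+ 3 * (m%:R * T%:R) * (2 * C * a ^+ k).
Proof.
move=> kl ln jk p1 h0 h1.
have U0 := Ug0 l.
rewrite (trilinearZ _ _ _ _ _ _ _ (lt0r_neq0 U0)) normrM normrX (ger0_norm (ltW U0)).
rewrite -mulrA ler_wpM2l ?exprn_ge0 ?(ltW U0)//.
have rk : (32 * (k %/ 32) <= k)%N by rewrite mulnC leq_trunc_div.
apply: le_trans (smooth rk _ jk (periodicZ _ p1) (periodicZ _ (D_per k)) _ _ _ _ _) _.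
- by apply: leq_trans ln; exact: ltnW.
- by move=> x; apply: norm_scaled.
- by move=> x; apply: norm_scaled.
- by move=> x; apply: norm_scaled => //; apply: D_bound.
- by apply: variation_scaled => //; apply: (diff_stepf_variation C00 g1 hd).
- by apply: window_scaled => //; apply: (diff_stepf_window C00 g1 hd).
have -> : C * (m%:R * T%:R) / 2 ^+ (k %/ 32) = m%:R * T%:R * (C * (2 ^+ (k %/ 32))^-1) by ring.
rewrite ler_pM2l// (mulrC 2) -mulrA ler_pM2l//.
have -> : (2 ^+ (k %/ 32))^-1 = a ^+ (32 * (k %/ 32)).
  by rewrite /a -!exprM mulnA (exprM s 128) s128 exprVn.
apply: (@le_trans _ _ (2 * a ^+ (32 * (k %/ 32) + 32))).
  by rewrite exprD /a -[X in _ * (_ * X)]exprM s128 mulrCA divff// mulr1.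
rewrite ler_pM2l// ler_wiXn2l ?ltW//.
by rewrite {1}(divn_eq k 32) mulnC leq_add2l ltnW// ltn_mod.
Qed.

Let coarse_arith h k (l : nat) (X : R) : 0 <= X ->
  X * (2 * 2 ^+ (2 * n) / 2 ^+ k) * (m%:R + (l * T)%:R * (2 * 2 ^+ h)) <=
  X * (m%:R * T%:R) * ((2 ^+ j.+1 + 2 * l%:R) * (2 ^+ h / 2 ^+ k)).
Proof.
move=> X0; rewrite -[leLHS]mulrA -[leRHS]mulrA ler_wpM2l//.
have em : m%:R = 2 * 2 ^+ (2 * n) :> R by rewrite /m /period natrX exprS.
have eT : 2 ^+ (2 * n) = T%:R * 2 ^+ j :> R.
  by rewrite /T natrX -exprD subnK.
have h1 : 1 <= 2 ^+ h :> R by rewrite exprn_ege1// ler1n.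
rewrite natrM em.
rewrite [leRHS](_ : _ =
  2 * 2 ^+ (2 * n) / 2 ^+ k * (2 * (T%:R * 2 ^+ j) * 2 ^+ h + l%:R * T%:R * (2 * 2 ^+ h))); last first.
  by rewrite exprS; ring.
rewrite -eT ler_wpM2l//.
by rewrite lerD2r ler_peMr// mulr_ge0// exprn_ge0.
Qed.

Let tri_coarse1 h k l f0 : (k < l)%N -> (h <= l)%N -> (l <= n)%N ->
  (forall x, `|f0 x| <= C0 * g ^+ l) ->
  `|Tr f0 (D k) (F h)| <= (C0 * g ^+ l) ^+ 3 * (m%:R * T%:R) *
     ((2 ^+ j.+1 + 2 * L.+1%:R) * (2 ^+ h / 2 ^+ k)).
Proof.
move=> kl hl ln h0; have U0 := Ug0 l.
apply: (@le_trans _ _ ((C0 * g ^+ l) ^+ 3 * (m%:R * T%:R) *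
     ((2 ^+ j.+1 + 2 * L%:R) * (2 ^+ h / 2 ^+ k)))); last first.
  apply: ler_wpM2l; first by rewrite mulr_ge0 ?exprn_ge0// ltW.
  rewrite ler_wpM2r ?divr_ge0 ?exprn_ge0// lerD2l ler_wpM2l// ler_nat//.
rewrite (trilinearZ _ _ _ _ _ _ _ (lt0r_neq0 U0)) normrM normrX (ger0_norm (ltW U0)).
have X0 : 0 <= (C0 * g ^+ l) ^+ 3 by rewrite exprn_ge0 ?ltW.
apply: le_trans (coarse_arith h k L X0); rewrite -[leRHS]mulrA ler_wpM2l//.
apply: trilinear_coarse1 => //.
- by apply: periodicZ.
- by move=> x; apply: norm_scaled => //; apply: F_bound.
- by apply: variation_scaled => //; apply: (stepf_variation C00 g1 hd).
- by move=> x; apply: norm_scaled.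
- by apply: window_scaled => //; apply: (diff_stepf_window C00 g1 hd).
Qed.

Let tri_coarse0 h k l f1 : (k < l)%N -> (h <= l)%N -> (l <= n)%N -> periodic m f1 ->
  (forall x, `|f1 x| <= C0 * g ^+ l) ->
  `|Tr (D k) f1 (F h)| <= (C0 * g ^+ l) ^+ 3 * (m%:R * T%:R) *
     ((2 ^+ j.+1 + 2 * L.+1%:R) * (2 ^+ h / 2 ^+ k)).
Proof.
move=> kl hl ln p1 h1; have U0 := Ug0 l.
rewrite (trilinearZ _ _ _ _ _ _ _ (lt0r_neq0 U0)) normrM normrX (ger0_norm (ltW U0)).
have X0 : 0 <= (C0 * g ^+ l) ^+ 3 by rewrite exprn_ge0 ?ltW.
apply: le_trans (coarse_arith h k L.+1 X0); rewrite -[leRHS]mulrA ler_wpM2l//.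
apply: trilinear_coarse0 => //; try by apply: periodicZ.
- by move=> x; apply: norm_scaled => //; apply: F_bound.
- by apply: variation_scaled => //; apply: (stepf_variation C00 g1 hd).
- by move=> x; apply: norm_scaled.
- by apply: window_scaled => //; apply: (diff_stepf_window C00 g1 hd).
Qed.

(** Replaces a fine third function by a coarse one: the levels between [h] and [h + i] are removed
    one at a time by smoothing, and the costs add up to a geometric sum. *)
Let tri_refine h i l f0 f1 : (h + i <= l)%N -> (l <= n)%N -> (3 * j <= h)%N ->
  periodic m f1 ->
  (forall x, `|f0 x| <= C0 * g ^+ l) -> (forall x, `|f1 x| <= C0 * g ^+ l) ->
  `|Tr f0 f1 (F (h + i))| <= `|Tr f0 f1 (F h)| +
    (C0 * g ^+ l) ^+ 3 * (m%:R * T%:R) * (2 * C * ((a ^+ h - a ^+ (h + i)) / (1 - a))).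
Proof.
move=> hl ln jh p1 h0 h1; elim: i hl => [|i IH] hl.
  by rewrite addn0 subrr mul0r !mulr0 addr0.
have hl' : (h + i < l)%N by rewrite -addnS.
have := IH (ltnW hl').
have := @tri_diff2 (h + i) l f0 f1 hl' ln (leq_trans jh (leq_addr _ _)) p1 h0 h1.
rewrite /D diff_stepfE trilinearB2 -/F addnS.
set X := (C0 * g ^+ l) ^+ 3 * _; set t1 := Tr _ _ _; set t2 := Tr _ _ _.
set t3 := Tr _ _ _ => e1 e2.
have := ler_distD t2 t1 0; rewrite !subr0 => e3.
have eX : X * (2 * C * ((a ^+ h - a ^+ (h + i).+1) / (1 - a))) =
   X * (2 * C * a ^+ (h + i)) + X * (2 * C * ((a ^+ h - a ^+ (h + i)) / (1 - a))).
  rewrite exprS; field; rewrite subr_eq0 eq_sym lt_eqF//.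
by rewrite eX; lra.
Qed.

Let err : R := 2 * C + 2 * ((2 ^+ j.+1 + 2 * L.+1%:R) + 2 * C / (1 - a) / b).

(** Balances the two gains at level [k %/ 2]: the coarse part gains [2 ^ (k %/ 2) / 2 ^ k], the fine
    part [a ^ (k %/ 2)], and both are at most a constant times [b ^ k]. The division by [b] pays for
    odd [k]. *)
Let split_half k (X : R) (x : R) : (0 < X) ->
  x <= X * ((2 ^+ j.+1 + 2 * L.+1%:R) * (2 ^+ (k %/ 2) / 2 ^+ k)) +
    X * (2 * C * ((a ^+ (k %/ 2) - a ^+ k) / (1 - a))) ->
  x <= X * (((2 ^+ j.+1 + 2 * L.+1%:R) + 2 * C / (1 - a) / b) * b ^+ k).
Proof.
move=> X0 hx; apply: (le_trans hx); rewrite -mulrDr ler_pM2l// [leRHS]mulrDl.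
have [hk h64 hk1 _ _] := half_facts k.
apply: lerD.
  apply: ler_wpM2l; first by rewrite addr_ge0 ?exprn_ge0// mulr_ge0.
  have -> : 2 ^+ (k %/ 2) / 2 ^+ k = b ^+ (64 * (k - k %/ 2)) :> R.
    rewrite /b -exprM mulnA (exprM s 128) s128 exprVn.
    have -> : 2 ^+ k = 2 ^+ (k %/ 2) * 2 ^+ (k - k %/ 2) :> R by rewrite -exprD hk.
    by rewrite invfM mulrA divff ?mul1r// expf_neq0.
  by rewrite ler_wiXn2l ?ltW.
have a10 : 0 < 1 - a by rewrite subr_gt0.
have -> : 2 * C / (1 - a) / b * b ^+ k = 2 * C * (b ^+ k / b / (1 - a)) by ring.
rewrite ler_wpM2l ?mulr_ge0 ?(ltW C_gt0)//.
rewrite ler_pM2r ?invr_gt0//; apply: (@le_trans _ _ (a ^+ (k %/ 2))).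
  by rewrite lerBlDr lerDl exprn_ge0 ?ltW.
rewrite ler_pdivlMr// /a (exprM s 2 2) -/b -exprM -exprSr.
by rewrite ler_wiXn2l ?ltW.
Qed.

Let Lam k := Tr (F k) (F k) (F k).

(** The difference of levels is moved through the three slots. In the third one smoothing applies
    directly; in the other two the third function does not oscillate, so it is first coarsened to
    level [k %/ 2] and summation by parts is used. The relation [g ^ 3 * s = 1] turns [b ^ k] into
    [s ^ k]. *)
Let Lam_step k : (k < n)%N -> (6 * j < k)%N ->
  `|Lam k.+1 - Lam k| <= C0 ^+ 3 * g ^+ 3 * (m%:R * T%:R) * err * s ^+ k.
Proof.
move=> kn jk.
pose X := (C0 * g ^+ k.+1) ^+ 3 * (m%:R * T%:R).
have X0 : 0 < X by rewrite mulr_gt0// exprn_gt0.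
have b01 : b ^+ k = (s ^+ k) ^+ 2 by rewrite /b -!exprM mulnC.
have jh := half_ge jk; have [hk _ _ kh k2] := half_facts k.
have Fb x : `|F k x| <= C0 * g ^+ k.+1 by apply: F_bound.
have Fb1 x : `|F k.+1 x| <= C0 * g ^+ k.+1 by apply: F_bound.
have Db x : `|D k x| <= C0 * g ^+ k.+1 by apply: D_bound.
have e2 : `|Tr (F k.+1) (F k.+1) (D k)| <= X * (2 * C * b ^+ k).
  have jk3 := leq_trans jh kh.
  apply: le_trans (tri_diff2 (ltnSn k) kn jk3 (F_per _) Fb1 Fb1) _.
  rewrite -/X ler_pM2l// ler_wpM2l ?mulr_ge0 ?(ltW C_gt0)//.
  by rewrite /a (exprM s 2 2) -/b -exprM ler_wiXn2l ?ltW.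
have e1 : `|Tr (F k.+1) (D k) (F k)| <=
    X * (((2 ^+ j.+1 + 2 * L.+1%:R) + 2 * C / (1 - a) / b) * b ^+ k).
  apply: split_half => //.
  have h1 : (k %/ 2 + (k - k %/ 2) <= k.+1)%N by rewrite hk.
  have := tri_refine h1 kn jh (D_per k) Fb1 Db; rewrite hk => h.
  apply: (le_trans h); rewrite lerD2r; apply: tri_coarse1 => //; exact: leq_trans kh (leqnSn k).
have e0 : `|Tr (D k) (F k) (F k)| <=
    X * (((2 ^+ j.+1 + 2 * L.+1%:R) + 2 * C / (1 - a) / b) * b ^+ k).
  apply: split_half => //.
  have h1 : (k %/ 2 + (k - k %/ 2) <= k.+1)%N by rewrite hk.
  have := tri_refine h1 kn jh (F_per k) Db Fb; rewrite hk => h.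
  apply: (le_trans h); rewrite lerD2r; apply: tri_coarse0 => //; exact: leq_trans kh (leqnSn k).
have -> : Lam k.+1 - Lam k = Tr (F k.+1) (F k.+1) (D k) +
    Tr (F k.+1) (D k) (F k) + Tr (D k) (F k) (F k).
  by rewrite /D diff_stepfE trilinearB2 trilinearB1 trilinearB0 /Lam /F; ring.
have eX : C0 ^+ 3 * g ^+ 3 * (m%:R * T%:R) * err * s ^+ k =
   X * (2 * C * b ^+ k) + 2 * (X * (((2 ^+ j.+1 + 2 * L.+1%:R) + 2 * C / (1 - a) / b) * b ^+ k)).
  have gk3 : (g ^+ k) ^+ 3 = (g ^+ 3) ^+ k by rewrite -!exprM mulnC.
  rewrite b01 /X (exprS g k) !exprMn gk3.
  have -> : (s ^+ k) ^+ 2 = s ^+ k * s ^+ k by rewrite expr2.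
  have gk : (g ^+ 3) ^+ k * s ^+ k = 1 by rewrite -exprMn gs expr1n.
  transitivity (C0 ^+ 3 * g ^+ 3 * (m%:R * T%:R) * err * s ^+ k * ((g ^+ 3) ^+ k * s ^+ k)).
    by rewrite gk mulr1.
  by rewrite /err; ring.
have t1 := ler_normD (Tr (F k.+1) (F k.+1) (D k) + Tr (F k.+1) (D k) (F k)) (Tr (D k) (F k) (F k)).
have t2 := ler_normD (Tr (F k.+1) (F k.+1) (D k)) (Tr (F k.+1) (D k) (F k)).
by rewrite eX; lra.
Qed.

Lemma trilinear_telescope : (6 * j < k0)%N -> (k0 <= n)%N ->
  `|Lam n - Lam k0| <= C0 ^+ 3 * g ^+ 3 * (m%:R * T%:R) * err * (s ^+ k0 / (1 - s)).
Proof.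
move=> jk kn.
have s10 : 0 < 1 - s by rewrite subr_gt0.
have err0 : 0 <= err.
  have c1 : 0 <= 2 ^+ j.+1 + 2 * L.+1%:R :> R by rewrite addr_ge0 ?exprn_ge0// mulr_ge0.
  have c2 : 0 <= 2 * C / (1 - a) / b.
    apply: divr_ge0; last exact: ltW.
    by apply: divr_ge0; [rewrite mulr_ge0// ltW|rewrite subr_ge0 ltW].
  by move: C_gt0; rewrite /err; lra.
set X := C0 ^+ 3 * g ^+ 3 * (m%:R * T%:R) * err.
have X0 : 0 <= X.
  by rewrite mulr_ge0// mulr_ge0 ?(ltW mT0)// mulr_ge0 ?exprn_ge0 ?(ltW C00)// (le_trans _ g1).
have main i : (k0 + i <= n)%N ->
    `|Lam (k0 + i) - Lam k0| <= X * ((s ^+ k0 - s ^+ (k0 + i)) / (1 - s)).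
  elim: i => [|i IH] hi; first by rewrite addn0 !subrr normr0 mul0r mulr0.
  have hi' : (k0 + i < n)%N by rewrite -addnS.
  have h1 := IH (ltnW hi').
  have h2 := Lam_step hi' (leq_trans jk (leq_addr _ _)).
  rewrite addnS; have h3 := ler_distD (Lam (k0 + i)) (Lam (k0 + i).+1) (Lam k0).
  have -> : X * ((s ^+ k0 - s ^+ (k0 + i).+1) / (1 - s)) =
     X * s ^+ (k0 + i) + X * ((s ^+ k0 - s ^+ (k0 + i)) / (1 - s)).
    by rewrite exprS; field; rewrite gt_eqF.
  by move: h2; rewrite -/X; lra.
have := main (n - k0)%N; rewrite subnKC// => /(_ (leqnn n)) h; apply: (le_trans h).
rewrite ler_wpM2l// ler_pM2r ?invr_gt0// lerBlDr lerDl exprn_ge0// ltW//.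
Qed.

End Telescoping.

(** * Main term and integer patterns *)

Section Pattern.
Variable R : archiRealFieldType.

(** As a function of [v], [p (1 - 2 q - 2 p v)] decreases at rate [2 p ^ 2]; its sign at [5 tau],
    the middle of the gap between the two ranges, tells on which of them it stays away from zero. *)
Lemma slope_sum_away (p q p0 tau v : R) : 0 < p0 -> p0 <= `|p| -> 0 < tau ->
  (2 * tau <= v <= 4 * tau -> 0 <= p * (1 - 2 * q - 10 * p * tau) ->
     2 * p0 * tau <= `|1 - 2 * q - 2 * p * v|) /\
  (6 * tau <= v <= 8 * tau -> p * (1 - 2 * q - 10 * p * tau) <= 0 ->
     2 * p0 * tau <= `|1 - 2 * q - 2 * p * v|).
Proof.
move=> p00 hp t0; have pp : 0 < `|p| by apply: lt_le_trans hp.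
have pE : `|p| * `|p| = p * p by rewrite -normrM ger0_norm// -expr2 sqr_ge0.
have key (y w : R) : `|p| * (2 * `|p| * tau) <= y -> y <= `|p| * w -> 2 * p0 * tau <= w.
  move=> h1 h2; have := le_trans h1 h2; rewrite ler_pM2l// => h3.
  by apply: le_trans h3; rewrite ler_pM2r// ler_pM2l.
split=> /andP[v1 v2] hy.
  apply: (key (p * (1 - 2 * q - 2 * p * v))); last by rewrite -normrM ler_norm.
  have -> : `|p| * (2 * `|p| * tau) = p * p * (2 * tau) by rewrite -pE; ring.
  have -> : p * (1 - 2 * q - 2 * p * v) = p * (1 - 2 * q - 10 * p * tau)
      + p * p * (10 * tau - 2 * v) by ring.
  rewrite -[leLHS]add0r; apply: lerD => //; rewrite ler_wpM2l -?expr2 ?sqr_ge0//; lra.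
apply: (key (- (p * (1 - 2 * q - 2 * p * v)))); last by rewrite -normrM -normrN ler_norm.
have -> : `|p| * (2 * `|p| * tau) = p * p * (2 * tau) by rewrite -pE; ring.
have -> : - (p * (1 - 2 * q - 2 * p * v)) = - (p * (1 - 2 * q - 10 * p * tau))
      + p * p * (2 * v - 10 * tau) by ring.
rewrite -[leLHS]add0r; apply: lerD; first by rewrite oppr_ge0.
by rewrite ler_wpM2l -?expr2 ?sqr_ge0//; lra.
Qed.

(* [1 - k1 - k4] is affine in [k1 + k4], hence bounded away from [0] when the two
   steps range over one of [[T, 2 T]] and [[3 T, 4 T]] *)
Lemma good_start (p q p0 N : R) (T : nat) : 0 < p0 -> p0 <= `|p| -> 0 < N -> (0 < T)%N ->
  exists2 A : nat, (T <= A <= 3 * T)%N &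
    forall i j, (i <= T)%N -> (j <= T)%N ->
    2 * p0 * (T%:R / N) <= `|1 - slope p q N A%:Z i%:Z - slope p q N A%:Z j%:Z|.
Proof.
move=> p00 hp N0 T0; set tau := T%:R / N.
have t0 : 0 < tau by rewrite divr_gt0// ltr0n.
have e A i j : 1 - slope p q N A%:Z i%:Z - slope p q N A%:Z j%:Z =
    1 - 2 * q - 2 * p * ((2 * A + i + j)%N%:R / N).
  by rewrite /slope !intrD -!pmulrn (natrD _ (2 * A + i) j) (natrD _ (2 * A) i) (natrM _ 2 A); field; rewrite gt_eqF.
have rng (c c' A i j : nat) : (c * T <= 2 * A + i + j)%N -> (2 * A + i + j <= c' * T)%N ->
    c%:R * tau <= (2 * A + i + j)%N%:R / N <= c'%:R * tau.
  by move=> h1 h2; rewrite /tau !mulrA !ler_pM2r ?invr_gt0// -!natrM !ler_nat h1.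
have [hy|hy] := leP 0 (p * (1 - 2 * q - 10 * p * tau)).
  exists T; first by lia.
  move=> i j iT jT; rewrite e.
  by apply: (slope_sum_away q _ p00 hp t0).1 => //; apply: (rng 2%N 4%N); lia.
exists (3 * T)%N; first by lia.
move=> i j iT jT; rewrite e.
apply: (slope_sum_away q _ p00 hp t0).2; last exact: ltW.
by apply: (rng 6%N 8%N); lia.
Qed.

End Pattern.

Section MainTerm.
Variable R : archiRealFieldType.
Variables (n k0 : nat) (C0 g : R) (d : nat -> nat -> R).
Variables (A T N4 : nat) (Q : int -> int).
Hypothesis C00 : 0 < C0.
Hypothesis g1 : 1 <= g.
Hypothesis hd : density_tree n k0 C0 g d.
Hypothesis k0n : (k0 <= n)%N.
Hypothesis hN4 : (2 ^ (2 * n) = 4 * N4)%N.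
Hypothesis hA : forall t, (t < T)%N -> (A + t <= N4)%N.
Hypothesis hQ : forall t : nat, (t < T)%N -> `|Q t%:Z| <= N4%:Z.

Let m := period n.
Let F := stepf n d.

Let mE : m = (8 * N4)%N.
Proof. by rewrite /m /period expnS hN4; clear; lia. Qed.

Lemma stepf_small k (z : int) : 0 <= z < m%:Z -> F k z = step n d k `|z|%N.
Proof. by move=> /andP[z0 zm]; rewrite /F /stepf /ext modz_small ?z0// ger0_norm. Qed.

Let F_one (z : int) : 0 <= z < (4 * N4)%N%:Z -> F k0 z = 1.
Proof.
move=> hz; have [_ _ h1] := hd.
rewrite stepf_small; last by rewrite mE; move: hz; clear; lia.
have zl : (`|z| < 2 ^ (2 * n))%N by move: hz; rewrite hN4; clear; lia.
rewrite /step zl; apply: h1 => //; exact: index_lt.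
Qed.

(** For [x] in the middle half of the [4 N4] grid points, all three points stay in the unit
    interval, where the density of level [k0] is one. This contributes [2 N4 * T], a quarter of
    [m * T], and the other terms are nonnegative. *)
Lemma main_term : m%:R * T%:R / 4 <= trilinear m T A%:Z Q (F k0) (F k0) (F k0).
Proof.
have F0 z : 0 <= F k0 z by have /andP[] := step_bound C00 g1 hd `|(z %% m%:Z)%Z|%N k0n.
pose h (x : nat) := \sum_(t < T) F k0 x%:Z * F k0 (x%:Z + A%:Z + t%:Z) * F k0 (x%:Z + Q t%:Z).
have h0 x : 0 <= h x by apply: sumr_ge0 => t _; rewrite !mulr_ge0.
have -> : trilinear m T A%:Z Q (F k0) (F k0) (F k0) = \sum_(x < m) h x by [].
have -> : \sum_(x < m) h x = \sum_(x < N4 + (2 * N4 + 5 * N4)) h x.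
  by have <- : m = (N4 + (2 * N4 + 5 * N4))%N by rewrite mE; clear; lia.
rewrite (@big_split_ord _ _ _ N4 (2 * N4 + 5 * N4)) (@big_split_ord _ _ _ (2 * N4) (5 * N4)) /=.
apply: (@le_trans _ _ (\sum_(x < 2 * N4) h (N4 + x)%N)); last first.
  rewrite [leRHS]addrCA. by rewrite lerDl addr_ge0// sumr_ge0.
have -> : m%:R * T%:R / 4 = \sum_(x < 2 * N4) T%:R :> R.
  rewrite sumr_const card_ord -[RHS]mulr_natl mE.
  by rewrite (natrM _ 8) (natrM _ 2); field.
apply: ler_sum => x _; rewrite /h.
rewrite (eq_bigr (fun=> 1)); first by rewrite sumr_const card_ord.
move=> t _; have := hA (ltn_ord t); have := hQ (ltn_ord t).
rewrite ler_norml => /andP[q1 q2] a1; have xl := ltn_ord x.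
by rewrite !F_one ?mulr1//; move: q1 q2 a1 xl; clear; lia.
Qed.

(** Half of the period is empty, so a point displaced by at most a quarter of the grid cannot reach
    another copy of the support. *)
Lemma stepf_neq0 (z : int) : - N4%:Z <= z < (5 * N4)%N%:Z -> F n z != 0 ->
  exists y : nat, [/\ z = y%:Z, (y < 2 ^ (2 * n))%N & d n (y %/ 2 ^ n)%N != 0].
Proof.
move=> hz; have [z0|z0] := leP 0 z.
  rewrite stepf_small; last by rewrite mE; move: hz z0; clear; lia.
  rewrite /step; case: ifP => [yl nz|]; last by rewrite eqxx.
  exists `|z|%N; split=> //; first by rewrite gez0_abs.
  by move: nz; rewrite (_ : 2 * n - n = n)%N//; clear; lia.
have N40 : (0 < N4)%N by move: hN4; case: N4 => //; rewrite muln0 => e; have := expn_gt0 2 (2 * n); rewrite e.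
have <- : F n (z + m%:Z) = F n z by apply: ext_periodic.
rewrite stepf_small; last by rewrite mE; move: hz z0; clear; lia.
rewrite /step ifF ?eqxx// hN4 mE; move: hz z0; clear; lia.
Qed.

Lemma trilinear_pos_pattern : 0 < trilinear m T A%:Z Q (F n) (F n) (F n) ->
  exists x t y z : nat, [/\ (t < T)%N, y = (x + A + t)%N, z%:Z = x%:Z + Q t%:Z &
    [/\ (x < 2 ^ (2 * n))%N, (y < 2 ^ (2 * n))%N & (z < 2 ^ (2 * n))%N] /\
    [/\ d n (x %/ 2 ^ n)%N != 0, d n (y %/ 2 ^ n)%N != 0 & d n (z %/ 2 ^ n)%N != 0]].
Proof.
move=> h.
have [/existsP[x /existsP[t nz]]|] := boolP [exists x : 'I_m, exists t : 'I_T,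
  F n x%:Z * F n (x%:Z + A%:Z + t%:Z) * F n (x%:Z + Q t%:Z) != 0]; last first.
  rewrite negb_exists => /forallP hx; move: h.
  rewrite /trilinear /csum big1 ?ltxx// => x _; rewrite big1// => t _.
  have := hx x; rewrite negb_exists => /forallP/(_ t).
  by rewrite negbK => /eqP.
move: nz; rewrite !mulf_eq0 !negb_or => /andP[/andP[nx ny] nz].
have := hA (ltn_ord t); have := hQ (ltn_ord t).
rewrite ler_norml => /andP[q1 q2] a1.
have xl : (x < 2 ^ (2 * n))%N.
  rewrite ltnNge; apply: contra nx => xl; rewrite stepf_small; last by move: (ltn_ord x); clear; lia.
  by rewrite /step ifF//; apply/negbTE; rewrite -leqNgt.
have [|x' [/eqP + _ dx]] := stepf_neq0 _ nx.
  by move: xl; rewrite hN4; clear; lia.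
rewrite eqz_nat => /eqP ex; rewrite -ex in dx.
have [|y [ey yl dy]] := stepf_neq0 _ ny.
  by move: xl a1; rewrite hN4; clear; lia.
have [|z [ez zl dz]] := stepf_neq0 _ nz.
  by move: xl q1 q2; rewrite hN4; clear; lia.
exists x, t, y, z; split=> //.
by move: ey; clear; lia.
Qed.

End MainTerm.

Lemma start_level i j : ((6 * j).+1 < 128 * i + 6 * j + 2)%N.
Proof. by lia. Qed.

Lemma level_facts j n : ((6 * j).+1 < n)%N ->
  [/\ (j <= 2 * n)%N, (2 * n = 2 + (2 * n).-2)%N & (3 <= 2 * n)%N].
Proof. by split; lia. Qed.

(** The main term at level [k0] exceeds the telescoped error once [E * s ^ k0 < 1/4], so the form at
    level [n] is positive. The lower bound on [t] is a fixed fraction [2 ^ - j] of the grid: it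
    survives the passage to the limit and keeps the final step away from zero. *)
Lemma density_pattern (R : archiRealFieldType) (p0 p1 g s : R) :
  0 < p0 -> p0 <= p1 -> 0 < s -> s < 1 -> s ^+ 128 = 2^-1 -> 1 <= g -> g ^+ 3 * s = 1 ->
  exists j : nat, forall C0 : R, 0 < C0 -> exists k0 : nat,
  forall (n : nat) (d : nat -> nat -> R) (p q : R), (k0 <= n)%N ->
  p0 <= `|p| <= p1 -> `|q| <= 1 -> density_tree n k0 C0 g d ->
  let N : R := 2 ^+ (2 * n) in
  exists x t y z : nat,
    [/\ (2 ^ (2 * n - j) <= t)%N, (j <= 2 * n)%N, y = (x + t)%N,
     z%:Z = x%:Z + Num.floor (p * t%:R ^+ 2 / N + q * t%:R) &
    [/\ (x < 2 ^ (2 * n))%N, (y < 2 ^ (2 * n))%N & (z < 2 ^ (2 * n))%N] /\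
    [/\ d n (x %/ 2 ^ n)%N != 0, d n (y %/ 2 ^ n)%N != 0 & d n (z %/ 2 ^ n)%N != 0]].
Proof.
move=> p00 hp01 s0 s1 s128 g1 gs.
have p10 : 0 <= p1 by apply: le_trans hp01; exact: ltW.
(* Steps are at most [4 T] with [T = N / 2 ^ j]; this [j] makes [4 T] and [16 p1 T + 4 T] at most
   [N / 8], so that no displacement exceeds a quarter of the grid. *)
pose j := Num.bound (8 * (16 * p1 + 4)).
have hj : 8 * (16 * p1 + 4) <= 2 ^+ j.
  apply: (@le_trans _ _ j%:R).
    by apply: ltW; apply: archi_boundP; rewrite mulr_ge0// addr_ge0// mulr_ge0.
  by rewrite -natrX ler_nat ltnW// ltn_expl.
exists j => C0 C00.
have j0 : 0 < 2 ^+ j :> R by rewrite exprn_gt0.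
pose K := 2 * p1 + 1.
have K1 : 1 <= K by rewrite /K; lra.
pose c0 : R := 2 * p0 * (2 ^+ j)^-1.
have c00 : 0 < c0 by rewrite !mulr_gt0// invr_gt0.
have [C C_gt0 hC] := smoothing p1 j p00 K1 c00.
pose L := Num.bound (K + p1 + 1).
have hL : K + p1 + 1 <= L%:R.
  by apply: ltW; apply: archi_boundP; move: p10 K1; clear; lra.
pose E : R := C0 ^+ 3 * g ^+ 3 * (2 * C + 2 * ((2 ^+ j.+1 + 2 * L.+1%:R) +
   2 * C / (1 - s ^+ 4) / s ^+ 2)) / (1 - s).
(* [s ^ (128 i0) = 2 ^ - i0] beats [E]; this explains the [128] in the starting level, while [6 j]
   leaves room for smoothing at level [k %/ 2]. *)
pose i0 := Num.bound (8 * `|E|).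
exists (128 * i0 + 6 * j + 2)%N => n d p q kn hp hq hd N.
set k0 := (128 * i0 + 6 * j + 2)%N in kn hd *.
have jk1 : ((6 * j).+1 < k0)%N by exact: start_level.
have jk0 := ltnW jk1; have jn := leq_trans jk1 kn.
have [j2n n2 n3] := level_facts jn.
pose T := (2 ^ (2 * n - j))%N.
have T0 : (0 < T)%N by rewrite expn_gt0.
have NT : N = T%:R * 2 ^+ j by rewrite /T natrX -exprD subnK.
have N0 : 0 < N by rewrite exprn_gt0.
have N1 : 1 <= N by rewrite exprn_ege1// ler1n.
have TN : T%:R / N = (2 ^+ j)^-1.
  by rewrite NT invfM mulrA divff ?mul1r// pnatr_eq0 -lt0n.
have hpp := andP hp.
have [A /andP[A1 A3] hA] := good_start q p00 hpp.1 N0 T0.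
pose N4 := (2 ^ (2 * n).-2)%N.
have hN4 : (2 ^ (2 * n) = 4 * N4)%N.
  rewrite /N4 -(expnD 2 2); by rewrite -n2.
have eN : N = 4 * N4%:R by rewrite /N -natrX hN4 natrM.
have j5 : (32 * T <= 2 ^ (2 * n))%N.
  rewrite -(ler_nat R) natrM natrX -/N NT mulrC ler_wpM2l//.
  by apply: le_trans hj; move: p10; clear; lra.
have hAt t : (t < T)%N -> (A + t <= N4)%N.
  by move: A3 j5; rewrite hN4; clear; lia.
have T4N : 32 * T%:R <= N by rewrite -(ler_nat R) natrM natrX in j5.
have AtN i : (i <= T)%N -> (A + i)%:R <= N / 8.
  move=> iT; apply: (@le_trans _ _ ((4 * T)%:R)); last by rewrite natrM; move: T4N; clear; lra.
  by rewrite ler_nat; move: iT A3; clear; lia.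
have ATN i : (i <= T)%N -> (A + i)%:R <= 4 * T%:R :> R.
  by move=> iT; rewrite -natrM ler_nat; move: iT A3; clear; lia.
have T0R : 0 < T%:R :> R by rewrite ltr0n.
have hK i : (i <= T)%N -> `|slope p q N A%:Z i%:Z| <= K.
  move=> iT; rewrite /slope -PoszD -pmulrn.
  apply: le_trans (ler_normD _ _) _; apply: lerD => //.
  rewrite !normrM normfV (ger0_norm (ler0n _ 2)) (ger0_norm (ler0n _ _)) (ger0_norm (ltW N0)).
  rewrite ler_pdivrMr// -mulrA -[leRHS]mulrA ler_pM2l//.
  apply: ler_pM => //; first exact: hpp.2.
  by apply: (le_trans (AtN _ iT)); move: N0; clear; lra.
have hc i i' : (i <= T)%N -> (i' <= T)%N ->
     c0 <= `|1 - slope p q N A%:Z i%:Z - slope p q N A%:Z i'%:Z|.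
  by move=> h1 h2; rewrite /c0 -TN; apply: hA.
have QL := quad_step N1 hpp.2 hL hK.
have two_pow : (8 <= 2 ^ (2 * n))%N.
  by rewrite -[8%N]/(2 ^ 3)%N leq_exp2l.
have n8 : 8 <= N by rewrite /N -natrX ler_nat.
have hQ t : (t < T)%N -> `|quad p q N A%:Z t%:Z| <= N4%:Z.
  move=> tT; rewrite /quad -PoszD -pmulrn.
  set y := p * _ / N + _.
  have yb : `|y| <= N / 8.
    apply: le_trans (ler_normD _ _) _.
    have At0 : 0 <= (A + t)%:R :> R by [].
    have h4 := ATN _ (ltnW tT).
    apply: (@le_trans _ _ (p1 * 16 * T%:R + 4 * T%:R)); last first.
      rewrite NT ler_pdivlMr//.
      rewrite (_ : _ * 8 = T%:R * (8 * (16 * p1 + 4))); last by ring.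
      by rewrite ler_pM2l.
    apply: lerD; last first.
      rewrite normrM (ger0_norm At0) -[leRHS]mul1r; apply: ler_pM => //.
    rewrite (normrM (p * _)) (normrM p) normfV (ger0_norm (ltW N0)) normrX (ger0_norm At0).
    rewrite ler_pdivrMr// -!mulrA; apply: ler_pM => //; first exact: hpp.2.
    have -> : 16 * (T%:R * N) = 4 * T%:R * (4 * N) by ring.
    rewrite expr2; apply: ler_pM => //.
    by apply: (le_trans (AtN _ (ltnW tT))); move: N0; clear; lra.
  rewrite -(ler_int R) intr_norm; have [e he ->] := floor_err y.
  apply: le_trans (ler_normB _ _) _.
  have e1 : `|e| <= 1 by rewrite ger0_norm; move: he; clear; lra.
  rewrite -pmulrn; move: yb e1 eN n8; clear; lra.
have m0 : 0 < (period n)%:R * T%:R :> R.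
  by rewrite mulr_gt0// ltr0n expn_gt0.
have k0n : (k0 <= n)%N by [].
have tele := @trilinear_telescope R n k0 j L C0 g s C d A%:Z (quad p q N A%:Z) C00 g1 hd
  s0 s1 s128 gs C_gt0 j2n.
have {}tele := tele (fun k r f0 f1 f2 rk kn' jk => hC n k r p q A%:Z f0 f1 f2 rk kn' jk hp hK hc) QL jk0 k0n.
have main := main_term C00 g1 hd k0n hN4 hAt hQ.
have small : E * s ^+ k0 < 4^-1.
  have i8 : 8 * `|E| < 2 ^+ i0.
    apply: (@lt_le_trans _ _ i0%:R); first by apply: archi_boundP; rewrite mulr_ge0.
    by rewrite -natrX ler_nat ltnW// ltn_expl.
  have sk : s ^+ k0 <= (2 ^+ i0)^-1.
    rewrite -exprVn -s128 -exprM ler_wiXn2l ?ltW//.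
    by rewrite /k0 -addnA leq_addr.
  have p2 : 0 < 2 ^+ i0 :> R by rewrite exprn_gt0.
  apply: (@le_lt_trans _ _ (`|E| * (2 ^+ i0)^-1)).
    apply: (@le_trans _ _ (`|E| * s ^+ k0)).
      by rewrite ler_wpM2r ?ler_norm// exprn_ge0// ltW.
    by rewrite ler_wpM2l.
  rewrite ltr_pdivrMr//; move: i8 (normr_ge0 E) p2; move: `|E| (2 ^+ i0) => e w; clear; lra.
have pos : 0 < trilinear (period n) T A%:Z (quad p q N A%:Z)
    (stepf n d n) (stepf n d n) (stepf n d n).
  have e : C0 ^+ 3 * g ^+ 3 * ((period n)%:R * T%:R) * (2 * C + 2 * ((2 ^+ j.+1 + 2 * L.+1%:R) +
   2 * C / (1 - s ^+ 4) / s ^+ 2)) * (s ^+ k0 / (1 - s)) = (period n)%:R * T%:R * (E * s ^+ k0).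
    by rewrite /E; move: (2 * C + _) => w; move: (1 - s)^-1 => v; ring.
  rewrite e in tele.
  have lt : (period n)%:R * T%:R * (E * s ^+ k0) < (period n)%:R * T%:R / 4.
    by rewrite ltr_pM2l.
  move: tele; rewrite ler_norml => /andP[tele _].
  have aux (x y z w : R) : - y <= z - w -> x <= w -> y < x -> 0 < z by clear; lra.
  exact: aux tele main lt.
have [x [t [y [z [tT yE zE [lts nz]]]]]] :=
  trilinear_pos_pattern hN4 hAt hQ pos.
exists x, (A + t)%N, y, z; split=> //.
- by apply: leq_trans A1 _; rewrite leq_addr.
- by rewrite addnA.
Qed.

(** * Max-flow min-cut on the dyadic tree *)

Section TreeFlow.
Variable R : realFieldType.
Variables (n : nat) (S : pred nat) (theta : R).
Hypothesis theta0 : 0 < theta.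

(** Cost of a minimal cut under the node of level [n - r] and index [j]: either the node itself, or
    optimal cuts under both children. Leaves outside [S] need no cut. *)
Fixpoint cut_value (r j : nat) : R :=
  if r is r'.+1
  then Num.min (theta ^+ (n - r)) (cut_value r' (2 * j) + cut_value r' (2 * j).+1)
  else if S j then theta ^+ n else 0.

Lemma cut_value_ge0 r j : 0 <= cut_value r j.
Proof.
elim: r j => [|r IH] j /=; first by case: ifP => // _; rewrite exprn_ge0 ?ltW.
by rewrite le_min exprn_ge0 ?addr_ge0// ltW.
Qed.

Lemma cut_value_le r j : cut_value r j <= theta ^+ (n - r).
Proof.
case: r => [|r] /=; last by rewrite ge_min lexx.
by rewrite subn0; case: (S j); rewrite ?lexx ?exprn_ge0// ltW.
Qed.

Definition node_above (q : nat * nat) (i : nat) : bool :=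
  (q.1 <= n)%N && (i %/ 2 ^ (n - q.1) == q.2)%N.

Lemma cut_exists r j : (r <= n)%N -> exists Q : seq (nat * nat),
  \sum_(q <- Q) theta ^+ q.1 = cut_value r j /\
  forall i, (i %/ 2 ^ r = j)%N -> S i -> has (node_above^~ i) Q.
Proof.
elim: r j => [|r IH] j rn /=.
  case: ifP => Sj.
    exists [:: (n, j)]; rewrite big_seq1; split=> // i ij Si /=.
    by rewrite orbF /node_above leqnn /= subnn ij eqxx.
  exists [::]; rewrite big_nil; split=> // i.
  by rewrite expn0 divn1 => -> ; rewrite Sj.
have [Q1 [s1 h1]] := IH (2 * j)%N (ltnW rn).
have [Q2 [s2 h2]] := IH (2 * j).+1 (ltnW rn).
have [le|_] := leP.
  exists [:: ((n - r.+1)%N, j)]; rewrite big_seq1; split=> // i ij Si /=.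
  by rewrite orbF /node_above leq_subr /= subKn// ij.
exists (Q1 ++ Q2); rewrite big_cat /= s1 s2; split=> // i ij Si.
rewrite has_cat; apply/orP.
have e : (i %/ 2 ^ r = 2 * j \/ i %/ 2 ^ r = (2 * j).+1)%N.
  by move: ij; rewrite expnSr divnMA; lia.
by case: e => e; [left; apply: h1|right; apply: h2].
Qed.

(** A maximal flow: the mass of a node is shared between its children in proportion to their cut
    values. If both vanish, division by zero returns the correct value [0]. *)
Fixpoint mass (l j : nat) : R :=
  if l is l'.+1 then
    mass l' (j %/ 2) * cut_value (n - l) j /
      (cut_value (n - l) (2 * (j %/ 2)) + cut_value (n - l) (2 * (j %/ 2)).+1)
  else cut_value n 0.

(** The mass of the parent is at most its cut value, hence at most the sum of those of its children;
    so the share of a child is at most its own cut value. *)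
Lemma mass_bounds l j : (l <= n)%N -> 0 <= mass l j /\ ((j < 2 ^ l)%N -> mass l j <= cut_value (n - l) j).
Proof.
elim: l j => [|l IH] j ln /=.
  split; first exact: cut_value_ge0.
  by rewrite expn0 ltnS leqn0 => /eqP ->; rewrite subn0.
have [IH0 IH1] := IH (j %/ 2)%N (ltnW ln).
have V1 := cut_value_ge0 (n - l.+1) (2 * (j %/ 2)).
have V2 := cut_value_ge0 (n - l.+1) (2 * (j %/ 2)).+1.
have V3 := cut_value_ge0 (n - l.+1) j.
set D := _ + _; have D0 : 0 <= D by rewrite addr_ge0.
split; first by rewrite divr_ge0// mulr_ge0.
move=> jl; have {}IH1 : mass l (j %/ 2) <= D.
  apply: le_trans (IH1 _) _; first by rewrite ltn_divLR// -expnSr.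
  have -> : (n - l = (n - l.+1).+1)%N by lia.
  by rewrite /= ge_min /D lexx orbT.
move: D0; rewrite le_eqVlt => /orP[/eqP <-|D0]; first by rewrite invr0 mulr0.
by rewrite ler_pdivrMr// mulrC ler_wpM2l.
Qed.

Lemma mass_split l j : (l < n)%N -> (j < 2 ^ l)%N ->
  mass l j = mass l.+1 (2 * j) + mass l.+1 (2 * j).+1.
Proof.
move=> ln jl /=.
have -> : (2 * j %/ 2 = j)%N by rewrite mulKn.
have -> : ((2 * j).+1 %/ 2 = j)%N by lia.
have V1 := cut_value_ge0 (n - l.+1) (2 * j).
have V2 := cut_value_ge0 (n - l.+1) (2 * j).+1.
have [m0 m1] := mass_bounds j (ltnW ln).
have mD : mass l j <= cut_value (n - l.+1) (2 * j) + cut_value (n - l.+1) (2 * j).+1.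
  apply: le_trans (m1 jl) _.
  have -> : (n - l = (n - l.+1).+1)%N by lia.
  by rewrite /= ge_min lexx orbT.
set D := _ + _ in mD *; rewrite -mulrDl -mulrDr -/D.
have [D0|D0] := eqVneq D 0; last by rewrite mulfK.
by rewrite D0 mulr0 mul0r; apply/eqP; rewrite eq_le m0 -D0 mD.
Qed.

(** The minimal cut is itself one of the finite covers that cost at least [c], so the flow can be
    divided by its total value [cut_value n 0], which is at least [c]. *)
Lemma tree_flow (c : R) : 0 < c ->
  (forall Q : seq (nat * nat),
     (forall i, (i < 2 ^ n)%N -> S i -> has (node_above^~ i) Q) ->
     c <= \sum_(q <- Q) theta ^+ q.1) ->
  exists w : nat -> nat -> R, [/\ w 0%N 0%N = 1,
    forall l j, (l < n)%N -> (j < 2 ^ l)%N -> w l j = w l.+1 (2 * j)%N + w l.+1 (2 * j).+1,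
    forall l j, (l <= n)%N -> (j < 2 ^ l)%N -> 0 <= w l j <= theta ^+ l / c &
    forall j, (j < 2 ^ n)%N -> w n j != 0 -> S j].
Proof.
move=> c0 hc.
have [Q [sQ hQ]] := cut_exists 0 (leqnn n).
have cv : c <= cut_value n 0.
  by rewrite -sQ; apply: hc => i il; apply: hQ; rewrite divn_small.
have v0 : 0 < cut_value n 0 by apply: lt_le_trans cv.
exists (fun l j => mass l j / cut_value n 0); split.
- by rewrite /= divff// gt_eqF.
- by move=> l j ln jl; rewrite mass_split// mulrDl.
- move=> l j ln jl; have [m0 /(_ jl) m1] := mass_bounds j ln.
  rewrite divr_ge0 ?(ltW v0)//=; apply: ler_pM => //; first by rewrite invr_ge0 ltW.
    by apply: le_trans m1 _; rewrite -{2}(subKn ln) cut_value_le.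
  by rewrite lef_pV2.
- move=> j jl; apply: contraNT => Sj; have [m0 /(_ jl)] := mass_bounds j (leqnn n).
  rewrite subnn /= (negbTE Sj) => m1.
  by have -> : mass n j = 0 by [apply/eqP; rewrite eq_le m0 m1]; rewrite mul0r.
Qed.

End TreeFlow.

(** * A Hilbertian capacity *)

Section Capacity.
Variable R : realType.
Variable theta : R.
Hypothesis theta0 : 0 < theta.
Implicit Types (f g : nat -> nat -> R) (A : set R) (x : R).

Definition cell (k : nat) x : nat := `|Num.floor (2 ^+ k * x)|%N.

Definition energy f (N : nat) : R :=
  \sum_(k < N) \sum_(j < 2 ^ k) f k j ^+ 2 * theta ^+ k.

Definition cost_le f (s : R) := forall N, energy f N <= s.

(** The sum along the branch of a point has to reach one at a finite level, so that no infinite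
    series enters; points of [[0, 1[] have exactly one branch. *)
Definition admissible f A :=
  (forall k j, 0 <= f k j) /\
  (forall x, A x -> 0 <= x < 1 -> exists N : nat, 1 <= \sum_(k < N) f k (cell k x)).

Definition capacity_ge A (c : R) :=
  forall f s, admissible f A -> cost_le f s -> c <= s.

Lemma energy_ge0 f N : 0 <= energy f N.
Proof.
apply: sumr_ge0 => k _; apply: sumr_ge0 => j _.
by rewrite mulr_ge0 ?sqr_ge0// exprn_ge0// ltW.
Qed.

Lemma energy_mono f N N' : (N <= N')%N -> energy f N <= energy f N'.
Proof.
move=> NN; rewrite -(subnKC NN) /energy big_split_ord /= lerDl.
apply: sumr_ge0 => k _; apply: sumr_ge0 => j _.
by rewrite mulr_ge0 ?sqr_ge0// exprn_ge0// ltW.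
Qed.

Lemma energy_le_comb f (I : Type) (r : seq I) (a : I -> R) (g : I -> nat -> nat -> R) N :
  (forall k j, f k j ^+ 2 <= \sum_(i <- r) a i * g i k j ^+ 2) ->
  energy f N <= \sum_(i <- r) a i * energy (g i) N.
Proof.
move=> h; rewrite /energy.
rewrite [leRHS](eq_bigr (fun i => \sum_(k < N) \sum_(j < 2 ^ k)
   a i * (g i k j ^+ 2 * theta ^+ k))); last first.
  by move=> i _; rewrite mulr_sumr; apply: eq_bigr => k _; rewrite mulr_sumr.
rewrite [leRHS]exchange_big; apply: ler_sum => k _.
rewrite [leRHS]exchange_big; apply: ler_sum => j _.
rewrite (eq_bigr (fun i => a i * g i k j ^+ 2 * theta ^+ k)); last by move=> i _; rewrite mulrA.
by rewrite -mulr_suml ler_wpM2r// exprn_ge0// ltW.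
Qed.

Lemma energy_parallelogram f g N :
  energy (fun k j => f k j - g k j) N + 4 * energy (fun k j => (f k j + g k j) / 2) N
  = 2 * energy f N + 2 * energy g N.
Proof.
rewrite /energy !mulr_sumr -!big_split; apply: eq_bigr => k _ /=.
by rewrite !mulr_sumr -!big_split; apply: eq_bigr => j _ /=; field.
Qed.

Lemma cell_lt k x : 0 <= x < 1 -> (cell k x < 2 ^ k)%N.
Proof.
move=> /andP[x0 x1]; rewrite /cell -ltz_nat gez0_abs; last first.
  by rewrite floor_ge0 mulr_ge0// exprn_ge0.
rewrite floor_lt_int -pmulrn natrX -[ltRHS]mulr1 ltr_pM2l// exprn_gt0//.
Qed.

(** Iterates [(a + b) ^ 2 <= 2 a ^ 2 + 2 b ^ 2]; the weights [2 ^ i] are harmless against energies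
    that decay like [4 ^ - i]. *)
Lemma weighted_sqr_sum (d : nat -> R) (I : nat) :
  (\sum_(i < I) d i) ^+ 2 <= 2 * \sum_(i < I) 2 ^+ i * d i ^+ 2.
Proof.
elim: I d => [|I IH] d; first by rewrite !big_ord0 expr0n mulr0.
rewrite !big_ord_recl /= expr0 mul1r.
have := IH (fun i => d i.+1); set S := \sum_(i < I) d i.+1 => h.
have h2 : (d 0%N + S) ^+ 2 <= 2 * d 0%N ^+ 2 + 2 * S ^+ 2.
  by have := sqr_ge0 (d 0%N - S); rewrite sqrrB sqrrD; lra.
apply: (le_trans h2); rewrite mulrDr lerD2l ler_pM2l//.
apply: (le_trans h); rewrite mulr_sumr le_eqVlt; apply/orP; left; apply/eqP.
by apply: eq_bigr => i _; rewrite /bump leq0n add1n (exprS 2 i) mulrA.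
Qed.

Lemma energy_limit (h : nat -> nat -> nat -> R) (H : nat -> nat -> R) N (s : R) :
  (forall k j, h I k j @[I --> \oo] --> H k j) ->
  (forall I, energy (h I) N <= s) -> energy H N <= s.
Proof.
move=> hc hs; have cv : energy (h I) N @[I --> \oo] --> energy H N.
  apply: (@cvg_big _ _ +%R 0) => [|k _]; first exact: add_continuous.
  apply: (@cvg_big _ _ +%R 0) => [|j _]; first exact: add_continuous.
  by apply: cvgMr_tmp; rewrite expr2; apply: cvgM.
by apply: (cvgr_to_le cv); near=> I; exact: hs.
Unshelve. all: by end_near.
Qed.


Definition costs A : set R := [set s | exists2 f, admissible f A & cost_le f s].

Lemma costs_lbound A : has_lbound (costs A).
Proof.
exists 0 => s [f _ hf]; apply: le_trans (hf 0%N).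
exact: energy_ge0.
Qed.

Lemma admissible_sub f A A' : A `<=` A' -> admissible f A' -> admissible f A.
Proof. by move=> AA [f0 h]; split=> // x /AA; exact: h. Qed.

Lemma admissible_mean f g A : admissible f A -> admissible g A ->
  admissible (fun k j => (f k j + g k j) / 2) A.
Proof.
move=> [f0 hf] [g0 hg]; split=> [k j|x Ax x01]; first by rewrite divr_ge0// addr_ge0.
have [N1 h1] := hf x Ax x01; have [N2 h2] := hg x Ax x01.
exists (maxn N1 N2).
have mono (u : nat -> nat -> R) N N' : (forall k j, 0 <= u k j) -> (N <= N')%N ->
    \sum_(k < N) u k (cell k x) <= \sum_(k < N') u k (cell k x).
  by move=> u0 NN; rewrite -(subnKC NN) big_split_ord /= lerDl; apply: sumr_ge0.
have m1 := le_trans h1 (mono _ _ _ f0 (leq_maxl N1 N2)).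
have m2 := le_trans h2 (mono _ _ _ g0 (leq_maxr N1 N2)).
rewrite -mulr_suml big_split /= ler_pdivlMr// mul1r.
by rewrite -[2]/(1 + 1) lerD.
Qed.

(* by the parallelogram identity, as in the projection theorem *)
Lemma near_minimisers f g A A' (v e : R) : A `<=` A' ->
  admissible f A -> admissible g A' -> cost_le f (v + e) -> cost_le g (v + e) ->
  capacity_ge A (v - e) ->
  cost_le (fun k j => g k j - f k j) (8 * e).
Proof.
move=> AA af ag cf cg cap N.
have := cap _ ((4 * (v + e) - energy (fun k j => g k j - f k j) N) / 4)
  (admissible_mean (admissible_sub AA ag) af).
rewrite ler_pdivlMr// => h; have {h} : (v - e) * 4 <= 4 * (v + e) - energy (fun k j => g k j - f k j) N.
  apply: h => N'.
  rewrite ler_pdivlMr//.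
  have [NN|NN] := leqP N N'.
    have := energy_parallelogram g f N'; have := cf N'; have := cg N'.
    have := energy_mono (fun k j => g k j - f k j) NN.
    by lra.
  have := energy_parallelogram g f N; have := cf N; have := cg N.
  have := energy_mono (fun k j => (g k j + f k j) / 2) (ltnW NN).
  by lra.
by lra.
Qed.

(** If all capacities stayed below [c'], near-minimisers [f i] along a fast subsequence would have
    summable increments in energy norm. Adding to [f 0] the sum [H] of the absolute increments gives
    a weight that dominates every [f i]; it is admissible for the union and its energy is at most
    [c' + (c - c') / 2], a contradiction. *)
Lemma capacity_increasing (A : nat -> set R) (c c' : R) :
  (forall n, A n `<=` A n.+1) -> capacity_ge (\bigcup_n A n) c -> c' < c ->
  exists n, capacity_ge (A n) c'.
Proof.
move=> Ainc capU cc; apply: contrapT => /forallNP hn.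
have Amono n n' : (n <= n')%N -> A n `<=` A n'.
  move=> nn; rewrite -(subnKC nn); elim: (n' - n)%N => [|k IH]; first by rewrite addn0.
  by rewrite addnS; apply: subset_trans IH (Ainc _).
have low n : exists f s, [/\ admissible f (A n), cost_le f s & s < c'].
  have := hn n; rewrite /capacity_ge => /existsNP[f /existsNP[s]].
  by move=> /not_implyP[af /not_implyP[cf /negP]]; rewrite -ltNge => sc; exists f, s.
pose v n := inf (costs (A n)).
have nz n : costs (A n) !=set0 by have [f [s [af cf _]]] := low n; exists s, f.
have vcap n : capacity_ge (A n) (v n).
  by move=> f s af cf; apply: ge_inf (costs_lbound _) _ _; exists f.
have vc n : v n <= c'.
  by have [f [s [af cf sc]]] := low n; apply: le_trans (vcap n f s af cf) (ltW sc).
have v0 n : 0 <= v n.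
  by apply: lb_le_inf (nz n) _ => s [f _ hf]; apply: le_trans (hf 0%N); exact: energy_ge0.
have vmono n n' : (n <= n')%N -> v n <= v n'.
  move=> nn; apply: lb_le_inf (nz n') _ => s [f af cf].
  by apply: vcap cf; exact: admissible_sub (Amono _ _ nn) af.
have hub : has_ubound (range v) by exists c' => _ [n _ <-].
pose V := sup (range v).
have vV n : v n <= V by apply: ub_le_sup => //; exists n.
have Vc : V <= c' by apply: ge_sup => [|_ [n _ <-]] //; exists (v 0%N), 0%N.
have V0 : 0 <= V by apply: le_trans (vV 0%N).
pose del := c - c'.
have del0 : 0 < del by rewrite subr_gt0.
(* The inequality [(x + y) ^ 2 <= (1 + eta) x ^ 2 + (1 + 1 / eta) y ^ 2] will be applied to
   [f 0 + H]; [eta], and then [eps], make each of the two losses at most [del / 4]. *)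
pose eta := del / (4 * (V + 1)).
have eta0 : 0 < eta by rewrite divr_gt0// mulr_gt0//; lra.
have etaV : (1 + eta) * V <= V + del / 4.
  rewrite mulrDl mul1r lerD2l /eta -mulrA ler_pM2l// ler_pdivrMl ?mulr_gt0//; lra.
pose B := (1 + eta) + (1 + eta^-1) * 32.
have B0 : 0 < B.
  apply: addr_gt0; first by lra.
  by apply: mulr_gt0 => //; apply: addr_gt0 => //; rewrite invr_gt0.
pose eps := del / 4 / B.
have eps0 : 0 < eps by rewrite !divr_gt0.
pose e i : R := eps / 4 ^+ i.
have e0 i : 0 < e i by rewrite divr_gt0// exprn_gt0.
have exM i : exists M, forall m, (M <= m)%N -> V - e i <= v m.
  have hs : has_sup (range v) by split=> //; exists (v 0%N), 0%N.
  have [_ [M _ <-] hM] := sup_adherent (e0 i) hs.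
  by exists M => m Mm; apply: le_trans (ltW hM) (vmono _ _ Mm).
have [M hM] := choice exM.
(* Nondecreasing, late enough for the tolerance [e i], and at least [i], so that the sets [A (m i)]
   exhaust the union. *)
pose m i := (\sum_(k < i.+1) (M k + k))%N.
have Mm i : (M i <= m i)%N by rewrite /m big_ord_recr /=; lia.
have im i : (i <= m i)%N by rewrite /m big_ord_recr /=; lia.
have mm i : (m i <= m i.+1)%N by rewrite [m i.+1]/m big_ord_recr /= -/(m i) leq_addr.
have exf i : exists f, admissible f (A (m i)) /\ cost_le f (V + e i).
  have [s [f af cf] hs] := inf_adherent (e0 i) (conj (nz (m i)) (costs_lbound (A (m i)))).
  exists f; split=> // N; apply: le_trans (cf N) _.
  by apply: le_trans (ltW hs) _; rewrite lerD2r; exact: vV.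
have [f /all_and2[af cf]] := choice exf.
have e_dec i : e i.+1 <= e i.
  by rewrite /e ler_pM2l// lef_pV2 ?posrE ?exprn_gt0// exprS ler_peMl ?exprn_ge0// ler1n.
have diff i : cost_le (fun k j => f i.+1 k j - f i k j) (8 * e i).
  apply: (near_minimisers (A := A (m i)) (A' := A (m i.+1)) (v := V)) => //.
  - exact: Amono.
  - by move=> N; apply: le_trans (cf i.+1 N) _; rewrite lerD2l.
  - move=> g s ag cg; apply: le_trans (vcap _ g s ag cg); exact: hM.
(* The energy does not see the indices [j >= 2 ^ k]; the value zero there keeps [h] bounded in [I],
   so that its supremum is a limit. *)
pose h I k j := if (j < 2 ^ k)%N then \sum_(i < I) `|f i.+1 k j - f i k j| else 0.
have hmono k j : {homo (fun I => h I k j) : I I' / (I <= I')%N >-> I <= I'}.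
  move=> I I' II /=; rewrite /h; case: ifP => // _.
  rewrite -(subnKC II) big_split_ord /= lerDl.
  by apply: sumr_ge0.
have hE I N : energy (h I) N <= 32 * eps.
  pose a (i : nat) : R := 2 * 2 ^+ i.
  have := @energy_le_comb (h I) 'I_I (index_enum _) (fun i => a i)
    (fun i k j => f i.+1 k j - f i k j) N.
  move=> hh; apply: le_trans (hh _) _ => {hh}.
    move=> k j; rewrite {1}/h; case: ifP => _; last first.
      by rewrite expr0n; apply: sumr_ge0 => i _; rewrite mulr_ge0 ?sqr_ge0 ?mulr_ge0 ?exprn_ge0.
    apply: le_trans (weighted_sqr_sum (fun i => `|f i.+1 k j - f i k j|) I) _.
    rewrite mulr_sumr; apply: ler_sum => i _.
    by rewrite /a mulrA real_normK ?num_real.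
  apply: (@le_trans _ _ (\sum_(i < I) 16 * eps / 2 ^+ i)).
    apply: ler_sum => i _; apply: (@le_trans _ _ (a i * (8 * e i))).
      by rewrite ler_wpM2l ?mulr_ge0 ?exprn_ge0//; exact: diff.
    rewrite /a /e -[4]/((2 * 2)%:R) natrM exprMn le_eqVlt; apply/orP; left; apply/eqP.
    by field; rewrite expf_neq0.
  have : \sum_(i < I) 16 * eps / 2 ^+ i = 32 * eps * (1 - (2 ^+ I)^-1).
    elim: I => [|I IH]; first by rewrite big_ord0 expr0 invr1 subrr mulr0.
    by rewrite big_ord_recr /= IH exprS; field; rewrite expf_neq0.
  move=> ->; apply: ler_piMr; first by apply: mulr_ge0 => //; exact: ltW.
  by rewrite lerBlDr lerDl invr_ge0 exprn_ge0.
pose H k j := sup (range (fun I => h I k j)).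
have hb k j : has_ubound (range (fun I => h I k j)).
  have [jk|jk] := ltnP j (2 ^ k); last first.
    by exists 0 => _ [I _ <-]; rewrite /h ltnNge jk.
  exists (32 * eps / theta ^+ k + 1) => _ [I _ <-] /=.
  have h2 : h I k j ^+ 2 * theta ^+ k <= 32 * eps.
    apply: le_trans (hE I k.+1); rewrite /energy big_ord_recr /=.
    rewrite (bigD1 (Ordinal jk)) //= addrCA lerDl addr_ge0//.
      by apply: (energy_ge0 (h I) k).
    by apply: sumr_ge0 => i _; rewrite mulr_ge0 ?sqr_ge0// exprn_ge0// ltW.
  rewrite -ler_pdivlMr ?exprn_gt0// in h2.
  apply: (@le_trans _ _ (h I k j ^+ 2 + 1)); last by rewrite lerD2r.
  by have := sqr_ge0 (h I k j - 2^-1); rewrite sqrrB; lra.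
have hH k j : h I k j @[I --> \oo] --> H k j by apply: nondecreasing_cvgn.
have hleH I k j : h I k j <= H k j by apply: ub_le_sup => //; exists I.
have h0 I k j : 0 <= h I k j by rewrite /h; case: ifP => // _; apply: sumr_ge0.
have HE N : energy H N <= 32 * eps by apply: energy_limit hH _ => I; exact: hE.
pose g k j := f 0%N k j + H k j.
have fg i k j : (j < 2 ^ k)%N -> f i k j <= g k j.
  move=> jk; apply: le_trans (_ : f 0%N k j + h i k j <= _); last by rewrite lerD2l.
  rewrite /h jk; elim: i => [|i IH]; first by rewrite big_ord0 addr0.
  rewrite big_ord_recr /= addrA.
  apply: (@le_trans _ _ (f i k j + `|f i.+1 k j - f i k j|)); last by rewrite lerD2r.
  by rewrite -lerBlDl ler_norm.
have ag : admissible g (\bigcup_n A n).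
  split=> [k j|x [n _ Anx] x01].
    by apply: addr_ge0; [exact: (af 0%N).1|apply: le_trans (h0 0%N k j) (hleH _ _ _)].
  have [N hN] := (af n).2 x (Amono _ _ (im n) _ Anx) x01.
  exists N; apply: (le_trans hN); apply: ler_sum => k _; apply: fg.
  exact: cell_lt.
have cg : cost_le g (c' + del / 2).
  move=> N; have := @energy_le_comb g bool [:: true; false]
    (fun b => if b then 1 + eta else 1 + eta^-1)
    (fun b => if b then f 0%N else H) N.
  rewrite !big_cons !big_nil /= addr0 => hh; apply: le_trans (hh _) _ => {hh}.
    move=> k j; rewrite !big_cons !big_nil /= addr0 /g.
    have := sqr_ge0 (eta * f 0%N k j - H k j) => sq.
    have : 0 <= eta^-1 * (eta * f 0%N k j - H k j) ^+ 2 by rewrite mulr_ge0// invr_ge0 ltW.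
    have -> : eta^-1 * (eta * f 0%N k j - H k j) ^+ 2 =
      eta * f 0%N k j ^+ 2 - 2 * f 0%N k j * H k j + eta^-1 * H k j ^+ 2.
      by field; rewrite gt_eqF.
    by rewrite sqrrD; lra.
  have e1 : (1 + eta) * energy (f 0%N) N <= (1 + eta) * (V + eps).
    rewrite ler_pM2l; last by lra.
    by apply: le_trans (cf 0%N N) _; rewrite /e expr0 divr1.
  have e2 : (1 + eta^-1) * energy H N <= (1 + eta^-1) * (32 * eps).
    by rewrite ler_wpM2l// addr_ge0// invr_ge0 ltW.
  apply: le_trans (lerD e1 e2) _.
  have -> : (1 + eta) * (V + eps) + (1 + eta^-1) * (32 * eps) = (1 + eta) * V + B * eps.
    by rewrite /B; ring.
  have -> : B * eps = del / 4 by rewrite /eps mulrC divfK// gt_eqF.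
  by move: etaV Vc; lra.
have := capU _ _ ag cg; rewrite /del; lra.
Qed.

End Capacity.

(** * Capacitability of Souslin sets *)

Section Frostman.
Variable R : realType.
Implicit Types (x : R) (A : set R).

(** Lower bound for the dyadic content in which a cell of level [k] costs [theta ^ k]; [Q] selects
    the covering cells, and bounded partial sums stand for the series. *)
Definition content_ge (theta : R) A (c : R) :=
  forall (Q : nat -> nat -> bool) (s : R),
  (forall x, A x -> 0 <= x < 1 -> exists k, Q k (cell k x)) ->
  (forall N, \sum_(k < N) \sum_(j < 2 ^ k) (Q k j)%:R * theta ^+ k <= s) -> c <= s.

(** A Chebyshev argument. The cells with [f k j >= (1 - rho) * rho ^ k] cover [A], because these
    thresholds sum to less than one along a branch; and above the threshold, [(theta * rho ^ 2) ^ k]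
    is at most [f k j ^ 2 * theta ^ k / (1 - rho) ^ 2]. The factor [rho ^ 2] is the loss in the
    exponent. *)
Lemma content_capacity (theta rho : R) A c : 0 < theta -> 0 < rho < 1 ->
  content_ge (theta * rho ^+ 2) A c -> capacity_ge theta A ((1 - rho) ^+ 2 * c).
Proof.
move=> t0 /andP[r0 r1] hc f s [f0 fA] cf.
have r10 : 0 < 1 - rho by rewrite subr_gt0.
rewrite mulrC -ler_pdivlMr ?exprn_gt0//.
apply: (hc (fun k j => (1 - rho) * rho ^+ k <= f k j)).
  move=> x Ax x01; have [N hN] := fA x Ax x01.
  apply: contrapT => /forallNP hk; move: hN; apply/negP; rewrite -ltNge.
  apply: (@le_lt_trans _ _ (\sum_(k < N) (1 - rho) * rho ^+ k)).
    by apply: ler_sum => k _; rewrite ltW// ltNge; exact/negP/hk.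
  have -> : \sum_(k < N) (1 - rho) * rho ^+ k = 1 - rho ^+ N.
    elim: N => [|N IH]; first by rewrite big_ord0 expr0 subrr.
    by rewrite big_ord_recr /= IH exprS; ring.
  by rewrite ltrBlDr ltrDl exprn_gt0.
move=> N; rewrite ler_pdivlMr ?exprn_gt0//; apply: le_trans (cf N).
rewrite /energy mulr_suml; apply: ler_sum => k _; rewrite mulr_suml.
apply: ler_sum => j _; case: (leP ((1 - rho) * rho ^+ k) (f k j)) => [h|_]; last first.
  by rewrite mulr0n !mul0r mulr_ge0 ?sqr_ge0// exprn_ge0// ltW.
rewrite mulr1n mul1r exprMn.
have -> : theta ^+ k * (rho ^+ 2) ^+ k * (1 - rho) ^+ 2 =
   ((1 - rho) * rho ^+ k) ^+ 2 * theta ^+ k.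
  by rewrite -exprM mulnC exprM; ring.
rewrite ler_wpM2r ?exprn_ge0 ?(ltW t0)//.
have q0 : 0 <= (1 - rho) * rho ^+ k by rewrite mulr_ge0 ?exprn_ge0// ltW.
by rewrite lerXn2r// nnegrE.
Qed.

Lemma cell_itv k x : 0 <= x -> (cell k x)%:R <= 2 ^+ k * x < (cell k x).+1%:R.
Proof.
move=> x0; have f0 : 0 <= Num.floor (2 ^+ k * x) by rewrite floor_ge0 mulr_ge0// exprn_ge0.
have := floor_itv (2 ^+ k * x); rewrite -(gez0_abs f0) -/(cell k x).
by rewrite intrD -!pmulrn natr1.
Qed.

Lemma cell_unique k x (a : nat) : a%:R <= 2 ^+ k * x < a.+1%:R -> cell k x = a.
Proof.
move=> h; rewrite /cell (@floor_def _ _ a%:Z)//.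
by rewrite intrD -!pmulrn natr1.
Qed.

Lemma cell_div k n x : 0 <= x -> (k <= n)%N -> (cell n x %/ 2 ^ (n - k))%N = cell k x.
Proof.
move=> x0 kn; apply/esym/cell_unique.
have /andP[h1 h2] := cell_itv n x0.
have e : 2 ^+ n * x = 2 ^+ (n - k) * (2 ^+ k * x) by rewrite mulrA -exprD subnK.
have p0 : 0 < 2 ^+ (n - k) :> R by rewrite exprn_gt0.
rewrite e in h1 h2.
have eP : 2 ^+ (n - k) = (2 ^ (n - k))%N%:R :> R by rewrite natrX.
rewrite -(ler_pM2l p0) -(ltr_pM2l p0); apply/andP; split.
  apply: le_trans h1; rewrite eP -natrM ler_nat mulnC; exact: leq_trunc_div.
apply: lt_le_trans h2 _; rewrite eP -natrM ler_nat mulnC.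
by apply: ltn_ceil; rewrite expn_gt0.
Qed.

(** A weight with values [0] and [1] equals its square, so the capacity also bounds the cost of
    finite covers from below; repeated nodes only increase the right-hand side. *)
Lemma energy_indicator (theta : R) (Q : seq (nat * nat)) N : 0 < theta ->
  energy theta (fun k j => ((k, j) \in Q)%:R) N <= \sum_(q <- Q) theta ^+ q.1.
Proof.
move=> t0; have tk k : 0 <= theta ^+ k by rewrite exprn_ge0// ltW.
apply: (@le_trans _ _ (\sum_(k < N) \sum_(j < 2 ^ k) \sum_(q <- Q)
   (q == (k : nat, j : nat))%:R * theta ^+ k)).
  apply: ler_sum => k _; apply: ler_sum => j _.
  rewrite -mulr_suml ler_wpM2r//; case: (boolP (_ \in Q)) => h; last first.
    by rewrite expr0n; apply: sumr_ge0.
  by rewrite expr1n (big_rem _ h) /= eqxx lerDl; apply: sumr_ge0.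
under eq_bigr do rewrite exchange_big.
rewrite exchange_big; apply: ler_sum => -[l i] _ /=.
have [lN|lN] := ltnP l N; last first.
  rewrite big1// => k _; rewrite big1// => j _.
  by rewrite xpair_eqE gtn_eqF ?mul0r//; apply: leq_trans lN; exact: ltn_ord.
rewrite (bigD1 (Ordinal lN)) //= [X in _ + X]big1 ?addr0; last first.
  move=> k kl; rewrite big1// => j _; rewrite xpair_eqE.
  case: eqP => [e|]; last by rewrite mul0r.
  by case/eqP: kl; apply: val_inj.
have [il|il] := ltnP i (2 ^ l); last first.
  rewrite big1// => j _; rewrite xpair_eqE (gtn_eqF (leq_trans (ltn_ord j) il)).
  by rewrite andbF mul0r.
rewrite (bigD1 (Ordinal il)) //= [X in _ + X]big1 ?addr0; last first.
  move=> j ji; rewrite xpair_eqE; case: eqP => // _; case: eqP => [e|]; last by rewrite mul0r.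
  by case/eqP: ji; apply: val_inj.
by rewrite eqxx mul1r.
Qed.

Definition souslin (C : seq nat -> set R) : set R :=
  [set x | exists sigma : nat -> nat, forall k, C (mkseq sigma k) x].

Section Scheme.
Variable C : seq nat -> set R.

(** The points reached by branches whose first terms are bounded by those of [b]. The set increases
    with a newly appended bound, and the union over that bound gives back the previous set. *)
Definition bounded_branches (b : seq nat) : set R :=
  [set x | exists sigma : nat -> nat,
     (forall i, (i < size b)%N -> (sigma i <= nth 0 b i)%N) /\
     forall k, C (mkseq sigma k) x].

Lemma capacity_bound_step (theta : R) b c c' : 0 < theta ->
  capacity_ge theta (bounded_branches b) c ->
  c' < c -> exists n, capacity_ge theta (bounded_branches (rcons b n)) c'.
Proof.
move=> t0 hc cc; apply: (capacity_increasing t0 _ _ cc).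
  move=> n x [sigma [hb hx]]; exists sigma; split=> // i.
  rewrite size_rcons => ib; have := hb i; rewrite size_rcons => /(_ ib) h.
  apply: leq_trans h _.
  by rewrite !nth_rcons; case: ifP => // _; case: ifP.
move=> f s [f0 fA] cf; apply: hc cf; split=> // x [sigma [hb hx]] x01.
apply: fA => //; exists (sigma (size b)) => //; exists sigma; split=> // i.
rewrite size_rcons ltnS leq_eqVlt => /orP[/eqP ->|ib]; first by rewrite nth_rcons ltnn eqxx.
by rewrite nth_rcons ib; exact: hb.
Qed.

Lemma capacity_bounds (theta : R) c c' : 0 < theta ->
  capacity_ge theta (souslin C) c -> c' < c ->
  exists b : nat -> nat, forall k, capacity_ge theta (bounded_branches (mkseq b k)) c'.
Proof.
(* A strictly decreasing sequence from [c] towards [c'], so that each new bound has some capacity to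
   lose. *)
move=> t0 hc cc; pose ck (k : nat) := c' + (c - c') / k.+1%:R.
have d0 : 0 < c - c' by rewrite subr_gt0.
have ckd k : ck k.+1 < ck k.
  by rewrite ltrD2l ltr_pM2l// ltf_pV2 ?posrE// ltr_nat.
have ex (sk : seq nat * nat) : exists n, capacity_ge theta (bounded_branches sk.1) (ck sk.2) ->
    capacity_ge theta (bounded_branches (rcons sk.1 n)) (ck sk.2.+1).
  have [h|h] := pselect (capacity_ge theta (bounded_branches sk.1) (ck sk.2)).
    by have [n hn] := capacity_bound_step t0 h (ckd _); exists n.
  by exists 0%N.
have [F hF] := choice ex.
pose S := fix S k := if k is k'.+1 then rcons (S k') (F (S k', k')) else [::].
pose b i := F (S i, i).
have Sb k : S k = mkseq b k.
  by elim: k => // k IH; rewrite /= {1}IH [RHS]/mkseq -addn1 iotaD map_cat /= cats1.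
exists b => k; rewrite -Sb.
have : capacity_ge theta (bounded_branches (S k)) (ck k).
  elim: k => [|k IH]; last exact: (hF (S k, k)).
  move=> f s [f0 fA] cf; rewrite /ck divr1 addrC subrK; apply: hc cf.
  by split=> // x [sigma hx] x01; apply: fA => //; exists sigma.
move=> h f s af cf; apply: le_trans (h f s af cf).
by rewrite lerDl divr_ge0// ltW.
Qed.

Variable b : nat -> nat.

(** Points with a branch of length [k] that extends [s] and is bounded by [b]. Only finite unions
    and finitely many closed conditions occur, so that these sets are closed, unlike
    [bounded_branches] in general. *)
Fixpoint branch_tree (k : nat) (s : seq nat) : set R :=
  if k is k'.+1
  then C s `&` \bigcup_(n in `I_(b (size s)).+1) branch_tree k' (rcons s n)
  else C s.

Lemma branch_tree_closed k s : (forall s, closed (C s)) -> closed (branch_tree k s).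
Proof.
move=> hC; elim: k s => [|k IH] s //=.
by apply: closedI => //; apply: closed_bigcup => // n _; exact: IH.
Qed.

Lemma branch_tree_dec k s : branch_tree k.+1 s `<=` branch_tree k s.
Proof.
elim: k s => [|k IH] s x; first by case.
by case=> Cx [n nb hx]; split=> //; exists n => //; exact: IH.
Qed.

Lemma branch_tree_mono k k' s : (k <= k')%N -> branch_tree k' s `<=` branch_tree k s.
Proof.
move=> kk; rewrite -(subnKC kk); elim: (k' - k)%N => [|i IH]; first by rewrite addn0.
by rewrite addnS; apply: subset_trans IH; exact: branch_tree_dec.
Qed.

Lemma bounded_branches_tree k : bounded_branches (mkseq b k) `<=` branch_tree k [::].
Proof.
move=> x [sigma [hb hx]]; rewrite size_mkseq in hb.
have {}hb i : (i < k)%N -> (sigma i <= b i)%N.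
  by move=> ik; have := hb i ik; rewrite nth_mkseq.
suff h i : (i <= k)%N -> branch_tree i (mkseq sigma (k - i)) x.
  by have := h k (leqnn k); rewrite subnn.
elim: i => [|i IH] ik /=; first exact: hx.
split; first exact: hx.
exists (sigma (k - i.+1)%N).
  by rewrite /= size_mkseq ltnS; apply: hb; rewrite ltn_subrL /= (leq_ltn_trans _ ik).
have -> : rcons (mkseq sigma (k - i.+1)) (sigma (k - i.+1)%N) = mkseq sigma (k - i).
  by rewrite -(subnSK ik) /mkseq -[in RHS]addn1 iotaD map_cat /= cats1.
exact: IH (ltnW ik).
Qed.

(* Koenig's lemma *)
Lemma branch_tree_souslin x : (forall k, branch_tree k [::] x) -> souslin C x.
Proof.
move=> h0.
have step (s : seq nat) : exists n, (forall k, branch_tree k s x) ->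
    forall k, branch_tree k (rcons s n) x.
  have [hs|hs] := pselect (forall k, branch_tree k s x); last by exists 0%N.
  apply: contrapT => /forallNP hn.
  have ex n : exists k, ~ branch_tree k (rcons s n) x.
    by apply: contrapT => /forallNP hk; apply: (hn n) => _ k; apply: contrapT; exact: hk.
  have [K hK] := choice ex.
  have [_ [n /= nb hx]] := hs (\max_(n < (b (size s)).+1) K n).+1.
  apply: (hK n); apply: branch_tree_mono hx.
  exact: (leq_bigmax (F := fun n : 'I__ => K n) (Ordinal nb)).
have [F hF] := choice step.
pose S := fix S k := if k is k'.+1 then rcons (S k') (F (S k')) else [::].
have hS k : forall i, branch_tree i (S k) x.
  by elim: k => [|k IH] //=; exact: hF.
have Sb k : S k = mkseq (fun i => F (S i)) k.
  by elim: k => // k IH; rewrite /= {1}IH [RHS]/mkseq -addn1 iotaD map_cat /= cats1.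
by exists (fun i => F (S i)) => k; rewrite -Sb; exact: (hS k 0%N).
Qed.

End Scheme.
End Frostman.

(** * Frostman weights on a compact part of a Souslin set *)

Section CompactFrostman.
Variable R : realType.

Lemma compact_nested (T : topologicalType) (X : set T) (B : nat -> set T) : compact X ->
  (forall k, closed (B k)) -> (forall k k', (k <= k')%N -> B k' `<=` B k) ->
  (forall k, exists2 x, X x & B k x) -> exists2 x, X x & forall k, B k x.
Proof.
move=> cX clB decB ex.
have /choice[u /all_and2[uX uB]] : forall k, exists x, X x /\ B k x.
  by move=> k; have [x Xx Bx] := ex k; exists x.
have XF : (u @ \oo) X by exists 0%N => // k _; exact: uX.
have [p [Xp clp]] := cX (u @ \oo) _ XF.
exists p => // k; apply: (clB k) => V nV.
have Fk : (u @ \oo) (B k) by exists k => // i /= ki; apply: decB ki _ (uB i).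
exact: clp Fk nV.
Qed.

(** [K] is the intersection of the closed sets [B k]. For a given [n], compactness provides one [k0]
    such that every leaf interval disjoint from [K] is already disjoint from [B k0]. A cover of the
    remaining leaves therefore covers [B k0], which contains a set of large capacity, and the flow
    on the tree of depth [n] exists. *)
Lemma souslin_frostman (C : seq nat -> set R) (theta rho c : R) :
  (forall s, closed (C s)) -> 0 < theta -> 0 < rho < 1 -> 0 < c ->
  content_ge (theta * rho ^+ 2) (souslin C) c ->
  exists K : set R, [/\ closed K, K `<=` souslin C &
   forall n, exists w : nat -> nat -> R, [/\ w 0%N 0%N = 1,
    forall l j, (l < n)%N -> (j < 2 ^ l)%N -> w l j = w l.+1 (2 * j)%N + w l.+1 (2 * j).+1,
    forall l j, (l <= n)%N -> (j < 2 ^ l)%N -> 0 <= w l j <= theta ^+ l / ((1 - rho) ^+ 2 * c / 2) &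
    forall j, (j < 2 ^ n)%N -> w n j != 0 ->
      exists2 y, K y & j%:R / 2 ^+ n <= y <= j.+1%:R / 2 ^+ n]].
Proof.
move=> clC t0 rho01 c0 hc.
have c'0 : 0 < (1 - rho) ^+ 2 * c.
  by rewrite mulr_gt0// exprn_gt0// subr_gt0; case/andP: rho01.
have half : (1 - rho) ^+ 2 * c / 2 < (1 - rho) ^+ 2 * c.
  by rewrite ltr_pdivrMr// ltr_pMr// ltr1n.
have [b hb] := capacity_bounds t0 (content_capacity t0 rho01 hc) half.
pose B k := branch_tree C b k [::].
have clB k : closed (B k) by exact: branch_tree_closed.
exists (\bigcap_k B k); split.
- by apply: closed_bigI => k _; exact: clB.
- by move=> x hx; apply: (branch_tree_souslin (b := b)) => k; exact: hx.
move=> n.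
pose I (j : nat) : set R := `[j%:R / 2 ^+ n, j.+1%:R / 2 ^+ n]%classic.
pose S j := `[< exists2 y, (\bigcap_k B k) y & I j y >].
have hS j : exists k, ~~ S j -> forall x, I j x -> ~ B k x.
  case: (boolP (S j)) => Sj; first by exists 0%N.
  apply: contrapT => /forallNP hk; move/negP: Sj; apply; apply/asboolP.
  have [x Ix Bx] : exists2 x, I j x & forall k, B k x.
    apply: compact_nested => //; first exact: segment_compact.
      by move=> k k' kk; exact: branch_tree_mono.
    by move=> k; apply: contrapT => hx; apply: (hk k) => _ x Ix Bx; apply: hx; exists x.
  by exists x => // k _; exact: Bx.
have [kk hkk] := choice hS.
pose k0 := (\max_(j < 2 ^ n) kk j)%N.
have [//|Q hQ|w [w1 w2 w3 w4]] := @tree_flow R n S theta t0 ((1 - rho) ^+ 2 * c / 2) _ _.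
- by rewrite divr_gt0.
(* The finite cover becomes an admissible weight with values [0] and [1]. *)
- apply: (hb k0 (fun k j => ((k, j) \in Q)%:R)); last first.
    by move=> N; exact: energy_indicator.
  split=> // x /bounded_branches_tree Bx x01.
  have /andP[x0 x1] := x01.
  have [q qQ] : exists2 q, q \in Q & node_above n q (cell n x).
    apply/hasP; apply: hQ; first exact: cell_lt.
    apply: contrapT => /negP Sj; apply: (hkk (cell n x) Sj x).
      rewrite /I /= in_itv /=; have /andP[h1 h2] := cell_itv n x0.
      have p0 : 0 < 2 ^+ n :> R by rewrite exprn_gt0.
      by rewrite ler_pdivrMr// ler_pdivlMr// mulrC h1 ltW.
    apply: branch_tree_mono Bx.
    exact: (leq_bigmax (F := fun j : 'I__ => kk j) (Ordinal (cell_lt n x01))).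
  case: q qQ => l i qQ /andP[/= ln /eqP e].
  exists l.+1; rewrite big_ord_recr /= -(cell_div x0 ln) e qQ lerDr.
  by apply: sumr_ge0.
- exists w; split=> // j jn wj; have /asboolP[y Ky Iy] := w4 j jn wj.
  by exists y => //; move: Iy; rewrite /I /= in_itv.
Qed.

End CompactFrostman.

(** * Borel sets are Souslin *)

Section BorelSouslin.
Variable R : realType.

Definition is_souslin (A : set R) := exists2 C : seq nat -> set R,
  (forall s, closed (C s)) & A = souslin C.

Lemma closed_is_souslin (A : set R) : closed A -> is_souslin A.
Proof.
move=> cA; exists (fun=> A) => //; apply/seteqP; split=> x.
  by move=> Ax; exists (fun=> 0%N).
by case=> sigma /(_ 0%N).
Qed.

(** The first term of a branch selects the set [A i], the rest is a branch for it. *)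
Lemma bigcup_is_souslin (A : nat -> set R) : (forall i, is_souslin (A i)) ->
  is_souslin (\bigcup_i A i).
Proof.
move=> hA; have /choice[C hC] : forall i, exists C : seq nat -> set R,
    (forall s, closed (C s)) /\ A i = souslin C.
  by move=> i; have [C c1 c2] := hA i; exists C.
exists (fun s => if s is i :: s' then C i s' else setT).
  by case=> [|i s]; [exact: closedT|exact: (hC i).1].
apply/seteqP; split=> x.
  case=> i _; rewrite (hC i).2 => -[sigma hs].
  exists (fun k => if k is k'.+1 then sigma k' else i) => -[|k] //.
  have -> : mkseq (fun k => if k is k'.+1 then sigma k' else i) k.+1 = i :: mkseq sigma k.
    by rewrite /mkseq /= (iotaDl 1 0) -map_comp.
  exact: hs.
case=> sigma hs; exists (sigma 0%N) => //; rewrite (hC _).2.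
exists (fun k => sigma k.+1) => k.
have e : mkseq (fun k => sigma k.+1) k = map sigma (iota 1 k).
  by rewrite (iotaDl 1 0) -map_comp.
by rewrite e; exact: (hs k.+1).
Qed.

Lemma bigcap_is_souslin (A : nat -> set R) : (forall i, is_souslin (A i)) ->
  is_souslin (\bigcap_i A i).
Proof.
move=> hA; have /choice[C hC] : forall i, exists C : seq nat -> set R,
    (forall s, closed (C s)) /\ A i = souslin C.
  by move=> i; have [C c1 c2] := hA i; exists C.
(* a branch codes the sequence of branches [n => sigma (pickle (i, n))], one for each [A i] *)
pose sub (i : nat) (s : seq nat) (l : nat) := mkseq (fun n => nth 0%N s (pickle (i, n))) l.
pose ok (i : nat) (s : seq nat) (l : nat) := forall n, (n < l)%N -> (pickle (i, n) < size s)%N.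
exists (fun s => [set x | forall i l, ok i s l -> C i (sub i s l) x]).
  move=> s; have -> : [set x | forall i l, ok i s l -> C i (sub i s l) x] =
      \bigcap_i \bigcap_(l in ok i s) C i (sub i s l).
    apply/seteqP; split=> x hx i; first by move=> _ l; exact: hx.
    by move=> l hl; exact: (hx i I l hl).
  by apply: closed_bigI => i _; apply: closed_bigI => l _; exact: (hC i).1.
have subE sigma i k l : ok i (mkseq sigma k) l ->
    sub i (mkseq sigma k) l = mkseq (fun n => sigma (pickle (i, n))) l.
  move=> hl; apply/eq_in_map => n; rewrite mem_iota /= => nl.
  by rewrite nth_mkseq//; have := hl n nl; rewrite size_mkseq.
apply/seteqP; split=> x.
  move=> hx; have ex i : exists sigma : nat -> nat, forall k, C i (mkseq sigma k) x.
    by have := hx i I; rewrite (hC i).2.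
  have [sg hsg] := choice ex.
  pose sigma (m : nat) := if @unpickle (nat * nat)%type m is Some (i, n) then sg i n else 0%N.
  exists sigma => k i l hl; rewrite subE//.
  have -> : mkseq (fun n => sigma (pickle (i, n))) l = mkseq (sg i) l.
    by apply: eq_mkseq => n; rewrite /sigma pickleK.
  exact: hsg.
case=> sigma hs i _; rewrite (hC i).2; exists (fun n => sigma (pickle (i, n))) => l.
pose k := (\max_(n < l) pickle (i, nat_of_ord n)).+1.
have hl : ok i (mkseq sigma k) l.
  move=> n nl; rewrite size_mkseq ltnS.
  exact: (leq_bigmax (F := fun n : 'I_l => pickle (i, nat_of_ord n)) (Ordinal nl)).
by rewrite -(subE _ _ _ _ hl); exact: hs.
Qed.

Lemma itv_oc_bigcup (a b : R) :
  `]a, b]%classic = \bigcup_n `[a + n.+1%:R^-1, b]%classic.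
Proof.
apply/seteqP; split=> x /=.
  rewrite in_itv /= => /andP[ax xb].
  pose n := Num.bound (x - a)^-1.
  exists n => //; rewrite /= in_itv /= xb andbT -lerBrDl.
  have xa : 0 < x - a by rewrite subr_gt0.
  rewrite -[leRHS]invrK lef_pV2 ?posrE ?invr_gt0//.
  apply: (@le_trans _ _ n%:R); last by rewrite ler_nat.
  by rewrite ltW// archi_boundP// invr_ge0 ltW.
case=> n _; rewrite /= !in_itv /= => /andP[h ->]; rewrite andbT.
by apply: lt_le_trans h; rewrite ltrDl invr_gt0.
Qed.

Lemma setC_itv_oc_bigcup (a b : R) :
  ~` `]a, b]%classic = `]-oo, a]%classic `|` \bigcup_n `[b + n.+1%:R^-1, +oo[%classic.
Proof.
apply/seteqP; split=> x /=.
  rewrite in_itv /= => /negP; rewrite negb_and -leNgt -ltNge => /orP[xa|bx].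
    by left; rewrite in_itv.
  right; pose n := Num.bound (x - b)^-1.
  exists n => //; rewrite /= in_itv /= andbT -lerBrDl.
  have xb : 0 < x - b by rewrite subr_gt0.
  rewrite -[leRHS]invrK lef_pV2 ?posrE ?invr_gt0//.
  apply: (@le_trans _ _ n%:R); last by rewrite ler_nat.
  by rewrite ltW// archi_boundP// invr_ge0 ltW.
case; rewrite /= !in_itv /= => h.
  by apply/negP; rewrite negb_and -leNgt h.
case: h => n _; rewrite /= in_itv /= andbT => h.
apply/negP; rewrite negb_and -ltNge orbC; apply/orP; left.
by apply: lt_le_trans h; rewrite ltrDl invr_gt0.
Qed.

Lemma setU_is_souslin (A B : set R) : is_souslin A -> is_souslin B -> is_souslin (A `|` B).
Proof.
move=> hA hB; have -> : A `|` B = \bigcup_i (if i is 0%N then A else B).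
  apply/seteqP; split=> x; first by case=> h; [exists 0%N|exists 1%N].
  by case=> -[|i] _ h; [left|right].
by apply: bigcup_is_souslin => -[].
Qed.

(** Being Souslin is not stable under complement, so the sigma-algebra used is that of the sets that
    are Souslin together with their complement; it contains the generating intervals []a, b]]. *)
Lemma borel_is_souslin (E : set (measurableTypeR R)) : measurable E -> is_souslin E.
Proof.
pose G : set (set R) := [set A | is_souslin A /\ is_souslin (~` A)].
have sG : sigma_algebra setT G.
  split.
  - by split; rewrite ?setC0; apply: closed_is_souslin; [exact: closed0|exact: closedT].
  - by move=> A [h1 h2]; split; rewrite setTD ?setCK.
  - move=> F hF; split; first by apply: bigcup_is_souslin => i; exact: (hF i).1.
    by rewrite setC_bigcup; apply: bigcap_is_souslin => i; exact: (hF i).2.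
move=> mE; suff [] : G E by [].
move: mE; rewrite /measurable /=; apply: smallest_sub => //.
move=> A [[a b] _ <-]; split.
  rewrite itv_oc_bigcup; apply: bigcup_is_souslin => n; apply: closed_is_souslin.
  exact: itv_closed.
rewrite setC_itv_oc_bigcup; apply: setU_is_souslin.
  by apply: closed_is_souslin; exact: lray_closed.
by apply: bigcup_is_souslin => n; apply: closed_is_souslin; exact: rray_closed.
Qed.

End BorelSouslin.

(** * Hausdorff content of dyadic cells *)

Section CellContent.
Variable R : realType.
Variables (beta : R) (k0 i : nat) (E : set R) (Q : nat -> nat -> bool).
Hypothesis beta0 : 0 < beta.
Hypothesis ik0 : (i < 2 ^ k0)%N.
Hypothesis E01 : E `<=` `[0, 1]%classic.

Let Theta : R := 2^-1 `^ beta.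

Lemma dyadic_powR k : (2 ^+ k)^-1 `^ beta = Theta ^+ k.
Proof.
have h0 : 0 <= 2^-1 :> R by rewrite invr_ge0.
by rewrite -exprVn -(powR_mulrn k h0) -powRrM mulrC powRrM powR_mulrn// powR_ge0.
Qed.

(* the node [(l, j)] of the binary tree is numbered [2 ^ l + j] *)
Let level (n : nat) := trunc_log 2 n.
Let index (n : nat) := (n - 2 ^ level n)%N.
Let used (n : nat) := (0 < n)%N && Q (level n) (index n).

Let level_node l j : (j < 2 ^ l)%N -> level (2 ^ l + j) = l.
Proof.
move=> jl; apply: trunc_log_eq => //.
by rewrite leq_addr /= expnS mul2n -addnn ltn_add2l.
Qed.

Let index_lt n : (0 < n)%N -> (index n < 2 ^ level n)%N.
Proof.
move=> n0; have := trunc_log_bounds (isT : (1 < 2)%N) n0; rewrite -/(level n) => /andP[h1 h2].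
by rewrite /index ltn_subLR// addnn -mul2n -expnS.
Qed.

Let node_itv (l j : nat) : interval R :=
  `[(i%:R + j%:R / 2 ^+ l) / 2 ^+ k0, (i%:R + j.+1%:R / 2 ^+ l) / 2 ^+ k0[.

(** One sequence of intervals: the cells of level [k0], then the nodes selected by [Q], rescaled
    into cell [i]. Slot [i] is free and takes the point [1], which no half-open cell contains and
    which costs nothing. *)
Let cover (m : nat) : interval R :=
  if (m < 2 ^ k0)%N then
    if m == i then `[1, 1] else `[m%:R / 2 ^+ k0, m.+1%:R / 2 ^+ k0[
  else if used (m - 2 ^ k0) then node_itv (level (m - 2 ^ k0)) (index (m - 2 ^ k0))
  else `[0, 0[.

Let node_cost (n : nat) : R := if used n then Theta ^+ (k0 + level n) else 0.

Let cost (m : nat) : R :=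
  if (m < 2 ^ k0)%N then if m == i then 0 else Theta ^+ k0
  else node_cost (m - 2 ^ k0).

Let p2 k : 0 < 2 ^+ k :> R. Proof. by rewrite exprn_gt0. Qed.

Let measure_co (a b : R) : a <= b -> lebesgue_measure (`[a, b[%classic : set R) = (b - a)%:E.
Proof.
rewrite lebesgue_measure_itv /= lte_fin le_eqVlt => /orP[/eqP ->|ab].
  by rewrite ltxx subrr.
by rewrite ab EFinB.
Qed.

Let cover_cost m : (lebesgue_measure ([set` cover m] : set R) `^ beta)%E = (cost m)%:E.
Proof.
have bn0 : beta != 0 by rewrite gt_eqF.
rewrite /cover /cost; case: ifP => _.
  case: ifP => _.
    by rewrite lebesgue_measure_itv /= ltxx poweR_EFin powR0.
  rewrite measure_co; last by rewrite ler_pM2r ?invr_gt0// ler_nat.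
  by rewrite poweR_EFin -mulrBl -natr1 addrAC subrr add0r mul1r dyadic_powR.
rewrite /node_cost; case: ifP => _; last first.
  by rewrite measure_co// subrr poweR_EFin powR0.
set l := level _; set j := index _.
rewrite /node_itv measure_co; last first.
  by rewrite ler_pM2r ?invr_gt0// lerD2l ler_pM2r ?invr_gt0// ler_nat.
rewrite poweR_EFin -dyadic_powR; congr (_ `^ _)%:E.
by rewrite -natr1 exprD; field; rewrite !gt_eqF.
Qed.

Let cover_in_01 m : [set` cover m] `<=` `[0, 1]%classic.
Proof.
move=> x; rewrite /cover; case: ifP => mk.
  case: ifP => _ /=; rewrite !in_itv /=.
    by move=> /andP[h ->]; rewrite andbT; apply: le_trans h.
  move=> /andP[h1 /ltW h2]; apply/andP; split; first by apply: le_trans h1; rewrite divr_ge0// ltW.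
  by apply: (le_trans h2); rewrite ler_pdivrMr// mul1r -natrX ler_nat.
case: ifP => [/andP[n0 _]|_] /=; rewrite !in_itv /= => /andP[h1 h2]; last first.
  by have := le_lt_trans h1 h2; rewrite ltxx.
have jl := index_lt n0.
apply/andP; split.
  by apply: le_trans h1; rewrite divr_ge0 ?(ltW (p2 _))// addr_ge0// divr_ge0// ltW.
apply: (le_trans (ltW h2)); rewrite ler_pdivrMr// mul1r.
apply: (@le_trans _ _ (i%:R + 1)).
  by rewrite lerD2l ler_pdivrMr// mul1r -natrX ler_nat.
by rewrite natr1 -natrX ler_nat.
Qed.

Let cost0 m : 0 <= cost m.
Proof.
rewrite /cost /node_cost; case: ifP => _; case: ifP => _ //; apply: exprn_ge0; exact: powR_ge0.
Qed.

Let node_cost_sum L : \sum_(n < 2 ^ L) node_cost n =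
  Theta ^+ k0 * \sum_(l < L) \sum_(j < 2 ^ l) (Q l j)%:R * Theta ^+ l.
Proof.
elim: L => [|L IH].
  by rewrite big_ord1 big_ord0 mulr0 /node_cost /used.
rewrite expnS mul2n -addnn big_split_ord /= IH big_ord_recr /= mulrDr; congr (_ + _).
rewrite mulr_sumr; apply: eq_bigr => j _.
have jL := ltn_ord j.
have u : used (2 ^ L + j) = Q L j.
  by rewrite /used addn_gt0 expn_gt0 /= /index level_node// addKn.
rewrite /node_cost u level_node// exprD; case: (Q L j); first by rewrite mul1r.
by rewrite mul0r mulr0.
Qed.

(** Covering cell [i] by rescaled nodes and each of the other cells by itself must cost at least the
    content of [E]; hence no single cell can be covered too cheaply. *)
Lemma content_cell (delta s : R) :
  ((1 - delta)%:E <= hausdorff_content beta E)%E ->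
  (forall y, E ((i%:R + y) / 2 ^+ k0) -> 0 <= y < 1 -> exists k, Q k (cell k y)) ->
  (forall N, \sum_(k < N) \sum_(j < 2 ^ k) (Q k j)%:R * Theta ^+ k <= s) ->
  1 - delta <= Theta ^+ k0 * (s + 2 ^+ k0 - 1).
Proof.
move=> hE hQ hs; rewrite -lee_fin; apply: (le_trans hE).
apply: (@le_trans _ _ (\sum_(m <oo) (lebesgue_measure ([set` cover m] : set R) `^ beta))%E).
  apply: ereal_inf_lbound; exists cover => //; split; first exact: cover_in_01.
  move=> x Ex; have := E01 Ex; rewrite /= in_itv /= => /andP[x0 x1].
  move: x1; rewrite le_eqVlt => /orP[/eqP ->|x1].
    by exists i => //; rewrite /= /cover ik0 eqxx /= in_itv /= lexx.
  have x01 : 0 <= x < 1 by rewrite x0.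
  have /andP[c1 c2] := cell_itv k0 x0; have ck := cell_lt k0 x01.
  have [ci|ci] := eqVneq (cell k0 x) i; last first.
    exists (cell k0 x) => //=; rewrite /cover ck (negbTE ci) /= in_itv /=.
    by rewrite ler_pdivrMr// ltr_pdivlMr// mulrC c1.
  rewrite ci in c1 c2.
  pose y := 2 ^+ k0 * x - i%:R.
  have y01 : 0 <= y < 1 by rewrite subr_ge0 c1 /= ltrBlDl natr1.
  have xy : x = (i%:R + y) / 2 ^+ k0 by rewrite /y addrC subrK mulrC mulKf// gt_eqF.
  have [l Ql] := hQ y (eq_ind _ E Ex _ xy) y01.
  have jl := cell_lt l y01.
  have nk : (2 ^ k0 + (2 ^ l + cell l y) < 2 ^ k0)%N = false.
    by apply/negbTE; rewrite -leqNgt leq_addr.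
  exists (2 ^ k0 + (2 ^ l + cell l y))%N => //=.
  rewrite /cover nk addKn /used addn_gt0 expn_gt0 /= /index level_node// addKn Ql.
  rewrite /node_itv /= in_itv /= [X in _ <= X]xy [X in X < _]xy.
  rewrite ler_pM2r ?invr_gt0// ltr_pM2r ?invr_gt0// lerD2l ltrD2l.
  have y0 : 0 <= y by case/andP: y01.
  have /andP[d1 d2] := cell_itv l y0.
  by rewrite ler_pdivrMr// ltr_pdivlMr// mulrC d1.
apply: lime_le; first by apply: is_cvg_nneseries => n _ _; rewrite cover_cost lee_fin.
near=> N.
rewrite (eq_bigr (fun m => (cost m)%:E)); last by move=> m _; rewrite cover_cost.
rewrite sumEFin lee_fin big_mkord.
apply: (@le_trans _ _ (\sum_(m < 2 ^ k0 + 2 ^ N) cost m)).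
  have NN : (N <= 2 ^ k0 + 2 ^ N)%N by apply: leq_trans (leq_addl _ _); rewrite ltnW// ltn_expl.
  by rewrite -(subnKC NN) big_split_ord /= lerDl; apply: sumr_ge0.
rewrite big_split_ord /=.
have -> : \sum_(j < 2 ^ N) cost (2 ^ k0 + j) = \sum_(n < 2 ^ N) node_cost n.
  by apply: eq_bigr => j _; rewrite /cost addKn ltnNge leq_addr.
rewrite node_cost_sum (bigD1 (Ordinal ik0)) //= {1}/cost ik0 eqxx add0r.
rewrite (eq_bigr (fun=> Theta ^+ k0)); last first.
  move=> m mi; rewrite /cost ltn_ord ifF//; apply/negbTE.
  by apply: contra mi => /eqP e; apply/eqP/val_inj.
rewrite sumr_const cardC1 card_ord -subn1 -[X in X + _]mulr_natl natrB ?expn_gt0// natrX.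
have T0 : 0 <= Theta ^+ k0 by apply: exprn_ge0; exact: powR_ge0.
have := ler_wpM2l T0 (hs N); lra.
Unshelve. all: by end_near.
Qed.

End CellContent.

(** * Frostman densities from all cells of level [k0] *)

Lemma content_ge_mono (R : realType) (t t' : R) (A : set R) (c : R) : 0 <= t -> t <= t' ->
  content_ge t A c -> content_ge t' A c.
Proof.
move=> t0 tt hc Q s hQ hs; apply: (hc Q) => // N; apply: le_trans (hs N).
apply: ler_sum => k _; apply: ler_sum => j _.
by rewrite ler_wpM2l//; apply: lerXn2r; rewrite ?nnegrE// (le_trans t0).
Qed.

Lemma closed_preimage (T U : topologicalType) (f : T -> U) (D : set U) :
  continuous f -> closed D -> closed (f @^-1` D).
Proof. by move=> cf cD; apply: closed_comp => // x _; exact: cf. Qed.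

Lemma double_succ_lt a b : (a < b)%N -> ((2 * a).+1 < 2 * b)%N.
Proof. by lia. Qed.

Section FrostmanCells.
Variable R : realType.

Lemma affine_continuous (a b : R) : continuous (fun x : R => a * x + b).
Proof. by move=> x; apply: cvgD; [apply: cvgM; [exact: cvg_cst|exact: cvg_id]|exact: cvg_cst]. Qed.

Lemma is_souslin_preimage (A : set R) (f : R -> R) : continuous f ->
  is_souslin A -> is_souslin (f @^-1` A).
Proof.
move=> cf [C clC ->]; exists (fun s => f @^-1` C s) => [s|]; first exact: closed_preimage.
by apply/seteqP; split=> x [sigma hs]; exists sigma.
Qed.

Lemma exponent_exists (Theta : R) : 2^-1 < Theta < 1 ->
  exists2 beta : R, 0 < beta < 1 & 2^-1 `^ beta = Theta.
Proof.
move=> /andP[t1 t2]; have T0 : 0 < Theta by apply: lt_trans t1; rewrite invr_gt0.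
have l2 : ln (2^-1 : R) < 0 by rewrite ln_lt0// invr_gt0//=; lra.
have lT : ln Theta < 0 by rewrite ln_lt0// T0.
exists (ln Theta / ln 2^-1).
  rewrite -mulrNN -invrN; apply/andP; split; first by rewrite divr_gt0// oppr_gt0.
  rewrite ltr_pdivrMr ?oppr_gt0// mul1r ltrN2 ltr_ln ?posrE//.
by rewrite /powR gt_eqF ?invr_gt0// divfK ?lnK ?posrE// lt_eqF.
Qed.

Lemma bernoulli_inv (x : R) (k : nat) : 0 <= x -> (1 + x) ^+ k * (1 - k%:R * x) <= 1.
Proof.
move=> x0; elim: k => [|k IH]; first by rewrite expr0 mul0r subr0 mulr1.
apply: le_trans IH; rewrite exprSr -mulrA ler_wpM2l ?exprn_ge0 ?addr_ge0//.
rewrite -natr1; have : 0 <= (k%:R + 1) * (x * x) by rewrite mulr_ge0// ?addr_ge0// mulr_ge0.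
by lra.
Qed.

(** Since [(1 + xi) / 2] is barely above one half, all [2 ^ k0] cells together cost only
    [(1 + xi) ^ k0], hardly more than one. Saving half a cell would bring the total below
    [1 - delta], where [delta] is a quarter of a cell length. *)
Lemma cell_content_ge (beta xi : R) (k0 i : nat) (E : set R) :
  0 < beta -> 0 < xi -> 2^-1 `^ beta = (1 + xi) / 2 -> (i < 2 ^ k0)%N ->
  k0%:R * xi <= (2 ^+ k0)^-1 / 4 ->
  E `<=` `[0, 1]%classic ->
  ((1 - (2 ^+ k0)^-1 / 4)%:E <= hausdorff_content beta E)%E ->
  content_ge ((1 + xi) / 2) ((fun y => (2 ^+ k0)^-1 * y + i%:R / 2 ^+ k0) @^-1` E) 2^-1.
Proof.
move=> b0 xi0 eT ik hxi E01 hE Q s hQ hs.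
set del := (2 ^+ k0)^-1 / 4 in hxi hE.
have p2 : 0 < 2 ^+ k0 :> R by rewrite exprn_gt0.
have del0 : 0 < del by rewrite divr_gt0// invr_gt0.
have del1 : del <= 4^-1.
  by rewrite ler_pdivrMr// mulVf// invf_le1// exprn_ege1// ler1n.
have := @content_cell R beta k0 i E Q b0 ik E01 del s hE.
rewrite eT => h.
have {}h : 1 - del <= ((1 + xi) / 2) ^+ k0 * (s + 2 ^+ k0 - 1).
  apply: h => // y Ey y01; apply: hQ => //=.
  by rewrite (_ : _ + _ = (i%:R + y) / 2 ^+ k0)//; ring.
rewrite leNgt; apply/negP => s2.
set u := (1 + xi) ^+ k0; have ub := bernoulli_inv k0 (ltW xi0); rewrite -/u in ub.
have u0 : 0 < u by rewrite exprn_gt0// addr_gt0.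
have e : ((1 + xi) / 2) ^+ k0 = u / 2 ^+ k0 by rewrite expr_div_n.
have h1 : ((1 + xi) / 2) ^+ k0 * (s + 2 ^+ k0 - 1) < u * (1 - 2 * del).
  have -> : u * (1 - 2 * del) = u / 2 ^+ k0 * (2 ^+ k0 - 2^-1).
    by rewrite /del; field; rewrite gt_eqF.
  rewrite e ltr_pM2l ?divr_gt0//; lra.
have h2 : u * (1 - 2 * del) <= u * (1 - k0%:R * xi) * (1 - del).
  rewrite -mulrA ler_pM2l//.
  have k0xi : 0 <= k0%:R * xi by rewrite mulr_ge0// ltW.
  have : 0 <= k0%:R * xi * del by rewrite mulr_ge0// ltW.
  lra.
have h3 : u * (1 - k0%:R * xi) * (1 - del) <= 1 * (1 - del).
  by rewrite ler_wpM2r//; lra.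
lra.
Qed.

(** Each cell of level [k0] receives mass [2 ^ - k0], distributed by Frostman weights for
    [theta = g / 2]; so the densities are one up to level [k0] and grow at most like [g ^ k]
    afterwards. The constant is the inverse of [(1 - rho) ^ 2 * 2^-1 / 2], where [2^-1] is the
    content of a rescaled cell, and thus does not involve [k0]. *)
Lemma frostman_densities (g rho : R) (k0 : nat) : 1 < g -> 0 < rho < 1 ->
  1 < g * rho ^+ 2 ->
  exists beta delta : R, [/\ 0 < beta < 1, 0 < delta &
   forall E : set (measurableTypeR R), measurable E -> E `<=` `[0, 1] ->
    ((1 - delta)%:E <= hausdorff_content beta E)%E ->
    exists K : set R, [/\ closed K, K `<=` E &
     forall n, (k0 <= n)%N -> exists2 d, density_tree n k0 (4 / (1 - rho) ^+ 2) g d &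
       forall J, (J < 2 ^ n)%N -> d n J != 0 ->
         exists2 e, K e & J%:R / 2 ^+ n <= e <= J.+1%:R / 2 ^+ n]].
Proof.
move=> g1 rho01 gr; have /andP[r0 r1] := rho01.
have p2 k : 0 < 2 ^+ k :> R by rewrite exprn_gt0.
have g0 : 0 < g by apply: lt_trans g1.
(* The first bound gives [(1 + xi) / 2 <= g / 2 * rho ^ 2], the second [k0 * xi <= delta] with
   [delta = 2 ^ - k0 / 4]. *)
pose xi := Num.min ((g * rho ^+ 2 - 1) / 1) ((2 ^+ k0)^-1 / 4 / k0.+1%:R).
have xi0 : 0 < xi.
  by rewrite lt_min !divr_gt0 ?invr_gt0// subr_gt0.
have xi1 : xi <= g * rho ^+ 2 - 1 by rewrite ge_min divr1 lexx.
have xi2 : xi <= (2 ^+ k0)^-1 / 4 / k0.+1%:R by rewrite ge_min lexx orbT.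
have del0 : 0 < (2 ^+ k0)^-1 / 4 :> R by rewrite divr_gt0// invr_gt0.
have hxi : k0%:R * xi <= (2 ^+ k0)^-1 / 4.
  rewrite ler_pdivlMr// mulrC in xi2; apply: le_trans xi2.
  by rewrite ler_pM2r// ler_nat.
have xi4 : xi <= 4^-1.
  apply: (le_trans xi2); rewrite ler_pdivrMr//.
  have : (2 ^+ k0)^-1 <= 1 :> R by rewrite invf_le1// exprn_ege1// ler1n.
  have : 1 <= k0.+1%:R :> R by rewrite ler1n.
  lra.
have [|beta beta01 eT] := @exponent_exists ((1 + xi) / 2).
  by rewrite -[X in X < _]mul1r ltr_pM2r// ltr_pdivrMr//; lra.
have beta0 : 0 < beta by case/andP: beta01.
exists beta, ((2 ^+ k0)^-1 / 4); split=> // E mE E01 hE.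
pose A (i : nat) : set R := (fun y => (2 ^+ k0)^-1 * y + i%:R / 2 ^+ k0) @^-1` E.
have cA i : (i < 2 ^ k0)%N -> content_ge (g / 2 * rho ^+ 2) (A i) 2^-1.
  move=> ik; apply: content_ge_mono (cell_content_ge beta0 xi0 eT ik hxi E01 hE).
    by rewrite divr_ge0// addr_ge0// ltW.
  by rewrite mulrAC ler_pM2r//; lra.
have exK i : exists K : set R, (i < 2 ^ k0)%N -> [/\ closed K, K `<=` A i &
   forall n, exists w : nat -> nat -> R, [/\ w 0%N 0%N = 1,
    forall l j, (l < n)%N -> (j < 2 ^ l)%N -> w l j = w l.+1 (2 * j)%N + w l.+1 (2 * j).+1,
    forall l j, (l <= n)%N -> (j < 2 ^ l)%N -> 0 <= w l j <= (g / 2) ^+ l / ((1 - rho) ^+ 2 * 2^-1 / 2) &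
    forall j, (j < 2 ^ n)%N -> w n j != 0 ->
      exists2 y, K y & j%:R / 2 ^+ n <= y <= j.+1%:R / 2 ^+ n]].
  case: (boolP (i < 2 ^ k0)%N) => ik; last by exists set0.
  have [C clC eC] : is_souslin (A i).
    apply: is_souslin_preimage; first exact: affine_continuous.
    exact: borel_is_souslin.
  have := cA i ik; rewrite eC => hc.
  have [||K hK] := souslin_frostman clC _ rho01 _ hc; last by exists K.
  - by rewrite divr_gt0.
  - by rewrite invr_gt0.
have [K hK] := choice exK.
exists (\bigcup_(i in `I_(2 ^ k0)) (fun e => 2 ^+ k0 * e + - i%:R) @^-1` K i); split.
- apply: closed_bigcup; first exact: finite_II.
  move=> i /= ik; apply: closed_preimage; first exact: affine_continuous.
  by have [] := hK i ik.
- move=> e [i /= ik Ke]; have [_ KA _] := hK i ik; have := KA _ Ke.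
  rewrite /A /=; set e' := (X in E X); have -> // : e' = e.
  by rewrite /e'; field; rewrite gt_eqF.
move=> n kn; pose l0 := (n - k0)%N.
have exw i : exists w : nat -> nat -> R, (i < 2 ^ k0)%N -> [/\ w 0%N 0%N = 1,
    forall l j, (l < l0)%N -> (j < 2 ^ l)%N -> w l j = w l.+1 (2 * j)%N + w l.+1 (2 * j).+1,
    forall l j, (l <= l0)%N -> (j < 2 ^ l)%N -> 0 <= w l j <= (g / 2) ^+ l / ((1 - rho) ^+ 2 * 2^-1 / 2) &
    forall j, (j < 2 ^ l0)%N -> w l0 j != 0 ->
      exists2 y, K i y & j%:R / 2 ^+ l0 <= y <= j.+1%:R / 2 ^+ l0].
  case: (boolP (i < 2 ^ k0)%N) => ik; last by exists (fun _ _ => 0).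
  by have [_ _ /(_ l0)[w hw]] := hK i ik; exists w.
have [w hw] := choice exw.
(* Above level [k0], the quotient of [J] names the cell of level [k0], the remainder the node inside
   it, and the power of two turns mass into density. *)
pose d (k J : nat) : R := if (k <= k0)%N then 1 else
  2 ^+ (k - k0) * w (J %/ 2 ^ (k - k0))%N (k - k0)%N (J %% 2 ^ (k - k0))%N.
have dE k J : (k0 <= k)%N -> (J < 2 ^ k)%N ->
   d k J = 2 ^+ (k - k0) * w (J %/ 2 ^ (k - k0))%N (k - k0)%N (J %% 2 ^ (k - k0))%N.
  move=> kk Jk; rewrite /d; case: leqP => // kk'.
  have ek : k = k0 by apply/eqP; rewrite eqn_leq kk kk'.
  rewrite ek subnn expr0 mul1r expn0 divn1 modn1.
  by rewrite ek in Jk; have [-> _ _ _] := hw J Jk.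
have qlt k J : (k0 <= k)%N -> (J < 2 ^ k)%N -> (J %/ 2 ^ (k - k0) < 2 ^ k0)%N.
  by move=> kk Jk; rewrite ltn_divLR ?expn_gt0// -expnD subnKC.
have one_r : 0 < 1 - rho by rewrite subr_gt0.
have C1 : 1 <= 4 / (1 - rho) ^+ 2.
  rewrite lter_pdivlMr ?exprn_gt0// mul1r; apply: (@le_trans _ _ 1); last by rewrite ler1n.
  by rewrite exprn_ile1//; lra.
exists d.
  split.
  - move=> k J kl Jk; have [kk|kk] := ltnP k k0.
      by rewrite /d kk (ltnW kk); field.
    have J2 : (2 * J < 2 ^ k.+1)%N by rewrite expnS ltn_pmul2l.
    have J21 : ((2 * J).+1 < 2 ^ k.+1)%N by rewrite expnS double_succ_lt.
    rewrite !dE ?(leqW kk)//.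
    have [_ hs _ _] := hw _ (qlt k J kk Jk).
    have m0 : (0 < 2 ^ (k - k0))%N by rewrite expn_gt0.
    rewrite (hs (k - k0)%N) ?ltn_mod//; last by rewrite /l0 ltn_sub2r// (leq_ltn_trans kk).
    rewrite subSn// expnS (divnMl (_ : (0 < 2)%N))// -muln_modr.
    have -> : ((2 * J).+1 %/ (2 * 2 ^ (k - k0)) = J %/ 2 ^ (k - k0))%N.
      rewrite {1}(divn_eq J (2 ^ (k - k0))) mulnDr mulnCA -addnS divnMDl ?muln_gt0//.
      by rewrite [X in (_ + X)%N]divn_small ?addn0// double_succ_lt// ltn_mod.
    have -> : ((2 * J).+1 %% (2 * 2 ^ (k - k0)) = (2 * (J %% 2 ^ (k - k0))).+1)%N.
      rewrite {1}(divn_eq J (2 ^ (k - k0))) mulnDr mulnCA -addnS modnMDl modn_small//.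
      by rewrite double_succ_lt// ltn_mod.
    by rewrite exprS; field.
  - move=> k J kn' Jk; have [kk|kk] := leqP k k0.
      rewrite /d kk ler01 /=; apply: (le_trans C1); rewrite ler_peMr//.
        by apply: le_trans C1.
      by rewrite exprn_ege1// ltW.
    rewrite dE ?(ltnW kk)//.
    have [_ _ hb _] := hw _ (qlt k J (ltnW kk) Jk).
    have /andP[b1 b2] := hb (k - k0)%N (J %% 2 ^ (k - k0))%N (leq_sub2r _ kn')
      (ltn_pmod _ (expn_gt0 2 (k - k0))).
    rewrite mulr_ge0 ?exprn_ge0//=; rewrite -(ler_pM2l (p2 (k - k0)%N)) in b2.
    apply: (le_trans b2); apply: (@le_trans _ _ (4 / (1 - rho) ^+ 2 * g ^+ (k - k0))).
      rewrite expr_div_n le_eqVlt; apply/orP; left; apply/eqP.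
      by field; rewrite !gt_eqF.
    rewrite ler_wpM2l ?(le_trans _ C1)// ler_weXn2l ?(ltW g1)// leq_subr//.
  - by move=> k J kk _; rewrite /d kk.
move=> J Jn; rewrite dE// mulf_eq0 negb_or => /andP[_ wn].
have m0 : (0 < 2 ^ (n - k0))%N by rewrite expn_gt0.
have [_ _ _ hs] := hw _ (qlt n J kn Jn).
have [y Ky /andP[y1 y2]] := hs _ (ltn_pmod J m0) wn.
set i := (J %/ 2 ^ (n - k0))%N in Ky wn *; set j := (J %% 2 ^ (n - k0))%N in y1 y2 wn.
exists ((i%:R + y) / 2 ^+ k0).
  exists i; first exact: (qlt n J kn Jn).
  by rewrite /= mulrC divfK ?gt_eqF// addrAC subrr add0r.
have eJ : J%:R = i%:R * 2 ^+ l0 + j%:R :> R.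
  by rewrite /i /j [in LHS](divn_eq J (2 ^ (n - k0))) natrD natrM natrX.
have en : 2 ^+ n = 2 ^+ l0 * 2 ^+ k0 :> R by rewrite -exprD subnK.
have j1 : j%:R <= y * 2 ^+ l0 by rewrite -ler_pdivrMr.
have j2 : y * 2 ^+ l0 <= j%:R + 1 by rewrite natr1 -ler_pdivlMr.
rewrite -[in X in _ <= _ <= X]natr1 en invfM !mulrA !ler_pM2r ?invr_gt0//.
rewrite ler_pdivrMr// ler_pdivlMr// eJ; apply/andP; split.
  by rewrite mulrDl lerD2l.
by rewrite mulrDl -addrA lerD2l.
Qed.

End FrostmanCells.

(** * Passage to the limit *)

Section Limit.
Variable R : realType.

Lemma le0_of_dyadic (a M : R) (n0 : nat) :
  (forall n, a <= M / 2 ^+ (n0 + n)) -> a <= 0.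
Proof.
move=> h; rewrite leNgt; apply/negP => a0.
pose n := Num.bound (M / a).
have := h n; rewrite ler_pdivlMr ?exprn_gt0// leNgt => /negP; apply.
rewrite mulrC -ltr_pdivrMr//.
apply: (@le_lt_trans _ _ `|M / a|); first exact: ler_norm.
apply: (@lt_le_trans _ _ n%:R).
  have := archi_boundP (normr_ge0 (M / a)).
  by rewrite /n /Num.bound normr_id.
rewrite -natrX ler_nat; apply: leq_trans (leq_addl n0 n) _.
by rewrite ltnW// ltn_expl.
Qed.

(** The conditions on triples in the compact set [K * K * K] are closed and nested, since the
    tolerances decrease. The lower bound [tau] on the step prevents the three points from collapsing
    in the limit. *)
Lemma pattern_limit (K : set R) (p q tau M : R) (n0 : nat) :
  closed K -> K `<=` `[0, 1]%classic ->
  (forall n, exists e0 e1 e2 : R, [/\ K e0, K e1, K e2,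
     tau - M / 2 ^+ (n0 + n) <= e1 - e0 &
     `|e2 - e0 - p * (e1 - e0) ^+ 2 - q * (e1 - e0)| <= M / 2 ^+ (n0 + n)]) ->
  exists e0 e1 e2 : R, [/\ K e0, K e1, K e2, tau <= e1 - e0 &
    e2 = e0 + p * (e1 - e0) ^+ 2 + q * (e1 - e0)].
Proof.
move=> cK K01 h.
have compK : compact K by apply: (subclosed_compact cK (@segment_compact _ 0 1)).
pose f (e : R * R * R) := e.1.2 - e.1.1.
pose e2e0 (e : R * R * R) := e.2 - e.1.1 - p * (e.1.2 - e.1.1) ^+ 2 - q * (e.1.2 - e.1.1).
have cf : continuous f.
  move=> e; apply: cvgB.
    by apply: (@cvg_comp _ _ _ (fun e : R * R * R => e.1) snd); [exact: cvg_fst|exact: cvg_snd].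
  by apply: (@cvg_comp _ _ _ (fun e : R * R * R => e.1) fst); [exact: cvg_fst|exact: cvg_fst].
have c1 : continuous (fun e : R * R * R => e.1.1).
  by move=> e; apply: (@cvg_comp _ _ _ (fun e : R * R * R => e.1) fst); [exact: cvg_fst|exact: cvg_fst].
have cg : continuous (fun e => `|e2e0 e|).
  move=> e; apply: cvg_norm; apply: cvgB; last by apply: cvgMl_tmp; exact: cf.
  apply: cvgB; first by apply: cvgB; [exact: cvg_snd|exact: c1].
  by apply: cvgMl_tmp; rewrite expr2; apply: cvgM; exact: cf.
have M0 n : 0 <= M / 2 ^+ (n0 + n).
  by have [e0 [e1 [e2 [_ _ _ _ h2]]]] := h n; apply: le_trans h2; exact: normr_ge0.
have Mdec n n' : (n <= n')%N -> M / 2 ^+ (n0 + n') <= M / 2 ^+ (n0 + n).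
  move=> nn; have M00 : 0 <= M by have := M0 0%N; rewrite pmulr_lge0// invr_gt0 exprn_gt0.
  by rewrite ler_wpM2l// lef_pV2 ?posrE ?exprn_gt0// ler_weXn2l ?ler1n// leq_add2l.
pose B n := f @^-1` `[tau - M / 2 ^+ (n0 + n), +oo[%classic `&`
   (fun e => `|e2e0 e|) @^-1` `]-oo, M / 2 ^+ (n0 + n)]%classic.
have [[[e0 e1] e2] [[/= K0 K1] K2] hB] : exists2 e, (K `*` K `*` K) e & forall n, B n e.
  apply: compact_nested.
  - by apply: compact_setX => //; exact: compact_setX.
  - move=> n; apply: closedI.
      by apply: (closed_preimage cf); exact: rray_closed.
    by apply: (closed_preimage cg); exact: lray_closed.
  - move=> n n' nn e [/=]; rewrite !in_itv /= andbT => h1 h2.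
    split; rewrite /= in_itv /= ?andbT.
      by apply: le_trans h1; rewrite lerD2l lerN2; exact: Mdec.
    by apply: (le_trans h2); exact: Mdec.
  - move=> n; have [e0 [e1 [e2 [K0 K1 K2 h1 h2]]]] := h n.
    by exists (e0, e1, e2) => //; split; rewrite /= in_itv /= ?andbT.
exists e0, e1, e2; split=> //.
  rewrite -subr_le0; apply: (@le0_of_dyadic _ M n0) => n.
  by have [+ _] := hB n; rewrite /= in_itv /= andbT /f /= lerBlDr addrC -lerBlDr.
have : `|e2e0 (e0, e1, e2)| <= 0.
  by apply: (@le0_of_dyadic _ M n0) => n; have [_] := hB n; rewrite /= in_itv.
rewrite normr_le0 /e2e0 /= => /eqP e; lra.
Qed.

(** A grid point is only known to share its cell of level [n] with a point of [K], which locates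
    that point up to [2 ^ - n]. *)
Lemma cell_close (n x : nat) (e : R) :
  (x %/ 2 ^ n)%N%:R / 2 ^+ n <= e <= (x %/ 2 ^ n).+1%:R / 2 ^+ n ->
  `|e - x%:R / 2 ^+ (2 * n)| <= (2 ^+ n)^-1.
Proof.
have p2 : 0 < 2 ^+ n :> R by rewrite exprn_gt0.
have eN : 2 ^+ (2 * n) = 2 ^+ n * 2 ^+ n :> R by rewrite mul2n -addnn exprD.
have h1 : (x %/ 2 ^ n)%N%:R / 2 ^+ n <= x%:R / 2 ^+ (2 * n) :> R.
  rewrite eN invfM mulrA ler_pM2r ?invr_gt0// ler_pdivlMr// -natrX -natrM ler_nat.
  exact: leq_trunc_div.
have h2 : x%:R / 2 ^+ (2 * n) <= (x %/ 2 ^ n).+1%:R / 2 ^+ n :> R.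
  rewrite eN invfM mulrA ler_pM2r ?invr_gt0// ler_pdivrMr// -natrX -natrM ler_nat.
  by rewrite ltnW// ltn_ceil// expn_gt0.
move: h1 h2; rewrite -[(x %/ 2 ^ n).+1%:R]natr1 [(_ + 1) / _]mulrDl mul1r; set a := _ / _; set b := x%:R / _.
by move=> h1 h2 /andP[h3 h4]; rewrite ler_norml; lra.
Qed.

(** Moving the points by [eps] changes the step by [w] with [|w| <= 2 eps]. As [|2 t + w| <= 4], the
    quadratic term changes by at most [8 p1 eps], the linear one by [2 eps], and three further
    errors [eps] make [8 p1 + 5]. *)
Lemma approx_pattern (p q p1 tau eps t e0 e1 e2 x y z : R) :
  `|p| <= p1 -> `|q| <= 1 -> 0 <= t <= 1 -> tau <= t -> 0 <= eps <= 1 ->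
  `|e0 - x| <= eps -> `|e1 - y| <= eps -> `|e2 - z| <= eps ->
  y = x + t -> `|z - x - (p * t ^+ 2 + q * t)| <= eps ->
  tau - (8 * p1 + 5) * eps <= e1 - e0 /\
  `|e2 - e0 - p * (e1 - e0) ^+ 2 - q * (e1 - e0)| <= (8 * p1 + 5) * eps.
Proof.
move=> hp hq /andP[t0 t1] taut /andP[ep0 ep1] h0 h1 h2 ey hz.
have p10 : 0 <= p1 by apply: le_trans hp.
have pe : 0 <= p1 * eps by rewrite mulr_ge0.
pose w := (e1 - y) - (e0 - x).
have ew : e1 - e0 = t + w by rewrite /w ey; ring.
have hw : `|w| <= 2 * eps by apply: le_trans (ler_normB _ _) _; lra.
split.
  by rewrite ew; move: hw; rewrite ler_norml => /andP[+ _]; lra.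
have -> : e2 - e0 - p * (e1 - e0) ^+ 2 - q * (e1 - e0) =
   (e2 - z) - (e0 - x) + (z - x - (p * t ^+ 2 + q * t)) - p * ((2 * t + w) * w) - q * w.
  by rewrite ew; ring.
have b1 : `|p * ((2 * t + w) * w)| <= p1 * (4 * (2 * eps)).
  rewrite !normrM; apply: ler_pM => //.
  apply: ler_pM => //; apply: le_trans (ler_normD _ _) _.
  by rewrite ger0_norm ?mulr_ge0//; lra.
have b2 : `|q * w| <= 1 * (2 * eps) by rewrite normrM; apply: ler_pM.
set a1 := e2 - z in h2 *; set a2 := e0 - x in h0 *; set a3 := z - x - _ in hz *.
set a4 := p * _ in b1 *; set a5 := q * w in b2 *.
move: h0 h2 hz b1 b2; rewrite !ler_norml => /andP[? ?] /andP[? ?] /andP[? ?] /andP[? ?] /andP[? ?].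
by apply/andP; split; lra.
Qed.

End Limit.

Theorem proposition1p3 (R : realType) (p0 p1 q0 : R)
    (hp0 : 0 < p0) (hp01 : p0 < p1) (hq0 : 0 <= q0 < 1) :
  exists beta delta : R,
    [/\ 0 < beta < 1, 0 < delta &
      forall E : set (measurableTypeR R),
        measurable E -> E `<=` `[0, 1] ->
        ((1 - delta)%:E <= hausdorff_content beta E)%E ->
        forall p q : R, p0 <= `|p| <= p1 -> `|q| <= q0 ->
          exists x t : R,
            t != 0 /\ [set x; x + t; x + p * t ^+ 2 + q * t] `<=` E].
Proof.
(* As [384 = 3 * 128], the number [s = g ^ - 3] satisfies [s ^ 128 = 1/2]. *)
pose g : R := 2 `^ 384%:R^-1.
have g384 : g ^+ 384 = 2.
  by rewrite -powR_mulrn ?powR_ge0// -powRrM mulVf// powRr1.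
have g0 : 0 < g by rewrite powR_gt0.
have g1 : 1 < g.
  rewrite ltNge; apply/negP => gle; have := exprn_ile1 384 (ltW g0) gle.
  by rewrite g384; lra.
clearbody g.
pose s := (g ^+ 3)^-1.
have g3 : 1 < g ^+ 3 by rewrite exprn_egt1.
have s0 : 0 < s by rewrite invr_gt0 exprn_gt0.
have s1 : s < 1 by rewrite invf_lt1// exprn_gt0.
have s128 : s ^+ 128 = 2^-1 by rewrite exprVn -exprM g384.
have gs : g ^+ 3 * s = 1 by rewrite divff// gt_eqF// exprn_gt0.
clearbody s.
(* Then [g * rho ^ 2 = (1 + g) / 2] lies strictly between [1] and [g]: the loss in comparing content
   with capacity stays within the growth that the densities are allowed. *)
pose rho := Num.sqrt ((1 + g) / (2 * g)).
have r2 : rho ^+ 2 = (1 + g) / (2 * g).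
  by rewrite sqr_sqrtr// divr_ge0 ?mulr_ge0 ?addr_ge0// ltW.
have gr : 1 < g * rho ^+ 2.
  have -> : g * rho ^+ 2 = (1 + g) / 2 by rewrite r2; field; rewrite gt_eqF.
  by rewrite ltr_pdivlMr//; lra.
have rho01 : 0 < rho < 1.
  have q0' : 0 < (1 + g) / (2 * g) by rewrite divr_gt0 ?mulr_gt0 ?addr_gt0.
  rewrite sqrtr_gt0 q0' /= -[ltRHS]sqrtr1 ltr_sqrt//.
  by rewrite ltr_pdivrMr ?mulr_gt0//; lra.
clearbody rho.
have [j hj] := density_pattern hp0 (ltW hp01) s0 s1 s128 (ltW g1) gs.
have C00 : 0 < 4 / (1 - rho) ^+ 2.
  by rewrite divr_gt0// exprn_gt0// subr_gt0; case/andP: rho01.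
have [k0 hk0] := hj _ C00.
have [beta [delta [beta01 delta0 hE]]] := frostman_densities k0 g1 rho01 gr.
exists beta, delta; split=> // E mE E01 cE p q hp hq.
have [K [clK KE hK]] := hE E mE E01 cE.
have hq1 : `|q| <= 1 by case/andP: hq0 => _ /ltW; exact: le_trans.
(* [2 ^ - j] is the guaranteed step, and [8 * p1 + 5] multiplies the discretisation error
   [2 ^ - (k0 + n)]. *)
have [|n|e0 [e1 [e2 [K0 K1 K2 ht e2E]]]] :=
  @pattern_limit R K p q (2 ^+ j)^-1 (8 * p1 + 5) k0 clK.
- by apply: subset_trans KE E01.
- set n' := (k0 + n)%N.
  have kn : (k0 <= n')%N by rewrite leq_addr.
  have [d hd hdK] := hK n' kn.
  have [x [t [y [z [tj jn yE zE [[xN yN zN] [dx dy dz]]]]]]] := hk0 n' d p q kn hp hq1 hd.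
  have lt_div a : (a < 2 ^ (2 * n') -> a %/ 2 ^ n' < 2 ^ n')%N.
    by move=> aN; rewrite ltn_divLR ?expn_gt0// -expnD addnn -mul2n.
  have [e0 Ke0 /cell_close h0] := hdK _ (lt_div _ xN) dx.
  have [e1 Ke1 /cell_close h1] := hdK _ (lt_div _ yN) dy.
  have [e2 Ke2 /cell_close h2] := hdK _ (lt_div _ zN) dz.
  have N0 : 0 < 2 ^+ (2 * n') :> R by rewrite exprn_gt0.
  have p2 : 0 < 2 ^+ n' :> R by rewrite exprn_gt0.
  exists e0, e1, e2.
  have [||||||b1 b2] // := @approx_pattern R p q p1 (2 ^+ j)^-1 (2 ^+ n')^-1
    (t%:R / 2 ^+ (2 * n')) e0 e1 e2 (x%:R / 2 ^+ (2 * n')) (y%:R / 2 ^+ (2 * n'))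
    (z%:R / 2 ^+ (2 * n')) _ hq1 _ _ _ h0 h1 h2.
  + by case/andP: hp.
  + rewrite divr_ge0 ?(ltW N0)//= ler_pdivrMr// mul1r -natrX ler_nat.
    by apply: ltnW; apply: leq_ltn_trans yN; rewrite yE leq_addl.
  + rewrite ler_pdivlMr// mulrC ler_pdivrMr ?exprn_gt0// -!natrX -natrM ler_nat.
    by rewrite -(subnK jn) expnD leq_mul2r tj orbT.
  + by rewrite invr_ge0 (ltW p2) /= invf_le1// exprn_ege1// ler1n.
  + by rewrite yE natrD mulrDl.
  have zR : z%:R = x%:R + (Num.floor (p * t%:R ^+ 2 / 2 ^+ (2 * n') + q * t%:R))%:~R :> R.
    by rewrite -[LHS]/(z%:Z%:~R) zE intrD.
  have [e he fE] := floor_err (p * t%:R ^+ 2 / 2 ^+ (2 * n') + q * t%:R).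
  rewrite fE in zR.
  rewrite zR [X in `|X|](_ : _ = - e / 2 ^+ (2 * n')); last by field; rewrite gt_eqF.
  rewrite normrM normrN (ger0_norm (_ : 0 <= e)); last by case/andP: he.
  rewrite ger0_norm ?invr_ge0 ?(ltW N0)//.
  apply: (@le_trans _ _ (1 / 2 ^+ (2 * n'))).
    by rewrite ler_pM2r ?invr_gt0//; case/andP: he => _ /ltW.
  rewrite mul1r lef_pV2 ?posrE// ler_weXn2l ?ler1n//.
  by rewrite mul2n -addnn leq_addr.
exists e0, (e1 - e0); split.
  by rewrite gt_eqF// (lt_le_trans _ ht)// invr_gt0 exprn_gt0.
move=> w [[->|->]|->]; first exact: KE.
  by rewrite addrC subrK; exact: KE.
by rewrite -e2E; exact: KE.
Qed.
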